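(* The complex $(2,3,5)$-structures given by the models $\mathsf N.6$ and $\mathsf D.6_a$ with $a\neq0$, and all their real forms, do not admit (non-trivial) almost-Einstein scales. The space of almost-Einstein scales is 7-dimensional for the flat model, 2-dimensional for the $\mathsf N.7_c$ models ($c\in\mathbb C$) and their real forms, and 1-dimensional for the $\mathsf D.6_0$ model and its real forms.
   Context: **$(2,3,5)$-distributions and Cartan geometry.** A $(2,3,5)$-distribution on a 5-manifold $M$ is a rank 2 subbundle $\mathcal D\subset TM$ with $[\mathcal D,\mathcal D]$ of rank 3 and $[\mathcal D,[\mathcal D,\mathcal D]]$ of rank 5. They are equivalent to regular, normal Cartan geometries $(\mathcal G\to M,\omega)$ of type $(G_2,P)$, $P=P_1$ (split real form over $\mathbb R$; holomorphic category over $\mathbb C$). All considerations are local. The flat model is the one with zero Cartan curvature. **$G_2$ data.** $\mathfrak g$ is the complex simple Lie algebra of type $G_2$, realised (with commutator bracket $[\cdot,\cdot]$) as the set of matrices acting on $\mathbb V=\mathbb C^7$ $$\begin{pmatrix} 2z_1+z_2&b_{10}&b_{11}&\sqrt2 b_{21}&b_{31}&b_{32}&0\\ a_{10}&z_1+z_2&b_{01}&\sqrt2 b_{11}&-b_{21}&0&-b_{32}\\ a_{11}&a_{01}&z_1&-\sqrt2 b_{10}&0&b_{21}&-b_{31}\\ \sqrt2a_{21}&\sqrt2a_{11}&-\sqrt2a_{10}&0&\sqrt2b_{10}&-\sqrt2b_{11}&-\sqrt2b_{21}\\ a_{31}&-a_{21}&0&\sqrt2a_{10}&-z_1&-b_{01}&-b_{11}\\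 a_{32}&0&a_{21}&-\sqrt2a_{11}&-a_{01}&-z_1-z_2&-b_{10}\\ 0&-a_{32}&-a_{31}&-\sqrt2a_{21}&-a_{11}&-a_{10}&-2z_1-z_2\end{pmatrix}.$$ $\mathsf Z_i$, $f_{st}$, $e_{st}$ denote the matrices for which $z_i$, $a_{st}$, $b_{st}$ respectively equals $1$ and all other parameters vanish; $h_{01}=[e_{01},f_{01}]=-\mathsf Z_1+2\mathsf Z_2$. $\mathfrak p=\langle\mathsf Z_1,\mathsf Z_2,e_{01},f_{01},e_{10},e_{11},e_{21},e_{31},e_{32}\rangle$ is the Lie algebra of $P$. The $f_{st}^*$ ($st=10,11,21,31,32$) denote the basis of $(\mathfrak g/\mathfrak p)^*$ dual to the classes of the $f_{st}$, with $(\alpha\wedge\beta)(x,y)=\alpha(x)\beta(y)-\alpha(y)\beta(x)$. **Nurowski conformal structure and almost-Einstein scales.** On $\mathfrak g/\mathfrak p$ the quadratic form $a_{10}a_{32}+a_{11}a_{31}+a_{21}^2$ is $P$-invariant up to scale, and via $TM\cong\mathcal G\times_P\mathfrak g/\mathfrak p$ it defines a canonical conformal structure $\mathsf c_{\mathcal D}$ on $M$. An almost-Einstein scale is a solution $\sigma$ (a section of the density bundle of conformal weight 1) of the linear equation: the trace-free part of $(\nabla_i\nabla_j+\mathsf P_{ij})\sigma$ is zero, where $\nabla$ and the Schouten tensor $\mathsf P$ are those of any metric in $\mathsf c_{\mathcal D}$; where $\sigma\ne0$, this says that $\sigma^{-2}\mathbf g$ (with $\mathbf g$ the conformal metric) is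 an Einstein metric in $\mathsf c_{\mathcal D}$. Almost-Einstein scales correspond bijectively to parallel sections of the standard tractor bundle $\mathcal G\times_P\mathbb V$ for the linear connection induced by $\omega$. **Models.** Each model below is a subspace $\mathfrak f\subset\mathfrak g$ with $\kappa\in\bigwedge^2(\mathfrak g/\mathfrak p)^*\otimes\mathfrak g$, a Lie algebra for $[x,y]_{\mathfrak f}=[x,y]-\kappa(x,y)$; put $\mathfrak f^i=\mathfrak f\cap\mathfrak g^i$, where $\mathfrak g^i$ is the sum of the $\mathrm{ad}_{\mathsf Z_1}$-eigenspaces with eigenvalue $\ge i$ (so $\mathfrak p=\mathfrak g^0$). The corresponding distribution is the homogeneous one on (local) $F/F^0$ given by $\mathfrak f^{-1}/\mathfrak f^0\subset\mathfrak f/\mathfrak f^0\cong\mathfrak g/\mathfrak p$, with Cartan curvature $\kappa$. A real form is the fixed-point set $\mathfrak f^\psi$ (with induced filtration) of an antilinear involutive automorphism $\psi$ of $\mathfrak g$ preserving $\mathfrak p$ and restricting to an anti-involution of $(\mathfrak f,[\cdot,\cdot]_{\mathfrak f})$. $\mathsf N.7_c$: basis $\mathsf Z_2$, $f_{01}$, $f_{10}+ce_{10}$, $f_{11}$, $f_{21}$, $f_{31}$, $f_{32}$; $\kappa=f_{10}^*\wedge f_{31}^*\otimes f_{01}$. $\mathsf N.6$: basis $f_{01}$, $f_{10}+e_{01}+6e_{10}+2e_{32}$, $f_{11}+\mathsf Z_1-2\mathsf Z_2+2e_{31}$, $f_{21}+9e_{10}+2e_{21}$, $f_{31}-2\mathsf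 Z_1+\mathsf Z_2-e_{11}-4e_{31}$, $f_{32}-e_{10}$; $\kappa=42\kappa_4-30\kappa_5+20\kappa_6-4\kappa_7+6\kappa_8$, where $\kappa_4=f_{10}^*\wedge f_{31}^*\otimes f_{01}$, $\kappa_5=f_{10}^*\wedge f_{31}^*\otimes e_{10}-2f_{21}^*\wedge f_{31}^*\otimes f_{01}$, $\kappa_6=-f_{10}^*\wedge f_{31}^*\otimes e_{21}-2f_{21}^*\wedge f_{31}^*\otimes e_{10}+f_{31}^*\wedge f_{32}^*\otimes f_{01}$, $\kappa_7=(f_{10}^*\wedge f_{32}^*-f_{11}^*\wedge f_{31}^* )\otimes e_{31}-2f_{10}^*\wedge f_{31}^*\otimes e_{32}+6f_{21}^*\wedge f_{31}^*\otimes e_{21}+3f_{31}^*\wedge f_{32}^*\otimes e_{10}$, $\kappa_8=f_{21}^*\wedge f_{31}^*\otimes e_{32}-f_{21}^*\wedge f_{32}^*\otimes e_{31}-f_{31}^*\wedge f_{32}^*\otimes e_{21}$. $\mathsf D.6_a$: basis $h_{01}$, $f_{10}+ae_{11}+e_{32}$, $f_{11}+ae_{10}+e_{31}$, $f_{21}+(a^2+1)e_{21}$, $f_{31}+e_{11}+a(a^2+\tfrac13)e_{32}$, $f_{32}+e_{10}+a(a^2+\tfrac13)e_{31}$; $\kappa=-4\kappa_4+\tfrac{4a}{3}\kappa_6-2a^2\kappa_8$, where $\kappa_4=(f_{10}^*\wedge f_{32}^*-f_{11}^*\wedge f_{31}^* )\otimes h_{01}-f_{10}^*\wedge f_{31}^*\otimes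 e_{01}-f_{11}^*\wedge f_{32}^*\otimes f_{01}$, $\kappa_6=(f_{11}^*\wedge f_{31}^*-f_{10}^*\wedge f_{32}^* )\otimes e_{21}-2f_{21}^*\wedge f_{32}^*\otimes e_{10}+2f_{21}^*\wedge f_{31}^*\otimes e_{11}+f_{31}^*\wedge f_{32}^*\otimes h_{01}$, $\kappa_8=f_{21}^*\wedge f_{31}^*\otimes e_{32}-f_{21}^*\wedge f_{32}^*\otimes e_{31}-f_{31}^*\wedge f_{32}^*\otimes e_{21}$. *)

(* Defs.v *)
From HB Require Import structures.
From mathcomp Require Import all_boot all_order all_algebra.
From mathcomp Require Import complex.
From mathcomp Require Import all_classical all_reals all_analysis.

Set Implicit Arguments.
Unset Strict Implicit.
Unset Printing Implicit Defensive.

Import Order.TTheory GRing.Theory Num.Theory.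
Import numFieldNormedType.Exports.

Local Open Scope classical_set_scope.
Local Open Scope ring_scope.

(* Pseudo-Riemannian geometry in a chart of K^5, with K either the reals or the
   complex numbers; over the complex numbers every derivative is a complex
   derivative, so this is the holomorphic category. *)
Section ChartGeometry.
Variable K : numFieldType.
Implicit Types (U : set 'rV[K]_5) (f sigma : 'rV[K]_5 -> K)
  (g : 'rV[K]_5 -> 'M[K]_5) (x : 'rV[K]_5) (i j k : 'I_5).

Definition partial i f : 'rV[K]_5 -> K := fun x => 'D_(delta_mx 0 i) f x.

Fixpoint of_class_C (m : nat) U f : Prop :=
  if m is m'.+1 then
    (forall x, U x -> differentiable f x) /\
    (forall i, of_class_C m' U (partial i f))
  else forall x, U x -> {for x, continuous f}.

Definition smooth U f : Prop := forall m, of_class_C m U f.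

(* Gamma^k_{ij} of the Levi-Civita connection *)
Definition christoffel g k i j : 'rV[K]_5 -> K := fun x =>
  2^-1 * \sum_l invmx (g x) k l *
    (partial i (fun y => g y j l) x + partial j (fun y => g y i l) x
     - partial l (fun y => g y i j) x).

Definition ricci g x : 'M[K]_5 := \matrix_(i, j) \sum_k
  (partial k (christoffel g k i j) x - partial j (christoffel g k i k) x
   + \sum_l (christoffel g k k l x * christoffel g l i j x
             - christoffel g k j l x * christoffel g l i k x)).

Definition metric_trace g x (T : 'M[K]_5) : K :=
  \sum_i \sum_j invmx (g x) i j * T i j.

Definition tracefree g x (T : 'M[K]_5) : 'M[K]_5 :=
  T - (metric_trace g x T / 5) *: g x.

(* (Ric - scal / (2 (n - 1)) g) / (n - 2) in dimension n = 5 *)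
Definition schouten g x : 'M[K]_5 :=
  3^-1 *: (ricci g x - (metric_trace g x (ricci g x) / 8) *: g x).

Definition hessian g sigma x : 'M[K]_5 := \matrix_(i, j)
  (partial i (partial j sigma) x
   - \sum_k christoffel g k i j x * partial k sigma x).

(* Densities of conformal weight 1 are written as functions in the
   trivialisation given by the representative metric g; replacing g by
   Omega^2 g replaces sigma by Omega sigma and preserves the equation. *)
Definition almost_einstein_scale U g sigma : Prop :=
  smooth U sigma /\
  forall x, U x ->
    tracefree g x (hessian g sigma x + sigma x *: schouten g x) = 0.

Definition only_trivial_scales U g : Prop :=
  forall W sigma, open W -> W `<=` U ->
    almost_einstein_scale W g sigma -> forall x, W x -> sigma x = 0.

(* The germs at each point of U of almost-Einstein scales form a K-vector
   space with a basis of d elements, namely the germs of the s a. *)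
Definition scales_of_dim (d : nat) U g : Prop :=
  forall x0, U x0 ->
  exists (V : set 'rV[K]_5) (s : 'I_d -> 'rV[K]_5 -> K),
    [/\ open V, V x0, V `<=` U,
        forall a, almost_einstein_scale V g (s a)
      & forall W tau, open W -> W x0 -> W `<=` U ->
          almost_einstein_scale W g tau ->
          exists! c : 'rV[K]_d,
            \forall x \near x0, tau x = \sum_a c 0 a * s a x].

End ChartGeometry.

Section G2.
Variable R : realType.
Notation C := R[i].

Definition g2mx (z1 z2 a01 a10 a11 a21 a31 a32 b01 b10 b11 b21 b31 b32 : C) :
    'M[C]_7 :=
  let r2 : C := sqrtC 2 in
  \matrix_(i < 7, j < 7) nth 0 (nth [::] [::
    [:: 2 * z1 + z2; b10; b11; r2 * b21; b31; b32; 0];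
    [:: a10; z1 + z2; b01; r2 * b11; - b21; 0; - b32];
    [:: a11; a01; z1; - (r2 * b10); 0; b21; - b31];
    [:: r2 * a21; r2 * a11; - (r2 * a10); 0; r2 * b10; - (r2 * b11);
        - (r2 * b21)];
    [:: a31; - a21; 0; r2 * a10; - z1; - b01; - b11];
    [:: a32; 0; a21; - (r2 * a11); - a01; - z1 - z2; - b10];
    [:: 0; - a32; - a31; - (r2 * a21); - a11; - a10; - (2 * z1) - z2]] i) j.

Definition Z1  := g2mx 1 0  0 0 0 0 0 0  0 0 0 0 0 0.
Definition Z2  := g2mx 0 1  0 0 0 0 0 0  0 0 0 0 0 0.
Definition f01 := g2mx 0 0  1 0 0 0 0 0  0 0 0 0 0 0.
Definition f10 := g2mx 0 0  0 1 0 0 0 0  0 0 0 0 0 0.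
Definition f11 := g2mx 0 0  0 0 1 0 0 0  0 0 0 0 0 0.
Definition f21 := g2mx 0 0  0 0 0 1 0 0  0 0 0 0 0 0.
Definition f31 := g2mx 0 0  0 0 0 0 1 0  0 0 0 0 0 0.
Definition f32 := g2mx 0 0  0 0 0 0 0 1  0 0 0 0 0 0.
Definition e01 := g2mx 0 0  0 0 0 0 0 0  1 0 0 0 0 0.
Definition e10 := g2mx 0 0  0 0 0 0 0 0  0 1 0 0 0 0.
Definition e11 := g2mx 0 0  0 0 0 0 0 0  0 0 1 0 0 0.
Definition e21 := g2mx 0 0  0 0 0 0 0 0  0 0 0 1 0 0.
Definition e31 := g2mx 0 0  0 0 0 0 0 0  0 0 0 0 1 0.
Definition e32 := g2mx 0 0  0 0 0 0 0 0  0 0 0 0 0 1.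

Definition bracket (x y : 'M[C]_7) : 'M[C]_7 := x *m y - y *m x.

Definition h01 := bracket e01 f01.

Definition g2 : {vspace 'M[C]_7} :=
  <<[:: Z1; Z2; f01; f10; f11; f21; f31; f32;
        e01; e10; e11; e21; e31; e32]%R>>%VS.

Definition parab : {vspace 'M[C]_7} :=
  <<[:: Z1; Z2; e01; f01; e10; e11; e21; e31; e32]%R>>%VS.

(* The basis of (g/p)^* dual to the classes of the f_st, as functionals on g
   vanishing on p: the coordinates a_st, read off the first column. *)
Definition df10 (x : 'M[C]_7) : C := x (inord 1) ord0.
Definition df11 (x : 'M[C]_7) : C := x (inord 2) ord0.
Definition df21 (x : 'M[C]_7) : C := x (inord 3) ord0 / sqrtC 2.
Definition df31 (x : 'M[C]_7) : C := x (inord 4) ord0.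
Definition df32 (x : 'M[C]_7) : C := x (inord 5) ord0.

Definition wedge (alpha beta : 'M[C]_7 -> C) (x y : 'M[C]_7) : C :=
  alpha x * beta y - alpha y * beta x.

(* The P-conformally invariant quadratic form on g/p. *)
Definition nurowski_form (x : 'M[C]_7) : C :=
  df10 x * df32 x + df11 x * df31 x + df21 x ^+ 2.

Record model := Model {
  mspace : {vspace 'M[C]_7};
  curv : 'M[C]_7 -> 'M[C]_7 -> 'M[C]_7 }.

Definition mbracket (M : model) (x y : 'M[C]_7) : 'M[C]_7 :=
  bracket x y - curv M x y.

Definition flat_model : model := Model g2 (fun _ _ => 0).

Definition modelN7 (c : C) : model := Model
  <<[:: Z2; f01; f10 + c *: e10; f11; f21; f31; f32]%R>>%VS
  (fun x y => wedge df10 df31 x y *: f01).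

Definition modelN6 : model := Model
  <<[:: f01; f10 + e01 + 6 *: e10 + 2 *: e32;
        f11 + Z1 - 2 *: Z2 + 2 *: e31; f21 + 9 *: e10 + 2 *: e21;
        f31 - 2 *: Z1 + Z2 - e11 - 4 *: e31; f32 - e10]%R>>%VS
  (fun x y =>
    let k4 := wedge df10 df31 x y *: f01 in
    let k5 := wedge df10 df31 x y *: e10
              - (2 * wedge df21 df31 x y) *: f01 in
    let k6 := - (wedge df10 df31 x y *: e21)
              - (2 * wedge df21 df31 x y) *: e10
              + wedge df31 df32 x y *: f01 in
    let k7 := (wedge df10 df32 x y - wedge df11 df31 x y) *: e31
              - (2 * wedge df10 df31 x y) *: e32
              + (6 * wedge df21 df31 x y) *: e21
              + (3 * wedge df31 df32 x y) *: e10 in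
    let k8 := wedge df21 df31 x y *: e32 - wedge df21 df32 x y *: e31
              - wedge df31 df32 x y *: e21 in
    42 *: k4 - 30 *: k5 + 20 *: k6 - 4 *: k7 + 6 *: k8).

Definition modelD6 (a : C) : model := Model
  <<[:: h01; f10 + a *: e11 + e32; f11 + a *: e10 + e31;
        f21 + (a ^+ 2 + 1) *: e21;
        f31 + e11 + (a * (a ^+ 2 + 1 / 3)) *: e32;
        f32 + e10 + (a * (a ^+ 2 + 1 / 3)) *: e31]%R>>%VS
  (fun x y =>
    let k4 := (wedge df10 df32 x y - wedge df11 df31 x y) *: h01
              - wedge df10 df31 x y *: e01 - wedge df11 df32 x y *: f01 in
    let k6 := (wedge df11 df31 x y - wedge df10 df32 x y) *: e21
              - (2 * wedge df21 df32 x y) *: e10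
              + (2 * wedge df21 df31 x y) *: e11
              + wedge df31 df32 x y *: h01 in
    let k8 := wedge df21 df31 x y *: e32 - wedge df21 df32 x y *: e31
              - wedge df31 df32 x y *: e21 in
    - 4 *: k4 + (4 * a / 3) *: k6 - (2 * a ^+ 2) *: k8).

Record real_form_involution (M : model) (psi : 'M[C]_7 -> 'M[C]_7) : Prop := {
  invol_g2 : forall x, x \in g2 -> psi x \in g2;
  invol_add : forall x y, x \in g2 -> y \in g2 -> psi (x + y) = psi x + psi y;
  invol_scale : forall (c : C) x, x \in g2 -> psi (c *: x) = conjc c *: psi x;
  invol_bracket : forall x y, x \in g2 -> y \in g2 ->
    psi (bracket x y) = bracket (psi x) (psi y);
  invol_invol : forall x, x \in g2 -> psi (psi x) = x;
  invol_parab : forall x, x \in parab -> psi x \in parab;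
  invol_space : forall x, x \in mspace M -> psi x \in mspace M;
  invol_mbracket : forall x y, x \in mspace M -> y \in mspace M ->
    psi (mbracket M x y) = mbracket M (psi x) (psi y) }.

(* K is the field of the category (R or C) and iota its embedding in C.  For the
   complex model fK is f itself, for a real form it is f^psi. *)
Section LocalModel.
Variables (K : numFieldType) (iota : K -> C) (M : model) (fK : set 'M[C]_7).

Definition is_basis_over n (B : 'I_n -> 'M[C]_7) : Prop :=
  (forall k, fK (B k)) /\
  forall x, fK x -> exists! c : 'rV[K]_n, x = \sum_k iota (c 0 k) *: B k.

(* The value Theta_x(v) in fK of the 1-form Theta whose component along B k at
   the coordinate vector field d/dx_i is theta x i k. *)
Definition form_at n (B : 'I_n -> 'M[C]_7) (theta : 'rV[K]_5 -> 'M[K]_(5, n))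
    (x v : 'rV[K]_5) : 'M[C]_7 :=
  \sum_k iota ((v *m theta x) 0 k) *: B k.

(* A chart U of the local homogeneous space F/F^0 with a local section to F is
   given by the pull-back Theta of the Maurer-Cartan form of F: an fK-valued
   1-form on U with d Theta + [Theta, Theta]_f / 2 = 0 inducing isomorphisms
   T_x U -> fK / (fK :&: p).  As [,]_f = [,] - kappa, this Theta is also the
   pull-back of the Cartan connection omega along that section, and its
   curvature d Theta + [Theta, Theta] / 2 is kappa. *)
Record maurer_cartan n (B : 'I_n -> 'M[C]_7) (U : set 'rV[K]_5)
    (theta : 'rV[K]_5 -> 'M[K]_(5, n)) : Prop := {
  mc_open : open U;
  mc_smooth : forall i k, smooth U (fun x => theta x i k);
  mc_equation : forall x, U x -> forall i j : 'I_5,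
    \sum_k iota (partial i (fun y => theta y j k) x
                 - partial j (fun y => theta y i k) x) *: B k
    + mbracket M (form_at B theta x (delta_mx 0 i))
                 (form_at B theta x (delta_mx 0 j)) = 0;
  mc_coframe : forall x, U x -> forall v : 'rV[K]_5,
    form_at B theta x v \in parab -> v = 0 }.

(* g is a metric of the conformal class of U: a K-valued multiple of the
   nurowski_form of Theta by a square Omega^2.  The constant lam accounts for
   the fact that on a real form nurowski_form is only real up to a constant. *)
Definition in_conformal_class n (B : 'I_n -> 'M[C]_7) (U : set 'rV[K]_5)
    (theta : 'rV[K]_5 -> 'M[K]_(5, n)) (g : 'rV[K]_5 -> 'M[K]_5) : Prop :=
  exists (lam : C) (Omega : 'rV[K]_5 -> K),
  [/\ lam != 0, smooth U Omega, forall x, U x -> Omega x != 0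
    & forall x, U x -> (g x)^T = g x /\
        forall v : 'rV[K]_5, iota ((v *m g x *m v^T) 0 0) =
          lam * iota (Omega x) ^+ 2 * nurowski_form (form_at B theta x v)].

Definition local_model_metric (U : set 'rV[K]_5) (g : 'rV[K]_5 -> 'M[K]_5) :
    Prop :=
  exists n (B : 'I_n -> 'M[C]_7) (theta : 'rV[K]_5 -> 'M[K]_(5, n)),
  [/\ is_basis_over B, maurer_cartan B U theta
    & in_conformal_class B U theta g].

End LocalModel.

Definition complex_model_metric (M : model) :
    set 'rV[C]_5 -> ('rV[C]_5 -> 'M[C]_5) -> Prop :=
  local_model_metric (K := C) id M [set x | x \in mspace M].

Definition real_form_metric (M : model) (psi : 'M[C]_7 -> 'M[C]_7) :
    set 'rV[R]_5 -> ('rV[R]_5 -> 'M[R]_5) -> Prop :=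
  local_model_metric (K := R) (real_complex R) M
    [set x | x \in mspace M /\ psi x = x].

Definition complex_no_scales (M : model) : Prop :=
  forall U g, complex_model_metric M U g -> only_trivial_scales U g.

Definition real_forms_no_scales (M : model) : Prop :=
  forall psi, real_form_involution M psi ->
  forall U g, real_form_metric M psi U g -> only_trivial_scales U g.

Definition complex_scales_dim (M : model) (d : nat) : Prop :=
  forall U g, complex_model_metric M U g -> scales_of_dim d U g.

Definition real_forms_scales_dim (M : model) (d : nat) : Prop :=
  forall psi, real_form_involution M psi ->
  forall U g, real_form_metric M psi U g -> scales_of_dim d U g.

End G2.

(* Main.v *)
From HB Require Import structures.
Require Import Defs.
From mathcomp Require Import all_boot all_order all_algebra.
From mathcomp Require Import complex ring lra.
From mathcomp Require Import all_classical all_reals all_analysis.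

(** Why the theorem is true.

Let K be the real or the complex numbers, and let Theta be the pull-back of the
Maurer-Cartan form to a chart U.  The matrices Theta_i are skew for the split
pairing hf on C^7, so nabla_i = D_i + Theta_i is a metric connection on C^7-valued
functions, and its curvature is kappa (Theta_i, Theta_j).  This is the standard
tractor connection.

Scales are parallel tractors.  The first basis vector spans the null line fixed by
the parabolic; rescaled by a factor Omega it gives a null section X whose
derivatives m_i = nabla_i X satisfy hf m_i m_j = g_ij.  Completing X, m_i by the
null section Y dual to X gives a moving frame with
  nabla_i m_j = Gamma^k_ij m_k - Q_ij X - g_ij Y   (gauss),
where Gamma is the Levi-Civita connection.  The models are normal: a trace of kappa
vanishes.  Taking this trace of the curvature of nabla on m_i gives
Ric = 3 Q + (tr Q) g, hence Q is the Schouten tensor (schoutenE).  Consequently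
hf X s solves the almost-Einstein equation whenever s is parallel
(scale_of_parallel), and a solution sigma comes from the section with coordinates
sigma, its differential and a trace term; the last component of the derivative of
that section is killed by the same trace of kappa (parallel_of_scale).

Upper bounds.  A parallel s is annihilated by every value of kappa (curv_kills).
Moreover, if one coordinate of s vanishes identically, then that coordinate of A s
vanishes for elements A of the model algebra with arbitrary class modulo the
parabolic (derive_coord).  Alternating the two facts leaves s = 0 for N.6 and for
D.6_a with a nonzero, leaves span (e_6, e_7) for N.7_c and the line of e_1 + e_7
for D.6_0.

Lower bounds.  On these spaces, and on all of C^7 for the flat model, kappa acts
by zero and the model algebra acts by endomorphisms, so the restricted connection
is flat.  A flat linear system has a local fundamental matrix (frobenius).  It is
built as a product integral: the transport along a segment is the limit of products
of midpoint steps over its dyadic subdivisions, and flatness makes the transport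
around a triangle trivial up to third order in its size, which suffices to
differentiate the transport from a fixed base point.

Real forms.  The antilinear involution preserves the parabolic, so a coframe that
is independent over R modulo the parabolic is independent over C
(rational_real); the complex-valued argument therefore applies to real charts.  The
real dimension of the space of scales equals the complex dimension of the space of
parallel tractors because the real and imaginary parts of a complex solution are
again solutions (scales_dim). *)

Set Implicit Arguments. Unset Strict Implicit. Unset Printing Implicit Defensive.
Import Order.TTheory GRing.Theory Num.Theory.
Import numFieldNormedType.Exports.
Import ComplexField.
Local Open Scope classical_set_scope.
Local Open Scope ring_scope.

(** * Partial derivatives and smooth functions *)

Section PartialDerivatives.
Variable K : numFieldType.
Implicit Types (f : 'rV[K]_5 -> K) (x h : 'rV[K]_5).

Lemma mx_norm_coord h i : `|h 0 i| <= `|h|.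
Proof.
rewrite [leRHS]mx_normE [leLHS]nngE num_le.
exact: (le_bigmax _ (fun ij : 'I_1 * 'I_5 => `|h ij.1 ij.2|%:nng) (0, i)).
Qed.

Lemma diff_sum f x h : differentiable f x ->
  'd f x h = \sum_i h 0 i * partial i f x.
Proof.
move=> df; rewrite [h in LHS]row_sum_delta linear_sum; apply: eq_bigr => i _.
by rewrite linearZ /= /partial deriveE.
Qed.

(** The epsilon-delta form of differentiability, the only one that is transported
between the norms in use. *)
Lemma diff_eps f x (e : K) : differentiable f x -> 0 < e ->
  exists2 d : K, 0 < d & forall h, `|h| < d ->
    `|f (h + x) - f x - \sum_i h 0 i * partial i f x| <= e * `|h|.
Proof.
move=> df e0; have /eqaddoP/(_ e e0) := diff_locally df.
move=> /nbhs_ballP[d /= d0 H]; exists d => // h hd.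
have := H h; rewrite -ball_normE /= sub0r normrN => /(_ hd).
by rewrite /cst !fctE /= -diff_sum // opprD addrA.
Qed.

(** Every approximating linear form is the differential, since linear maps on K^5 are
continuous; this is how derivatives of functions built by a limit are computed. *)
Lemma eps_diff f x (c : 'I_5 -> K) :
  (forall e : K, 0 < e -> exists2 d : K, 0 < d & forall h, `|h| < d ->
    `|f (h + x) - f x - \sum_i h 0 i * c i| <= e * `|h|) ->
  differentiable f x /\ forall i, partial i f x = c i.
Proof.
move=> H.
pose L (h : 'rV[K]_5) : K := \sum_i h 0 i * c i.
have Ll : linear L.
  move=> a u v; rewrite /L scaler_sumr -big_split; apply: eq_bigr => i _ /=.
  by rewrite !mxE mulrDl scalerAl.
pose Lm := GRing.isLinear.Build _ _ _ _ L Ll.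
pose LL : {linear 'rV[K]_5 -> K} := HB.pack L Lm.
have Lc : continuous LL.
  move=> h; apply: (@cvg_big K 'I_5 +%R 0 xpredT (@add_continuous K) _ _ _
    (fun i (y : 'rV[K]_5) => y 0 i * c i) (fun i => h 0 i * c i)
    (nbhs_filter h)) => i _.
  apply: cvgMl; exact: coord_continuous.
have HE : f \o shift x = cst (f x) + LL +o_ (0 : 'rV[K]_5) id.
  apply/eqaddoP => e /H[d d0 Hd]; apply/nbhs_ballP; exists d => //= h.
  rewrite -ball_normE /= sub0r normrN => /Hd.
  by rewrite /cst !fctE /= opprD addrA.
have dE := diff_unique Lc HE.
have df : differentiable f x.
  apply/diff_locallyP; split; first by rewrite dE.
  by rewrite dE.
split=> // i; rewrite /partial deriveE // dE /= /L (bigD1 i) //= big1.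
  by rewrite mxE !eqxx mul1r addr0.
by move=> j ji; rewrite mxE (negbTE ji) andbF mul0r.
Qed.

Lemma partial_near i f g x : (\forall y \near x, f y = g y) ->
  partial i f x = partial i g x.
Proof. exact: near_eq_derive. Qed.

Lemma differentiable_near f g x : (\forall y \near x, f y = g y) ->
  differentiable f x -> differentiable g x.
Proof.
move=> fg df; suff [] : differentiable g x /\ forall i, partial i g x = partial i f x by [].
apply: eps_diff => e e0; have [d d0 H] := diff_eps df e0.
move: fg => /nbhs_ballP[d' /= d'0 H'].
have cdd : (d >=< d')%O by apply: real_comparable; exact: gtr0_real.
have dd : 0 < Num.min d d' by rewrite comparable_lt_min // d0.
exists (Num.min d d') => // h; rewrite comparable_lt_min // => /andP[h1 h2].
rewrite -H'; last by rewrite -ball_normE /= opprD addrCA subrr addr0 normrN.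
rewrite -(H' x); last exact: ballxx.
exact: H.
Qed.

Lemma open_near (U : set 'rV[K]_5) x (P : 'rV[K]_5 -> Prop) : open U -> U x ->
  (forall y, U y -> P y) -> \forall y \near x, P y.
Proof. by move=> oU Ux H; apply: filterS H _; exact: open_nbhs_nbhs. Qed.

Lemma open_near_eq (U : set 'rV[K]_5) x f g : open U -> U x ->
  (forall y, U y -> f y = g y) -> \forall y \near x, f y = g y.
Proof. by move=> oU Ux H; exact: (@open_near U x (fun y => f y = g y)). Qed.

Lemma of_class_ext m (U : set 'rV[K]_5) f g : open U -> (forall x, U x -> f x = g x) ->
  of_class_C m U f -> of_class_C m U g.
Proof.
move=> oU; elim: m f g => [|m IH] f g fg /=.
  move=> H x Ux; have := H x Ux; rewrite /prop_for /continuous_at -fg // => H1.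
  apply: cvg_trans H1; apply: (near_eq_cvg (FF := nbhs_filter x)).
  exact: open_near_eq oU Ux fg.
move=> [df dp]; split.
  by move=> x Ux; apply: differentiable_near (df x Ux); exact: open_near_eq fg.
by move=> i; apply: IH (dp i) => x Ux; apply: partial_near; exact: open_near_eq fg.
Qed.

Lemma smooth_ext (U : set 'rV[K]_5) f g : open U -> (forall x, U x -> f x = g x) ->
  smooth U f -> smooth U g.
Proof. move=> oU fg H m; exact: of_class_ext (H m). Qed.

Lemma smooth_sub (U V : set 'rV[K]_5) f : V `<=` U -> smooth U f -> smooth V f.
Proof.
move=> VU H m; move/(_ m): H; elim: m f => [|m IH] f /=.
  by move=> H x /VU/H.
by move=> [df dp]; split; [move=> x /VU/df|move=> i; apply: IH].
Qed.

Lemma of_class_diff m (U : set 'rV[K]_5) f x : of_class_C m.+1 U f -> U x -> differentiable f x.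
Proof. by move=> [H _] /H. Qed.

Lemma of_class_le m (U : set 'rV[K]_5) f : of_class_C m.+1 U f -> of_class_C m U f.
Proof.
elim: m f => [|m IH] f [df dp] /=.
  by move=> x /df; exact: differentiable_continuous.
by split=> // i; exact: IH.
Qed.

Lemma smooth_diff (U : set 'rV[K]_5) f x : smooth U f -> U x -> differentiable f x.
Proof. by move=> /(_ 1); exact: of_class_diff. Qed.

Lemma smooth_partial (U : set 'rV[K]_5) f i : smooth U f -> smooth U (partial i f).
Proof. by move=> H m; have [_ ] := H m.+1; exact. Qed.

Lemma partial_cst i a x : partial i (fun=> a) x = 0.
Proof. exact: derive_cst. Qed.
Lemma partialD i f g x : differentiable f x -> differentiable g x ->
  partial i (fun y => f y + g y) x = partial i f x + partial i g x.
Proof. by move=> df dg; rewrite /partial deriveD //; exact: diff_derivable. Qed.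
Lemma partialM i f g x : differentiable f x -> differentiable g x ->
  partial i (fun y => f y * g y) x = partial i f x * g x + f x * partial i g x.
Proof.
move=> df dg; rewrite /partial deriveM; try exact: diff_derivable.
by rewrite addrC /GRing.scale /= [g x * _]mulrC.
Qed.
Lemma partialV i f x : differentiable f x -> f x != 0 ->
  partial i (fun y => (f y)^-1) x = - (f x)^-1 * (f x)^-1 * partial i f x.
Proof.
move=> df f0; rewrite /partial deriveV //; last exact: diff_derivable.
by rewrite -[LHS]/(- (f x ^+ 2)^-1 * _) expr2 invfM !mulNr.
Qed.
Lemma differentiableV' f x : differentiable f x -> f x != 0 ->
  differentiable (fun y => (f y)^-1) x.
Proof. by move=> df f0; apply: differentiableV. Qed.
Lemma differentiableM' f g x : differentiable f x -> differentiable g x ->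
  differentiable (fun y => f y * g y) x.
Proof. by move=> df dg; apply: differentiableM. Qed.
Lemma differentiableD' f g x : differentiable f x -> differentiable g x ->
  differentiable (fun y => f y + g y) x.
Proof. by move=> df dg; apply: differentiableD. Qed.

Section Smooth.
Variable U : set 'rV[K]_5.
Hypothesis oU : open U.

Lemma of_class_cst m a : of_class_C m U (fun=> a).
Proof.
elim: m a => [|m IH] a /=; first by move=> x _; apply: differentiable_continuous; exact: differentiable_cst.
split=> [x _|i]; first exact: differentiable_cst.
by apply: (of_class_ext oU _ (IH 0)) => x _; rewrite partial_cst.
Qed.
Lemma of_classD m f g : of_class_C m U f -> of_class_C m U g ->
  of_class_C m U (fun y => f y + g y).
Proof.
elim: m f g => [|m IH] f g /=.
  by move=> Hf Hg x Ux; apply: continuousD; [exact: Hf|exact: Hg].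
move=> [df pf] [dg pg]; split=> [x Ux|i]; first exact: differentiableD' (df x Ux) (dg x Ux).
apply: (of_class_ext oU _ (IH _ _ (pf i) (pg i))) => x Ux.
by rewrite partialD //; [exact: df|exact: dg].
Qed.
Lemma of_classM m f g : of_class_C m U f -> of_class_C m U g ->
  of_class_C m U (fun y => f y * g y).
Proof.
elim: m f g => [|m IH] f g.
  by move=> /= Hf Hg x Ux; apply: continuousM; [exact: Hf|exact: Hg].
move=> Hf Hg; have [df pf] := Hf; have [dg pg] := Hg.
split=> [x Ux|i]; first exact: differentiableM' (df x Ux) (dg x Ux).
have H1 := IH _ _ (pf i) (of_class_le Hg).
have H2 := IH _ _ (of_class_le Hf) (pg i).
apply: (of_class_ext oU _ (of_classD H1 H2)) => x Ux.
by rewrite partialM //; [exact: df|exact: dg].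
Qed.
Lemma of_classV m f : (forall x, U x -> f x != 0) -> of_class_C m U f ->
  of_class_C m U (fun y => (f y)^-1).
Proof.
move=> f0; elim: m => [|m IH].
  by move=> /= Hf x Ux; apply: continuousV; [exact: f0|exact: Hf].
move=> Hf; have [df pf] := Hf.
split=> [x Ux|i]; first exact: differentiableV' (df x Ux) (f0 x Ux).
have H0 := IH (of_class_le Hf).
have H1 := of_classM (of_class_cst m (-1)) (of_classM H0 (of_classM H0 (pf i))).
apply: (of_class_ext oU _ H1) => x Ux.
by rewrite partialV ?f0 //; [rewrite mulN1r !mulrA !mulNr|exact: df].
Qed.

Lemma smooth_cst a : smooth U (fun=> a).
Proof. move=> m; exact: of_class_cst. Qed.
Lemma smoothD f g : smooth U f -> smooth U g -> smooth U (fun y => f y + g y).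
Proof. by move=> Hf Hg m; exact: of_classD. Qed.
Lemma smoothM f g : smooth U f -> smooth U g -> smooth U (fun y => f y * g y).
Proof. by move=> Hf Hg m; exact: of_classM. Qed.
Lemma smoothV f : (forall x, U x -> f x != 0) -> smooth U f ->
  smooth U (fun y => (f y)^-1).
Proof. by move=> f0 Hf m; exact: of_classV. Qed.
Lemma smoothZ a f : smooth U f -> smooth U (fun y => a * f y).
Proof. by move=> Hf; apply: smoothM => //; exact: smooth_cst. Qed.
Lemma smoothN f : smooth U f -> smooth U (fun y => - f y).
Proof.
by move=> Hf; apply: (smooth_ext oU _ (smoothZ (-1) Hf)) => x _; rewrite mulN1r.
Qed.
Lemma smooth_sum (I : Type) (r : seq I) (P : pred I) (F : I -> 'rV[K]_5 -> K) :
  (forall i, P i -> smooth U (F i)) ->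
  smooth U (fun y => \sum_(i <- r | P i) F i y).
Proof.
move=> HF; elim: r => [|i r IH].
  by apply: (smooth_ext oU _ (smooth_cst 0)) => x _; rewrite big_nil.
case Pi: (P i); last by apply: (smooth_ext oU _ IH) => x _; rewrite big_cons Pi.
by apply: (smooth_ext oU _ (smoothD (HF i Pi) IH)) => x _; rewrite big_cons Pi.
Qed.
Lemma smooth_prod (I : Type) (r : seq I) (P : pred I) (F : I -> 'rV[K]_5 -> K) :
  (forall i, P i -> smooth U (F i)) ->
  smooth U (fun y => \prod_(i <- r | P i) F i y).
Proof.
move=> HF; elim: r => [|i r IH].
  by apply: (smooth_ext oU _ (smooth_cst 1)) => x _; rewrite big_nil.
case Pi: (P i); last by apply: (smooth_ext oU _ IH) => x _; rewrite big_cons Pi.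
by apply: (smooth_ext oU _ (smoothM (HF i Pi) IH)) => x _; rewrite big_cons Pi.
Qed.
End Smooth.
End PartialDerivatives.

(** * Complex-valued functions over a real or complex chart *)

Section NormC.
Variable R : realType.
Notation C := R[i].
Notation nc := (@Normc.normc R).
Lemma ncE (z : C) : `|z| = (nc z)%:C%C.
Proof. by rewrite normc_def; case: z. Qed.
Lemma nc_ge0 (z : C) : 0 <= nc z.
Proof. by rewrite -ler0c -ncE normr_ge0. Qed.
Lemma ncD (x y : C) : nc (x + y) <= nc x + nc y.
Proof. exact: le_normcD. Qed.
Lemma ncN (x : C) : nc (- x) = nc x.
Proof. exact: normcN. Qed.
Lemma ncB (x y : C) : nc (x - y) <= nc x + nc y.
Proof. by rewrite -(ncN y) ncD. Qed.
Lemma ncM (x y : C) : nc (x * y) = nc x * nc y.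
Proof. exact: Normc.normcM. Qed.
Lemma nc0 : nc 0 = 0.
Proof. exact: Normc.normc0. Qed.
Lemma nc1 : nc 1 = 1.
Proof. exact: Normc.normc1. Qed.
Lemma nc_eq0 (x : C) : nc x = 0 -> x = 0.
Proof. exact: Normc.eq0_normc. Qed.
Lemma ncR (r : R) : nc r%:C%C = `|r|.
Proof. by rewrite /= expr0n /= addr0 sqrtr_sqr. Qed.
Lemma nc_sum (I : Type) (r : seq I) (P : pred I) (F : I -> C) :
  nc (\sum_(i <- r | P i) F i) <= \sum_(i <- r | P i) nc (F i).
Proof.
elim/big_rec2: _ => [|i y z _ H]; first by rewrite nc0.
by apply: le_trans (ncD _ _) _; rewrite lerD2l.
Qed.
End NormC.

(** The structure of K that makes one proof serve both categories: iota embeds K in C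
compatibly with norms and order, and gr_bas is a K-basis of C with coordinate
functions gr_co, namely 1 over C, and 1, i with real and imaginary parts over R. *)
Record ground (R : realType) (K : numFieldType) (iota : {rmorphism K -> R[i]}) := Ground {
  gr_norm : forall x, iota `|x| = (Normc.normc (iota x))%:C%C;
  gr_lt : forall x y, (iota x < iota y) = (x < y);
  gr_real : R -> K;
  gr_realE : forall r, iota (gr_real r) = r%:C%C;
  gr_n : nat;
  gr_bas : 'I_gr_n -> R[i];
  gr_co : 'I_gr_n -> R[i] -> K;
  gr_coD : forall k x y, gr_co k (x + y) = gr_co k x + gr_co k y;
  gr_coZ : forall k a z, gr_co k (iota a * z) = a * gr_co k z;
  gr_coE : forall z, z = \sum_k iota (gr_co k z) * gr_bas k;
  gr_coB : forall k l, gr_co k (gr_bas l) = (k == l)%:R;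
  gr_co_le : forall k z, Normc.normc (iota (gr_co k z)) <= Normc.normc z;
  gr_0 : 'I_gr_n;
  gr_bas0 : gr_bas gr_0 = 1
}.

Arguments gr_norm {R K iota} _ _.
Arguments gr_lt {R K iota} _ _ _.
Arguments gr_real {R K iota} _ _.
Arguments gr_realE {R K iota} _ _.
Arguments gr_bas {R K iota} _ _.
Arguments gr_co {R K iota} _ _ _.
Arguments gr_coD {R K iota} _ _ _ _.
Arguments gr_coZ {R K iota} _ _ _ _.
Arguments gr_coE {R K iota} _ _.
Arguments gr_coB {R K iota} _ _ _.
Arguments gr_co_le {R K iota} _ _ _.
Arguments gr_0 {R K iota} _.
Arguments gr_bas0 {R K iota} _.

Section Calculus.
Variables (R : realType) (K : numFieldType) (iota : {rmorphism K -> R[i]}).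
Variable gr : ground iota.
Notation C := R[i].
Notation pt := 'rV[K]_5.
Notation nc := (@Normc.normc R).
Notation co := (gr_co gr).
Notation bas := (gr_bas gr).
Implicit Types (F G : pt -> C) (x h : pt) (f : pt -> K).

Lemma iota_inj : injective iota.
Proof. exact: fmorph_inj. Qed.
Lemma gr_le (x y : K) : (iota x <= iota y) = (x <= y).
Proof. by rewrite !le_eqVlt (gr_lt gr) (inj_eq iota_inj). Qed.
Lemma iota_gt0 (x : K) : (0 < iota x) = (0 < x).
Proof. by rewrite -(gr_lt gr) rmorph0. Qed.
Lemma co0 k : co k 0 = 0.
Proof. by have := gr_coZ gr k 0 0; rewrite rmorph0 !mul0r. Qed.
Lemma coN k z : co k (- z) = - co k z.
Proof. by have := gr_coZ gr k (-1) z; rewrite rmorphN rmorph1 !mulN1r. Qed.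
Lemma coB k (x y : C) : co k (x - y) = co k x - co k y.
Proof. by rewrite gr_coD coN. Qed.
Lemma co_sum k (I : Type) (r : seq I) (P : pred I) (f : I -> C) :
  co k (\sum_(i <- r | P i) f i) = \sum_(i <- r | P i) co k (f i).
Proof. by elim/big_rec2: _ => [|i y z _ <-]; rewrite ?co0 ?(gr_coD gr). Qed.
Lemma co_iota k a : co k (iota a) = a * co k 1.
Proof. by rewrite -(gr_coZ gr) mulr1. Qed.
Lemma co_1 k : co k 1 = (k == gr_0 gr)%:R.
Proof. by rewrite -(gr_bas0 gr) gr_coB. Qed.
Lemma co_inj z w : (forall k, co k z = co k w) -> z = w.
Proof. by move=> H; rewrite (gr_coE gr z) (gr_coE gr w); apply: eq_bigr => k _; rewrite H. Qed.

(** The l1 norm of a coordinate vector, with values in R over both ground fields. *)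
Definition nv h : R := \sum_i nc (iota (h 0 i)).
Lemma nv_ge0 h : 0 <= nv h.
Proof. by apply: sumr_ge0 => i _; exact: nc_ge0. Qed.
Lemma nv0 : nv 0 = 0.
Proof. by rewrite /nv big1 // => i _; rewrite mxE rmorph0 nc0. Qed.
Lemma nvD h k : nv (h + k) <= nv h + nv k.
Proof. by rewrite /nv -big_split; apply: ler_sum => i _ /=; rewrite mxE rmorphD ncD. Qed.
Lemma nvN h : nv (- h) = nv h.
Proof. by apply: eq_bigr => i _; rewrite mxE rmorphN ncN. Qed.
Lemma nvZ a h : nv (a *: h) = nc (iota a) * nv h.
Proof. by rewrite /nv mulr_sumr; apply: eq_bigr => i _; rewrite mxE rmorphM ncM. Qed.
Lemma nvBC h k : nv (h - k) = nv (k - h).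
Proof. by rewrite -nvN opprB. Qed.
Lemma nv_dist x y z : nv (x - z) <= nv (x - y) + nv (y - z).
Proof. by apply: le_trans (nvD _ _); rewrite addrA subrK. Qed.
Lemma nv_mx h : iota `|h| <= (nv h)%:C%C.
Proof.
have [/eqP h0|h0] := boolP (mx_norm h == 0).
  by rewrite [`|h|]h0 rmorph0 ler0c nv_ge0.
have [[i j] /= hE] := mx_norm_neq0 h0; rewrite [`|h|]hE.
rewrite (gr_norm gr) // lecR (ord1 i) /nv (bigD1 j) //= ler_wpDr // sumr_ge0 // => k _.
exact: nc_ge0.
Qed.
Lemma mx_nv h : (nv h)%:C%C <= 5%:R * iota `|h|.
Proof.
rewrite rmorph_sum /=.
have -> : 5%:R * iota `|h| = \sum_(i < 5) iota `|h|.
  by rewrite sumr_const card_ord mulr_natl.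
by apply: ler_sum => i _; rewrite -(gr_norm gr) gr_le mx_norm_coord.
Qed.
Lemma real_gt0 r : (0 < gr_real gr r) = (0 < r).
Proof. by rewrite -iota_gt0 (gr_realE gr) -(rmorph0 (real_complex R)) ltcR. Qed.
Lemma iota_Re (e : K) : 0 < e -> exists2 d : R, 0 < d & iota e = d%:C%C.
Proof.
move=> e0; exists (nc (iota e)); last by rewrite -(gr_norm gr) gtr0_norm.
by rewrite lt0r nc_ge0 andbT; apply/eqP => /nc_eq0/eqP; rewrite fmorph_eq0 gt_eqF.
Qed.
Lemma nv_ball x (e : R) : 0 < e -> \forall y \near x, nv (y - x) < e.
Proof.
move=> e0; apply/nbhs_ballP; exists (gr_real gr (e / 5)) => /=.
  by rewrite real_gt0 divr_gt0.
move=> y; rewrite -ball_normE /= -(gr_lt gr) (gr_realE gr) => H.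
rewrite -ltcR nvBC; apply: le_lt_trans (mx_nv _) _.
have -> : e%:C%C = 5%:R * (e / 5)%:C%C.
  by rewrite -[5%:R](rmorph_nat (real_complex R)) -rmorphM /= mulrC divfK.
by rewrite ltr_pM2l.
Qed.
Lemma near_nv x (P : pt -> Prop) : (\forall y \near x, P y) ->
  exists2 e : R, 0 < e & forall y, nv (y - x) < e -> P y.
Proof.
move=> /nbhs_ballP[d /= d0 H]; have [e e0 de] := iota_Re d0.
exists e => // y ye; apply: H; rewrite -ball_normE /= -(gr_lt gr) de.
by apply: le_lt_trans (nv_mx _) _; rewrite nvBC ltcR.
Qed.

(** F has the C-valued partial derivatives c at x in the sense of a first order
expansion; over K = C this is holomorphy, over K = R real differentiability. *)
Definition has_D F x (c : 'I_5 -> C) := forall e : R, 0 < e ->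
  exists2 d : R, 0 < d & forall h, nv h < d ->
    nc (F (h + x) - F x - \sum_i iota (h 0 i) * c i) <= e * nv h.

Lemma has_D_diff f x : differentiable f x ->
  has_D (fun y => iota (f y)) x (fun i => iota (partial i f x)).
Proof.
move=> df e e0.
have e'0 : 0 < gr_real gr (e / 5) by rewrite real_gt0 divr_gt0.
have [d d0 H] := diff_eps df e'0.
have [r r0 dr] := iota_Re d0; exists r => // h hr.
have /H : `|h| < d.
  by rewrite -(gr_lt gr) dr; apply: le_lt_trans (nv_mx _) _; rewrite ltcR.
rewrite -gr_le (gr_norm gr) rmorphM (gr_realE gr) !rmorphB rmorph_sum /=.
under eq_bigr do rewrite rmorphM.
move=> H1; rewrite -lecR; apply: le_trans H1 _.
apply: (@le_trans _ _ ((e / 5)%:C%C * (nv h)%:C%C)).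
  by rewrite ler_wpM2l ?nv_mx // ler0c divr_ge0 // ltW.
rewrite -rmorphM /= lecR ler_wpM2r ?nv_ge0 //; lra.
Qed.

Lemma diff_has_D f x c : has_D (fun y => iota (f y)) x (fun i => iota (c i)) ->
  differentiable f x /\ forall i, partial i f x = c i.
Proof.
move=> H; apply: eps_diff => e e0.
have [r r0 er] := iota_Re e0.
have [d d0 Hd] := H (r / 5) (divr_gt0 r0 (ltr0Sn _ _)).
exists (gr_real gr (d / 5)); first by rewrite real_gt0 divr_gt0.
move=> h hd.
have hn : nv h < d.
  rewrite -ltcR; apply: le_lt_trans (mx_nv _) _.
  have -> : d%:C%C = 5%:R * (d / 5)%:C%C.
    by rewrite -[5%:R](rmorph_nat (real_complex R)) -rmorphM /= mulrC divfK.
  by rewrite ltr_pM2l // -(gr_realE gr) gr_lt.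
rewrite -gr_le (gr_norm gr) rmorphM !rmorphB rmorph_sum /=.
under eq_bigr do rewrite rmorphM.
rewrite er; apply: (@le_trans _ _ (r / 5 * nv h)%:C%C); first by rewrite lecR Hd.
rewrite rmorphM /=; apply: le_trans (ler_wpM2l _ (mx_nv h)) _.
  by rewrite ler0c divr_ge0 // ltW.
have -> : r%:C%C = (r / 5)%:C%C * 5%:R.
  by rewrite -(rmorph_nat (real_complex R) 5) -rmorphM /= divfK.
by rewrite mulrA.
Qed.
End Calculus.

Lemma finite_lower_bound (R : realType) (I : finType) (d : I -> R) : (forall i, 0 < d i) ->
  exists2 m, 0 < m & forall i, m <= d i.
Proof.
move=> d0; suff [m m0 H] : exists2 m, 0 < m & forall i, i \in enum I -> m <= d i.
  by exists m => // i; apply: H; rewrite mem_enum.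
elim: (enum I) => [|i r [m m0 H]]; first by exists 1.
exists (Num.min (d i) m); first by rewrite lt_min d0.
by move=> j; rewrite inE => /orP[/eqP->|/H]; rewrite ge_min ?lexx // => ->; rewrite orbT.
Qed.

Section CCalculus.
Variables (R : realType) (K : numFieldType) (iota : {rmorphism K -> R[i]}).
Variable gr : ground iota.
Notation C := R[i].
Notation pt := 'rV[K]_5.
Notation nc := (@Normc.normc R).
Notation co := (gr_co gr).
Notation bas := (gr_bas gr).
Notation nv := (@nv R K iota).
Implicit Types (F G : pt -> C) (x h : pt) (f : pt -> K).

Definition cdiff F x := forall k, differentiable (fun y => co k (F y)) x.
(** The C-valued partial derivative, assembled from those of the K-valued coordinates of
F. *)
Definition cD i F x : C := \sum_k iota (partial i (fun y => co k (F y)) x) * bas k.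
Definition csmooth U F := forall k, smooth U (fun y => co k (F y)).

Lemma co_sumbas k (a : 'I_(gr_n gr) -> K) : co k (\sum_l iota (a l) * bas l) = a k.
Proof.
rewrite co_sum (bigD1 k) //= gr_coZ gr_coB eqxx mulr1 big1 ?addr0 // => l lk.
by rewrite gr_coZ gr_coB eq_sym (negbTE lk) mulr0.
Qed.
Lemma co_cD k i F x : co k (cD i F x) = partial i (fun y => co k (F y)) x.
Proof. exact: co_sumbas. Qed.

Lemma has_D_cD F x : cdiff F x -> has_D iota F x (fun i => cD i F x).
Proof.
move=> dF e e0.
pose S := 1 + \sum_k nc (bas k).
have S0 : 0 < S by rewrite ltr_pwDl // sumr_ge0 // => k _; exact: nc_ge0.
have /choice [d Hd] : forall k, exists d : R, 0 < d /\ forall h, nv h < d ->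
   nc (iota (co k (F (h + x))) - iota (co k (F x)) - \sum_i iota (h 0 i) *
     iota (partial i (fun y => co k (F y)) x)) <= e / S * nv h.
  move=> k; have [|d d0 H] := has_D_diff gr (dF k) (e := e / S); first by rewrite divr_gt0.
  by exists d.
have [m m0 md] := finite_lower_bound (fun k => proj1 (Hd k)); exists m => // h hm.
have hd k : nv h < d k := lt_le_trans hm (md k).
have -> : F (h + x) - F x - \sum_i iota (h 0 i) * cD i F x =
  \sum_k (iota (co k (F (h + x))) - iota (co k (F x)) - \sum_i iota (h 0 i) *
     iota (partial i (fun y => co k (F y)) x)) * bas k.
  rewrite {1}(gr_coE gr (F (h + x))) {1}(gr_coE gr (F x)).
  rewrite [X in _ - X](_ : _ = \sum_k (\sum_i iota (h 0 i) *
     iota (partial i (fun y => co k (F y)) x)) * bas k).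
    by rewrite -!sumrB; apply: eq_bigr => k _; rewrite !mulrBl.
  rewrite (eq_bigr _ (fun i _ => mulr_sumr _ _ _ _)) exchange_big /=.
  by apply: eq_bigr => k _; rewrite mulr_suml; apply: eq_bigr => i _; rewrite mulrA.
apply: le_trans (nc_sum _ _ _) _.
apply: (@le_trans _ _ (\sum_k (e / S * nv h) * nc (bas k))).
  apply: ler_sum => k _; rewrite ncM ler_wpM2r ?nc_ge0 //.
  by have [_ H] := Hd k; exact: H.
rewrite -mulr_sumr mulrAC ler_wpM2r ?nv_ge0 // -mulrA ger_pMr // mulrC ler_pdivrMr // mul1r.
by rewrite /S lerDr.
Qed.

Lemma cD_of_has_D F x c : has_D iota F x c -> cdiff F x /\ forall i, cD i F x = c i.
Proof.
move=> H.
have Hk k : differentiable (fun y => co k (F y)) x /\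
    forall i, partial i (fun y => co k (F y)) x = co k (c i).
  apply: (diff_has_D gr) => e /H[d d0 Hd]; exists d => // h /Hd.
  apply: le_trans; rewrite (_ : _ - _ = iota (co k (F (h + x) - F x - \sum_i iota (h 0 i) * c i))).
    exact: gr_co_le.
  rewrite !coB co_sum [RHS]rmorphB [X in _ = X - _]rmorphB [X in _ = _ - X]rmorph_sum; congr (_ - _).
  by apply: eq_bigr => i _; rewrite gr_coZ rmorphM.
split=> [k|i]; first by have [] := Hk k.
by rewrite (gr_coE gr (c i)); apply: eq_bigr => k _; have [_ ->] := Hk k.
Qed.

Lemma csmooth_diff U F x : csmooth U F -> U x -> cdiff F x.
Proof. by move=> H Ux k; exact: smooth_diff (H k) Ux. Qed.
Lemma csmooth_cD U F i : open U -> csmooth U F -> csmooth U (cD i F).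
Proof.
move=> oU H k; apply: smooth_ext oU _ (smooth_partial i (H k)) => x _.
by rewrite co_cD.
Qed.
Lemma csmooth_sub U V F : V `<=` U -> csmooth U F -> csmooth V F.
Proof. by move=> VU H k; exact: smooth_sub (H k). Qed.
Lemma csmooth_ext U F G : open U -> (forall x, U x -> F x = G x) -> csmooth U F -> csmooth U G.
Proof. by move=> oU FG H k; apply: smooth_ext oU _ (H k) => x /FG ->. Qed.
Lemma cD_ext U F G x i : open U -> U x -> (forall y, U y -> F y = G y) -> cD i F x = cD i G x.
Proof.
move=> oU Ux FG; apply: eq_bigr => k _; congr (iota _ * _).
by apply: partial_near; apply: open_near_eq oU Ux _ => y /FG ->.
Qed.

Section OnOpen.
Variable U : set pt.
Hypothesis oU : open U.
Lemma csmooth_cst a : csmooth U (fun=> a).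
Proof. by move=> k; exact: smooth_cst. Qed.
Lemma csmoothD F G : csmooth U F -> csmooth U G -> csmooth U (fun y => F y + G y).
Proof.
move=> HF HG k; apply: smooth_ext oU _ (smoothD oU (HF k) (HG k)) => x _.
by rewrite gr_coD.
Qed.
Lemma coM k F G y : co k (F y * G y) =
  \sum_p \sum_q co k (bas p * bas q) * (co p (F y) * co q (G y)).
Proof.
rewrite {1}(gr_coE gr (F y)) mulr_suml co_sum; apply: eq_bigr => p _.
rewrite {1}(gr_coE gr (G y)) mulr_sumr co_sum; apply: eq_bigr => q _.
by rewrite mulrACA -rmorphM gr_coZ mulrC.
Qed.
Lemma csmoothM F G : csmooth U F -> csmooth U G -> csmooth U (fun y => F y * G y).
Proof.
move=> HF HG k.
apply: (@smooth_ext K U (fun y =>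
  \sum_p \sum_q co k (bas p * bas q) * (co p (F y) * co q (G y)))) => //.
  by move=> x _; rewrite coM.
by do 2 (apply: smooth_sum => // ? _); apply: smoothZ => //; apply: smoothM.
Qed.
Lemma csmoothN F : csmooth U F -> csmooth U (fun y => - F y).
Proof.
move=> HF; apply: csmooth_ext oU _ (csmoothM (csmooth_cst (-1)) HF) => x _.
by rewrite mulN1r.
Qed.
Lemma csmoothB F G : csmooth U F -> csmooth U G -> csmooth U (fun y => F y - G y).
Proof. by move=> HF HG; apply: csmoothD => //; exact: csmoothN. Qed.
Lemma csmooth_sum (I : Type) (r : seq I) (P : pred I) (F : I -> pt -> C) :
  (forall i, P i -> csmooth U (F i)) ->
  csmooth U (fun y => \sum_(i <- r | P i) F i y).
Proof.
move=> HF k; apply: (@smooth_ext K U (fun y => \sum_(i <- r | P i) co k (F i y))) => //.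
  by move=> x _; rewrite co_sum.
by apply: smooth_sum => // i Pi; exact: HF.
Qed.
Lemma csmooth_iota f : smooth U f -> csmooth U (fun y => iota (f y)).
Proof.
move=> Hf k; apply: smooth_ext oU _ (smoothM oU Hf (smooth_cst oU (co k 1))) => x _.
by rewrite co_iota.
Qed.
Lemma smooth_iota f : csmooth U (fun y => iota (f y)) -> smooth U f.
Proof.
move=> /(_ (gr_0 gr)) H; apply: smooth_ext oU _ H => x _.
by rewrite co_iota co_1 eqxx mulr1.
Qed.
End OnOpen.

Lemma cD_cst i a x : cD i (fun=> a) x = 0.
Proof. by rewrite /cD big1 // => k _; rewrite partial_cst rmorph0 mul0r. Qed.
Lemma cD_iota i f x : differentiable f x -> cD i (fun y => iota (f y)) x = iota (partial i f x).
Proof.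
move=> df; have := has_D_diff gr df => /cD_of_has_D[_ H]; exact: H.
Qed.
Lemma cDD i F G x : cdiff F x -> cdiff G x ->
  cD i (fun y => F y + G y) x = cD i F x + cD i G x.
Proof.
move=> dF dG; apply: (co_inj (gr := gr)) => k; rewrite gr_coD !co_cD -partialD //.
by congr (partial i _ x); apply: funext => y; rewrite gr_coD.
Qed.
Lemma partial_sum i (I : Type) (r : seq I) (P : pred I) (f : I -> pt -> K) x :
  (forall j, P j -> differentiable (f j) x) ->
  differentiable (fun y => \sum_(j <- r | P j) f j y) x /\
  partial i (fun y => \sum_(j <- r | P j) f j y) x = \sum_(j <- r | P j) partial i (f j) x.
Proof.
move=> H; elim: r => [|j r [IH1 IH2]].
  have -> : (fun y => \sum_(j <- [::] | P j) f j y) = (fun=> 0).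
    by apply: funext => y; rewrite big_nil.
  by rewrite partial_cst big_nil; split=> //; exact: differentiable_cst.
have [Pj|nPj] := boolP (P j).
  have -> : (fun y => \sum_(j <- j :: r | P j) f j y) =
     (fun y => f j y + \sum_(j <- r | P j) f j y).
    by apply: funext => y; rewrite big_cons Pj.
  by rewrite partialD ?big_cons ?Pj ?IH2 //; [split=> //; apply: differentiableD' => //|]; exact: H.
have -> : (fun y => \sum_(j <- j :: r | P j) f j y) = (fun y => \sum_(j <- r | P j) f j y).
  by apply: funext => y; rewrite big_cons (negbTE nPj).
by rewrite big_cons (negbTE nPj).
Qed.
Lemma cdiffM_cDM i F G x : cdiff F x -> cdiff G x ->
  cdiff (fun y => F y * G y) x /\
  cD i (fun y => F y * G y) x = cD i F x * G x + F x * cD i G x.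
Proof.
move=> dF dG.
have dpq k p q : differentiable (fun y => co k (bas p * bas q) * (co p (F y) * co q (G y))) x.
  by apply: differentiableM'; [exact: differentiable_cst|apply: differentiableM'; [exact: dF|exact: dG]].
have ppq k p q : partial i (fun y => co k (bas p * bas q) * (co p (F y) * co q (G y))) x
   = co k (bas p * bas q) * (co p (cD i F x) * co q (G x))
     + co k (bas p * bas q) * (co p (F x) * co q (cD i G x)).
  rewrite partialM; [|exact: differentiable_cst|by apply: differentiableM'; [exact: dF|exact: dG]].
  by rewrite partial_cst mul0r add0r partialM ?mulrDr ?co_cD; [|exact: dF|exact: dG].
have dq k p := (partial_sum i (index_enum 'I_(gr_n gr)) (P := xpredT) (fun q _ => dpq k p q)).
have dp k := (partial_sum i (index_enum 'I_(gr_n gr)) (P := xpredT) (fun p _ => proj1 (dq k p))).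
have E k : (fun y => co k (F y * G y)) = (fun y =>
  \sum_p \sum_q co k (bas p * bas q) * (co p (F y) * co q (G y))).
  by apply: funext => y; rewrite coM.
split=> [k|]; first by rewrite E; exact: (proj1 (dp k)).
apply: (co_inj (gr := gr)) => k; rewrite gr_coD co_cD E (proj2 (dp k)).
rewrite (coM k (fun _ => cD i F x) G x) (coM k F (fun _ => cD i G x) x) -big_split.
apply: eq_bigr => p _ /=; rewrite (proj2 (dq k p)) -big_split.
by apply: eq_bigr => q _ /=; rewrite ppq.
Qed.
Lemma cdiffM F G x : cdiff F x -> cdiff G x -> cdiff (fun y => F y * G y) x.
Proof. by move=> dF dG; have [] := cdiffM_cDM ord0 dF dG. Qed.
Lemma cDM i F G x : cdiff F x -> cdiff G x ->
  cD i (fun y => F y * G y) x = cD i F x * G x + F x * cD i G x.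
Proof. by move=> dF dG; have [] := cdiffM_cDM i dF dG. Qed.
Lemma cdiff_cst a x : cdiff (fun=> a) x.
Proof. by move=> k; exact: differentiable_cst. Qed.
Lemma cdiffZ a F x : cdiff F x -> cdiff (fun y => a * F y) x.
Proof. by move=> dF; apply: cdiffM => //; exact: cdiff_cst. Qed.
Lemma cDZ i a F x : cdiff F x -> cD i (fun y => a * F y) x = a * cD i F x.
Proof. by move=> dF; rewrite cDM ?cD_cst ?mul0r ?add0r //; exact: cdiff_cst. Qed.
Lemma cdiff_sum (I : Type) (r : seq I) (P : pred I) (F : I -> pt -> C) x :
  (forall j, P j -> cdiff (F j) x) -> cdiff (fun y => \sum_(j <- r | P j) F j y) x.
Proof.
move=> H k; rewrite (_ : (fun y => _) = (fun y => \sum_(j <- r | P j) co k (F j y))).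
  by have [] := @partial_sum ord0 _ r P (fun j y => co k (F j y)) x (fun j Pj => H j Pj k).
by apply: funext => y; rewrite co_sum.
Qed.
Lemma cD_sum i (I : Type) (r : seq I) (P : pred I) (F : I -> pt -> C) x :
  (forall j, P j -> cdiff (F j) x) ->
  cD i (fun y => \sum_(j <- r | P j) F j y) x = \sum_(j <- r | P j) cD i (F j) x.
Proof.
move=> H; apply: (co_inj (gr := gr)) => k; rewrite co_cD co_sum.
rewrite (_ : (fun y => _) = (fun y => \sum_(j <- r | P j) co k (F j y))).
  have [_ ->] := @partial_sum i _ r P (fun j y => co k (F j y)) x (fun j Pj => H j Pj k).
  by apply: eq_bigr => j _; rewrite co_cD.
by apply: funext => y; rewrite co_sum.
Qed.
End CCalculus.

(** * Mean value inequality and symmetry of second derivatives *)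

(** Cousin's lemma for an additive interval predicate, by the supremum of the reachable
points. It replaces integration along a segment in the mean value inequality. *)
Lemma cousin (R : realType) (P : R -> R -> Prop) :
  (forall a b c : R, a <= b -> b <= c -> P a b -> P b c -> P a c) ->
  (forall t : R, 0 <= t <= 1 -> exists2 d : R, 0 < d & forall a b : R, a <= t -> t <= b -> 0 <= a -> b <= 1 ->
     b - a < d -> P a b) -> P 0 1.
Proof.
move=> Padd Ploc.
pose S := [set t | 0 <= t <= 1 /\ P 0 t].
have P00 : S 0.
  split; first by rewrite lexx ler01.
  have [|d d0 H] := Ploc 0; first by rewrite lexx ler01.
  by apply: H; rewrite ?lexx ?ler01 ?subrr.
have Sub : has_sup S.
  by split; [exists 0|exists 1 => t [/andP[]]].
set c := sup S.
have c0 : 0 <= c by apply: ub_le_sup => //; have [] := Sub.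
have c1 : c <= 1 by apply: ge_sup; [exists 0|move=> t [/andP[]]].
have [|d d0 H] := Ploc c; first by rewrite c0 c1.
have [t [/andP[t0 t1] Pt] ct] := sup_adherent (eps := d / 2) (divr_gt0 d0 (ltr0Sn _ _)) Sub.
have tc : t <= c by apply: ub_le_sup; [have [] := Sub|split=> //; rewrite t0].
(* one third of the radius keeps the interval from t to b shorter than d *)
pose b := Num.min 1 (c + d / 3).
have cb : c <= b by rewrite le_min c1 /=; lra.
have bc : b <= c + d / 3 by rewrite ge_min lexx orbT.
have b1 : b <= 1 by rewrite ge_min lexx.
have Pb : P 0 b.
  apply: Padd Pt _ => //; first exact: le_trans tc cb.
  by apply: H => //; move: ct; rewrite -/c; lra.
have : b <= c.
  apply: ub_le_sup; first by have [] := Sub.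
  by split=> //; rewrite b1 (le_trans c0).
move: Pb; rewrite /b; case: (leP 1 (c + d / 3)) => //; lra.
Qed.

Section MeanValue.
Variables (R : realType) (K : numFieldType) (iota : {rmorphism K -> R[i]}).
Variable gr : ground iota.
Notation C := R[i].
Notation pt := 'rV[K]_5.
Notation nc := (@Normc.normc R).
Notation nv := (@nv R K iota).
Notation rl := (gr_real gr).
Implicit Types (F G : pt -> C) (x h : pt).

Lemma nvZr (t : R) h : nv (rl t *: h) = `|t| * nv h.
Proof. by rewrite nvZ gr_realE ncR. Qed.
Lemma rlD s t : rl (s + t) = rl s + rl t.
Proof. by apply: (@iota_inj R K iota); rewrite rmorphD !gr_realE rmorphD. Qed.
Lemma rlB s t : rl (s - t) = rl s - rl t.
Proof. by apply: (@iota_inj R K iota); rewrite rmorphB !gr_realE rmorphB. Qed.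
Lemma rl1 : rl 1 = 1.
Proof. by apply: (@iota_inj R K iota); rewrite gr_realE !rmorph1. Qed.
Lemma rl0 : rl 0 = 0.
Proof. by apply: (@iota_inj R K iota); rewrite gr_realE !rmorph0. Qed.

Lemma le_eps (a b S : R) : 0 <= S -> (forall e : R, 0 < e -> a <= b + e * S) -> a <= b.
Proof.
move=> S0 H; apply/ler_addgt0Pr => e e0.
have S1 : 0 < S + 1 by lra.
apply: le_trans (H (e / (S + 1)) (divr_gt0 e0 S1)) _.
by rewrite lerD2l mulrAC ler_pdivrMr //; nra.
Qed.

(** If the derivative along the segment from x to h + x stays within M of the constant
form c0, so does the increment: the bound is additive over subintervals and holds
near each point up to an arbitrary e. *)
Lemma mean_value F (c0 : 'I_5 -> C) M x h (c : R -> 'I_5 -> C) :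
  (forall t : R, 0 <= t <= 1 -> has_D iota F (rl t *: h + x) (c t)) ->
  (forall t : R, 0 <= t <= 1 -> nc (\sum_i iota (h 0 i) * (c t i - c0 i)) <= M * nv h) ->
  nc (F (h + x) - F x - \sum_i iota (h 0 i) * c0 i) <= M * nv h.
Proof.
move=> HD HM; apply: (@le_eps _ _ (nv h)); first exact: nv_ge0.
move=> e e0.
pose L := \sum_i iota (h 0 i) * c0 i.
pose phi t := F (rl t *: h + x) - t%:C%C * L.
suff : nc (phi 1 - phi 0) <= (M + e) * nv h * (1 - 0).
  rewrite /phi rl1 rl0 scale1r scale0r add0r rmorph1 mul1r rmorph0 mul0r !subr0 mulr1.
  by rewrite addrAC mulrDl.
apply: (@cousin R (fun a b => nc (phi b - phi a) <= (M + e) * nv h * (b - a))).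
  move=> a b d ab bd H1 H2.
  have -> : phi d - phi a = (phi d - phi b) + (phi b - phi a) by rewrite addrA subrK.
  by apply: le_trans (ncD _ _) _; apply: le_trans (lerD H2 H1) _; lra.
move=> t t01.
have [d d0 Hd] := HD t t01 e e0.
have n1 : 0 < nv h + 1 by rewrite ltr_wpDl ?nv_ge0.
have key s : `|s - t| < d / (nv h + 1) ->
   nc (phi s - phi t) <= (M + e) * nv h * `|s - t|.
  move=> st; have /Hd : nv (rl (s - t) *: h) < d.
    rewrite nvZr; apply: (@le_lt_trans _ _ (`|s - t| * (nv h + 1))).
      by rewrite ler_wpM2l // lerDl.
    by rewrite -ltr_pdivlMr.
  rewrite addrA -scalerDl -rlD subrK nvZr.
  rewrite (_ : \sum_i _ = (s - t)%:C%C * \sum_i iota (h 0 i) * (c t i - c0 i) + (s - t)%:C%C * L); last first.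
    rewrite -mulrDr /L -big_split mulr_sumr; apply: eq_bigr => i _ /=.
    by rewrite mxE rmorphM gr_realE -mulrA -mulrDr subrK.
  set A := F _; set B := F _; set S := \sum_i _ => H1.
  have -> : phi s - phi t = (A - B - ((s - t)%:C%C * S + (s - t)%:C%C * L)) + (s - t)%:C%C * S.
    by rewrite /phi -/A -/B rmorphB /=; ring.
  apply: le_trans (ncD _ _) _; apply: le_trans (lerD H1 (lexx _)) _.
  rewrite ncM ncR; have := HM t t01; rewrite -/S => H2.
  have := ler_wpM2l (normr_ge0 (s - t)) H2; lra.
exists (d / (nv h + 1)); first by rewrite divr_gt0.
move=> a b at_ tb a0 b1 bad.
have -> : phi b - phi a = (phi b - phi t) - (phi a - phi t) by ring.
apply: le_trans (ncB _ _) _.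
have Hb := key b; have Ha := key a.
rewrite ger0_norm ?subr_ge0 // in Hb; rewrite distrC ger0_norm ?subr_ge0 // in Ha.
apply: le_trans (lerD (Hb _) (Ha _)) _; lra.
Qed.

Lemma delta_sum (i : 'I_5) (c : 'I_5 -> C) (t : R) :
  \sum_k iota ((rl t *: delta_mx 0 i : pt) 0 k) * c k = t%:C%C * c i.
Proof.
rewrite (bigD1 i) //= !mxE !eqxx mulr1 gr_realE big1 ?addr0 // => k ki.
by rewrite !mxE (negbTE ki) andbF mulr0 rmorph0 mul0r.
Qed.
Lemma nv_delta (i : 'I_5) t : nv (rl t *: delta_mx 0 i) = `|t|.
Proof.
rewrite nvZr /nv (bigD1 i) //= !mxE !eqxx rmorph1 nc1 big1 ?addr0 ?mulr1 // => k ki.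
by rewrite !mxE (negbTE ki) andbF rmorph0 nc0.
Qed.

Notation cD := (cD gr).
Notation cdiff := (cdiff gr).
Notation csmooth := (csmooth gr).

(** The mean value inequality is applied to the first difference F (u + y) - F y, whose
derivative varies by the mixed derivative along the segment. *)
Lemma second_difference F x (U : set pt) i j : open U -> U x -> csmooth U F ->
  forall e : R, 0 < e -> exists2 d : R, 0 < d & forall t : R, 0 < t -> t < d ->
    nc (F (rl t *: delta_mx 0 j + (rl t *: delta_mx 0 i + x)) - F (rl t *: delta_mx 0 j + x)
        - (F (rl t *: delta_mx 0 i + x) - F x)
        - t%:C%C * (t%:C%C * cD i (cD j F) x)) <= 3 * e * t * t.
Proof.
move=> oU Ux sF e e0.
have [d1 d10 HD] := has_D_cD (csmooth_diff (csmooth_cD j oU sF) Ux) e0.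
have [d2 d20 HU] := near_nv gr (open_near oU Ux (fun y Uy => Uy)).
exists (Num.min d1 d2 / 2); first by rewrite divr_gt0 // lt_min d10.
move=> t t0 td.
have {td}[td1 td2] : 2 * t < d1 /\ 2 * t < d2.
  by apply/andP; rewrite -lt_min; lra.
set u : pt := rl t *: delta_mx 0 i; set w : pt := rl t *: delta_mx 0 j.
pose G y := F (u + y) - F y.
have Uball (s : R) : 0 <= s <= 1 -> nv (rl s *: w) <= t /\ U (rl s *: w + x) /\ U (u + (rl s *: w + x)).
  move=> /andP[s0 s1].
  have n1 : nv (rl s *: w) <= t.
    by rewrite nvZr (ger0_norm s0) /w nv_delta (gtr0_norm t0) ler_piMl // ltW.
  have n2 : nv u = t by rewrite /u nv_delta gtr0_norm.
  split=> //; split; apply: HU.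
    by rewrite addrK; lra.
  rewrite addrA addrK; apply: le_lt_trans (nvD _ _ _) _; lra.
have := @mean_value G (fun k => if k == j then t%:C%C * cD i (cD j F) x else 0) (3 * e * t) x w
  (fun s k => cD k F (u + (rl s *: w + x)) - cD k F (rl s *: w + x)).
rewrite /G /w delta_sum eqxx nv_delta (gtr0_norm t0); rewrite -/w -/u => H.
rewrite [w + (u + x)]addrCA; apply: H.
  move=> s /Uball[_ [U1 U2]] e' e'0.
  have [c1 c10 H1] := has_D_cD (csmooth_diff sF U1) (divr_gt0 e'0 (ltr0Sn _ 1)).
  have [c2 c20 H2] := has_D_cD (csmooth_diff sF U2) (divr_gt0 e'0 (ltr0Sn _ 1)).
  exists (Num.min c1 c2); first by rewrite lt_min c10.
  move=> h; rewrite lt_min => /andP[h1 h2].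
  rewrite [X in nc X](_ : _ = (F (h + (u + (rl s *: w + x))) - F (u + (rl s *: w + x)) -
    \sum_k iota (h 0 k) * cD k F (u + (rl s *: w + x))) - (F (h + (rl s *: w + x)) - F (rl s *: w + x) -
    \sum_k iota (h 0 k) * cD k F (rl s *: w + x))).
    by apply: le_trans (ncB _ _) _; apply: le_trans (lerD (H2 _ h2) (H1 _ h1)) _; lra.
  under eq_bigr do rewrite mulrBr; rewrite sumrB [u + (h + _)]addrCA; ring.
move=> s /Uball[n1 [U1 U2]].
rewrite /w delta_sum eqxx -/w ncM ncR (gtr0_norm t0) mulrC ler_pM2r //.
have n2 : nv u = t by rewrite /u nv_delta gtr0_norm.
have nuw := nvD iota u (rl s *: w).
have HB := HD (rl s *: w); have HA := HD (u + rl s *: w).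
rewrite -[u + rl s *: w + x]addrA in HA.
move: HA HB.
set A := cD j F (u + _); set B := cD j F (rl s *: w + x); set A0 := cD j F x.
rewrite (_ : \sum_k iota ((u + rl s *: w) 0 k) * _ = t%:C%C * cD i (cD j F) x + \sum_k iota ((rl s *: w) 0 k) * cD k (cD j F) x); last first.
  rewrite -(delta_sum i (fun k => cD k (cD j F) x)) -/u -big_split; apply: eq_bigr => k _ /=.
  by rewrite mxE rmorphD mulrDl.
set S := \sum_k _ => HA HB.
rewrite [X in nc X](_ : _ = (A - A0 - (t%:C%C * cD i (cD j F) x + S)) - (B - A0 - S)); last by ring.
apply: le_trans (ncB _ _) _.
apply: (@le_trans _ _ (e * nv (u + rl s *: w) + e * nv (rl s *: w))).
  by apply: lerD; [apply: HA|apply: HB]; lra.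
nra.
Qed.

(** The second difference is symmetric in the two directions, and its expansion
determines either mixed derivative. *)
Lemma schwarz F x (U : set pt) i j : open U -> U x -> csmooth U F ->
  cD i (cD j F) x = cD j (cD i F) x.
Proof.
move=> oU Ux sF; apply/eqP; rewrite -subr_eq0; apply/eqP/nc_eq0/le_anti.
rewrite nc_ge0 andbT; apply: (@le_eps _ _ 6) => // e e0.
have [d1 d10 H1] := second_difference i j oU Ux sF e0.
have [d2 d20 H2] := second_difference j i oU Ux sF e0.
pose t := Num.min d1 d2 / 2.
have t0 : 0 < t by rewrite divr_gt0 // lt_min d10.
have [td1 td2] : t < d1 /\ t < d2.
  have : 2 * t <= Num.min d1 d2 by rewrite /t; lra.
  by rewrite le_min => /andP[h1 h2]; split; lra.
have {H1} := H1 t t0 td1; have {H2} := H2 t t0 td2.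
set a := rl t *: delta_mx 0 i; set b := rl t *: delta_mx 0 j.
rewrite [b + (a + x)]addrCA.
set P := cD i (cD j F) x; set Q := cD j (cD i F) x => H2 H1.
have E : nc (t%:C%C * t%:C%C * (P - Q)) <= 3 * e * t * t + 3 * e * t * t.
  apply: le_trans (lerD H2 H1); apply: le_trans (ncB _ _).
  by rewrite le_eqVlt; apply/orP; left; apply/eqP; congr nc; ring.
move: E; rewrite ncM [nc (_ * _)]ncM ncR (gtr0_norm t0); clear H1 H2.
have -> : 3 * e * t * t + 3 * e * t * t = t * t * (0 + e * 6) by ring.
by rewrite (ler_pM2l (mulr_gt0 t0 t0)).
Qed.
End MeanValue.

(** * Matrix norms and the midpoint step *)

Section MatrixNorm.
Variable R : realType.
Notation C := R[i].
Notation nc := (@Normc.normc R).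

Lemma mx_addE p q (X Y : 'M[C]_(p, q)) i j : (X + Y) i j = X i j + Y i j.
Proof. by rewrite mxE. Qed.
Lemma mx_oppE p q (X : 'M[C]_(p, q)) i j : (- X) i j = - X i j.
Proof. by rewrite mxE. Qed.
Lemma mx_scaleE p q a (X : 'M[C]_(p, q)) i j : (a *: X) i j = a * X i j.
Proof. by rewrite mxE. Qed.
Definition mx_linE := (mx_addE, mx_oppE, mx_scaleE).
Definition mx_distr := (mulmxDl, mulmxDr, mulmxBl, mulmxBr, mulNmx, mulmxN, mul1mx, mulmx1).

Definition nm p q (X : 'M[C]_(p, q)) : R := \sum_i \sum_j nc (X i j).
Lemma nm_ge0 p q (X : 'M[C]_(p, q)) : 0 <= nm X.
Proof. by do 2 (apply: sumr_ge0 => ? _); exact: nc_ge0. Qed.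
Lemma nmD p q (X Y : 'M[C]_(p, q)) : nm (X + Y) <= nm X + nm Y.
Proof.
rewrite /nm -big_split; apply: ler_sum => i _; rewrite -big_split; apply: ler_sum => j _ /=.
by rewrite mxE ncD.
Qed.
Lemma nmN p q (X : 'M[C]_(p, q)) : nm (- X) = nm X.
Proof. by do 2 (apply: eq_bigr => ? _); rewrite mxE ncN. Qed.
Lemma nmB p q (X Y : 'M[C]_(p, q)) : nm (X - Y) <= nm X + nm Y.
Proof. by rewrite -(nmN Y) nmD. Qed.
Lemma nmZ p q a (X : 'M[C]_(p, q)) : nm (a *: X) = nc a * nm X.
Proof.
rewrite /nm mulr_sumr; apply: eq_bigr => i _; rewrite mulr_sumr; apply: eq_bigr => j _.
by rewrite mxE ncM.
Qed.
Lemma nm0 p q : nm (0 : 'M[C]_(p, q)) = 0.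
Proof. by rewrite /nm big1 // => i _; rewrite big1 // => j _; rewrite mxE nc0. Qed.
Lemma nm_entry p q (X : 'M[C]_(p, q)) i j : nc (X i j) <= nm X.
Proof.
rewrite /nm (bigD1 i) //= (bigD1 j) //= -addrA lerDl addr_ge0 //.
  by apply: sumr_ge0 => k _; exact: nc_ge0.
by do 2 (apply: sumr_ge0 => ? _); exact: nc_ge0.
Qed.
Lemma nm_le0 p q (X : 'M[C]_(p, q)) : nm X <= 0 -> X = 0.
Proof.
move=> H; apply/matrixP => i j; rewrite mxE; apply: nc_eq0; apply/le_anti.
by rewrite nc_ge0 andbT (le_trans (nm_entry X i j) H).
Qed.
Lemma nmM p q s (X : 'M[C]_(p, q)) (Y : 'M[C]_(q, s)) : nm (X *m Y) <= nm X * nm Y.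
Proof.
rewrite [X in _ <= X * _]/nm mulr_suml; apply: ler_sum => i _.
apply: (@le_trans _ _ (\sum_j \sum_k nc (X i k) * nc (Y k j))).
  apply: ler_sum => j _; rewrite mxE; apply: le_trans (nc_sum _ _ _) _.
  by apply: ler_sum => k _; rewrite ncM.
rewrite exchange_big mulr_suml; apply: ler_sum => k _ /=.
rewrite -mulr_sumr ler_wpM2l ?nc_ge0 // /nm [leRHS](bigD1 k) //= lerDl.
by do 2 (apply: sumr_ge0 => ? _); exact: nc_ge0.
Qed.
Lemma nm_bound p q (X : 'M[C]_(p, q)) (b : R) : (forall i j, nc (X i j) <= b) ->
  nm X <= (p * q)%:R * b.
Proof.
move=> H; apply: (@le_trans _ _ (\sum_(i < p) \sum_(j < q) b)).
  by do 2 (apply: ler_sum => ? _); exact: H.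
by rewrite sumr_const sumr_const !card_ord -mulrnA mulr_natl mulnC.
Qed.
Lemma nm_tri p q (Y X Z : 'M[C]_(p, q)) a b : nm (X - Y) <= a -> nm (Y - Z) <= b -> nm (X - Z) <= a + b.
Proof.
move=> H1 H2; have -> : X - Z = (X - Y) + (Y - Z) by rewrite addrA subrK.
by apply: le_trans (nmD _ _) _; exact: lerD.
Qed.
Lemma nmM_le p q s (X : 'M[C]_(p, q)) (Y : 'M[C]_(q, s)) a b :
  nm X <= a -> nm Y <= b -> nm (X *m Y) <= a * b.
Proof.
move=> Ha Hb; apply: le_trans (nmM _ _) _.
by apply: ler_pM => //; exact: nm_ge0.
Qed.
Lemma nmD_le p q (X Y : 'M[C]_(p, q)) a b : nm X <= a -> nm Y <= b -> nm (X + Y) <= a + b.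
Proof. by move=> Ha Hb; apply: le_trans (nmD _ _) _; exact: lerD. Qed.
Lemma nmB_le p q (X Y : 'M[C]_(p, q)) a b : nm X <= a -> nm Y <= b -> nm (X - Y) <= a + b.
Proof. by move=> Ha Hb; apply: le_trans (nmB _ _) _; exact: lerD. Qed.
Lemma nm_mul1l p q (X : 'M[C]_(p, q)) U a u : nm X <= a -> nm (U - 1%:M) <= u - 1 -> nm (U *m X) <= u * a.
Proof.
move=> Ha Hu; have -> : U *m X = (U - 1%:M) *m X + X by rewrite mulmxBl mul1mx subrK.
apply: le_trans (nmD_le (nmM_le Hu Ha) Ha) _; lra.
Qed.
Lemma nm_mul1r p q (X : 'M[C]_(p, q)) U a u : nm X <= a -> nm (U - 1%:M) <= u - 1 -> nm (X *m U) <= a * u.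
Proof.
move=> Ha Hu; have -> : X *m U = X *m (U - 1%:M) + X by rewrite mulmxBr mulmx1 subrK.
apply: le_trans (nmD_le (nmM_le Ha Hu) Ha) _; lra.
Qed.
(** Bounds of the form u - 1 on the distance to the identity multiply, which is why the
growth rate below is an exponential minus one. *)
Lemma nm_mul11 p (U V : 'M[C]_p) u v : nm (U - 1%:M) <= u - 1 -> nm (V - 1%:M) <= v - 1 ->
  nm (U *m V - 1%:M) <= u * v - 1.
Proof.
move=> Hu Hv.
have -> : U *m V - 1%:M = (U - 1%:M) *m (V - 1%:M) + ((U - 1%:M) + (V - 1%:M)).
  rewrite mulmxBl !mulmxBr !mulmx1 !mul1mx.
  by apply/matrixP => i j; rewrite !mx_linE; ring.
apply: le_trans (nmD_le (nmM_le Hu Hv) (nmD_le Hu Hv)) _; lra.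
Qed.

(** The second order Taylor polynomial of exp (- a); together with evaluation of the
form at the midpoint it makes one step exact to second order. *)
Definition step p (a : 'M[C]_p) : 'M[C]_p := 1%:M - a + 2^-1 *: (a *m a).

Lemma step_mul p (c1 c2 : 'M[C]_p) : step c2 *m step c1 =
  1%:M - c1 - c2 + c2 *m c1 + 2^-1 *: (c1 *m c1) + 2^-1 *: (c2 *m c2)
  - 2^-1 *: (c2 *m c2 *m c1) - 2^-1 *: (c2 *m (c1 *m c1))
  + (2^-1 * 2^-1) *: (c2 *m c2 *m (c1 *m c1)).
Proof.
rewrite /step !mx_distr -!scalemxAl -!scalemxAr scalerA.
move: (c2 *m c2 *m (c1 *m c1)) (c2 *m (c1 *m c1)) (c2 *m c2 *m c1) => t1 t2 t3.
move: (c2 *m c2) (c2 *m c1) (c1 *m c1) => t4 t5 t6.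
by apply/matrixP => i j; rewrite !mx_linE; ring.
Qed.

(** The first bracket is the only term of second order in the side length, and flatness
cancels it; all other terms are of third order. *)
Lemma step_defect p (a1 a2 b1 b2 b3 : 'M[C]_p) :
  step (a2 + b2) *m step (a1 + b1) - step (a1 + a2 + b3) =
  (b3 - b1 - b2 - 2^-1 *: (a1 *m a2 - a2 *m a1))
  + (a2 *m b1 + b2 *m a1 + b2 *m b1)
  + 2^-1 *: (a1 *m b1 + b1 *m a1 + b1 *m b1)
  + 2^-1 *: (a2 *m b2 + b2 *m a2 + b2 *m b2)
  - 2^-1 *: ((a1 + a2) *m b3 + b3 *m (a1 + a2) + b3 *m b3)
  - 2^-1 *: ((a2 + b2) *m (a2 + b2) *m (a1 + b1))
  - 2^-1 *: ((a2 + b2) *m ((a1 + b1) *m (a1 + b1)))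
  + (2^-1 * 2^-1) *: ((a2 + b2) *m (a2 + b2) *m ((a1 + b1) *m (a1 + b1))).
Proof.
rewrite step_mul /step; set c1 := a1 + b1; set c2 := a2 + b2.
have e21 : c2 *m c1 = a2 *m a1 + (a2 *m b1 + b2 *m a1 + b2 *m b1).
  by rewrite /c1 /c2 !mx_distr; apply/matrixP => i j; rewrite !mx_linE; ring.
have e11 : c1 *m c1 = a1 *m a1 + (a1 *m b1 + b1 *m a1 + b1 *m b1).
  by rewrite /c1 /c2 !mx_distr; apply/matrixP => i j; rewrite !mx_linE; ring.
have e22 : c2 *m c2 = a2 *m a2 + (a2 *m b2 + b2 *m a2 + b2 *m b2).
  by rewrite /c1 /c2 !mx_distr; apply/matrixP => i j; rewrite !mx_linE; ring.
have e33 : (a1 + a2 + b3) *m (a1 + a2 + b3) = a1 *m a1 + a1 *m a2 + a2 *m a1 + a2 *m a2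
   + ((a1 + a2) *m b3 + b3 *m (a1 + a2) + b3 *m b3).
  by rewrite !mx_distr; apply/matrixP => i j; rewrite !mx_linE; ring.
rewrite e33.
move: (c2 *m c2 *m c1) (c2 *m (c1 *m c1)) (c2 *m c2 *m (c1 *m c1)) => t1 t2 t3.
rewrite e21 e11 e22 /c1 /c2; clear.
by apply/matrixP => i j; rewrite !mx_linE; field.
Qed.

Lemma nc2V : nc 2^-1 = 2^-1.
Proof.
have -> : (2^-1 : C) = (2^-1 : R)%:C%C by rewrite fmorphV rmorph_nat.
by rewrite ncR ger0_norm.
Qed.

(** With a_i of order d and b_i of order d^2 every monomial is at most c^4 d^3; the
constant collects their coefficients. *)
Lemma step_defect_le p (a1 a2 b1 b2 b3 : 'M[C]_p) (c d : R) :
  1 <= c -> 0 <= d -> d <= 1 ->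
  nm a1 <= c * d -> nm a2 <= c * d -> nm b1 <= c * d ^+ 2 -> nm b2 <= c * d ^+ 2 ->
  nm b3 <= 4 * c * d ^+ 2 ->
  nm (b3 - b1 - b2 - 2^-1 *: (a1 *m a2 - a2 *m a1)) <= 4 * c * d ^+ 3 ->
  nm (step (a2 + b2) *m step (a1 + b1) - step (a1 + a2 + b3)) <= 50 * c ^+ 4 * d ^+ 3.
Proof.
move=> c1 d0 d1 ha1 ha2 hb1 hb2 hb3 hr.
have nh (X : 'M[C]_p) b : nm X <= b -> nm (2^-1 *: X) <= 2^-1 * b.
  by move=> H; rewrite nmZ nc2V ler_pM2l.
have nq (X : 'M[C]_p) b : nm X <= b -> nm ((2^-1 * 2^-1) *: X) <= 4^-1 * b.
  by move=> H; rewrite nmZ ncM nc2V; have := nm_ge0 X; lra.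
have ha12 := nmD_le ha1 ha2.
have hc1 := nmD_le ha1 hb1; have hc2 := nmD_le ha2 hb2.
rewrite step_defect.
apply: le_trans (nmD_le (nmB_le (nmB_le (nmB_le (nmD_le (nmD_le (nmD_le hr _) (nh _ _ _))
  (nh _ _ _)) (nh _ _ _)) (nh _ _ _)) (nh _ _ _)) (nq _ _ _)) _.
- exact: nmD_le (nmD_le (nmM_le ha2 hb1) (nmM_le hb2 ha1)) (nmM_le hb2 hb1).
- exact: nmD_le (nmD_le (nmM_le ha1 hb1) (nmM_le hb1 ha1)) (nmM_le hb1 hb1).
- exact: nmD_le (nmD_le (nmM_le ha2 hb2) (nmM_le hb2 ha2)) (nmM_le hb2 hb2).
- exact: nmD_le (nmD_le (nmM_le ha12 hb3) (nmM_le hb3 ha12)) (nmM_le hb3 hb3).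
- exact: nmM_le (nmM_le hc2 hc2) hc1.
- exact: nmM_le hc2 (nmM_le hc1 hc1).
- exact: nmM_le (nmM_le hc2 hc2) (nmM_le hc1 hc1).
have c0 : 0 <= c by lra.
have cX k l : (k <= l)%N -> c ^+ k <= c ^+ l by move=> kl; exact: ler_weXn2l.
have dX k l : (k <= l)%N -> d ^+ l <= d ^+ k by move=> kl; exact: ler_wiXn2l.
have mon k l : (k <= 4)%N -> (3 <= l)%N -> c ^+ k * d ^+ l <= c ^+ 4 * d ^+ 3.
  by move=> kl ll; apply: ler_pM; rewrite ?exprn_ge0 ?cX ?dX.
have m13 := mon 1%N 3%N isT isT; have m23 := mon 2%N 3%N isT isT.
have m24 := mon 2%N 4%N isT isT; have m33 := mon 3%N 3%N isT isT.
have m34 := mon 3%N 4%N isT isT; have m35 := mon 3%N 5%N isT isT.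
have m36 := mon 3%N 6%N isT isT; have m44 := mon 4%N 4%N isT isT.
have m45 := mon 4%N 5%N isT isT; have m46 := mon 4%N 6%N isT isT.
have m47 := mon 4%N 7%N isT isT; have m48 := mon 4%N 8%N isT isT.
have q0 : 0 <= c ^+ 4 * d ^+ 3 by rewrite mulr_ge0 ?exprn_ge0.
lra.
Qed.
End MatrixNorm.

(** * Product integrals along segments *)

Section RealLimits.
Variable R : realType.
Notation C := R[i].
Notation nc := (@Normc.normc R).

(** The intervals of radius 2k/2^n about u n are nested, so the supremum of their left
ends works. *)
Lemma geo_limR (u : nat -> R) (k : R) : (forall n, `|u n.+1 - u n| <= k / 2 ^+ n) ->
  exists l, forall n, `|u n - l| <= 2 * k / 2 ^+ n.
Proof.
move=> H.
have k0 : 0 <= k by have := H 0%N; rewrite expr0 divr1; exact: le_trans.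
pose w n := u n - 2 * k / 2 ^+ n; pose v n := u n + 2 * k / 2 ^+ n.
have p2 n : 0 < (2 ^+ n : R) by rewrite exprn_gt0.
have E n : 2 * k / 2 ^+ n = 2 * (k / 2 ^+ n) by rewrite mulrA.
have ES n : k / 2 ^+ n.+1 = k / 2 ^+ n / 2 by rewrite exprSr invfM; ring.
have wS n : w n <= w n.+1.
  by rewrite /w !E ES; have := H n; rewrite ler_norml => /andP[]; lra.
have vS n : v n.+1 <= v n.
  by rewrite /v !E ES; have := H n; rewrite ler_norml => /andP[]; lra.
have wm m n : (m <= n)%N -> w m <= w n.
  elim: n => [|n IH]; first by rewrite leqn0 => /eqP->.
  by rewrite leq_eqVlt => /orP[/eqP->//|/IH/le_trans->].
have vm m n : (m <= n)%N -> v n <= v m.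
  elim: n => [|n IH]; first by rewrite leqn0 => /eqP->.
  by rewrite leq_eqVlt => /orP[/eqP->//|/IH]; exact: le_trans.
have wv m n : w m <= v n.
  have wvk j : w j <= v j by rewrite /w /v E; have := divr_ge0 k0 (ltW (p2 j)); lra.
  apply: le_trans (wm m (maxn m n) (leq_maxl _ _)) _; apply: le_trans (wvk _) _.
  exact: vm (leq_maxr _ _).
have hs : has_sup (range w).
  by split; [exists (w 0%N), 0%N|exists (v 0%N) => _ [n _ <-]].
exists (sup (range w)) => n; rewrite ler_norml.
have h1 : w n <= sup (range w) by apply: ub_le_sup; [case: hs|exists n].
have h2 : sup (range w) <= v n.
  by apply: ge_sup; [case: hs|move=> _ [m _ <-]].
by move: h1 h2; rewrite /w /v E; lra.
Qed.

Lemma nc_ReIm (z : C) : [/\ `|complex.Re z| <= nc z, `|complex.Im z| <= nc z &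
  nc z <= `|complex.Re z| + `|complex.Im z|].
Proof.
split.
- by case: z => a b /=; rewrite -sqrtr_sqr ler_wsqrtr // lerDl sqr_ge0.
- by case: z => a b /=; rewrite -sqrtr_sqr ler_wsqrtr // lerDr sqr_ge0.
have {1}-> : z = (complex.Re z)%:C%C + 'i%C * (complex.Im z)%:C%C by exact: complexE.
apply: le_trans (ncD _ _) _; rewrite ncM !ncR.
have -> : nc 'i%C = 1 by rewrite /= expr0n expr1n add0r sqrtr1.
by rewrite mul1r.
Qed.

Lemma geo_lim (u : nat -> C) (k : R) : (forall n, nc (u n.+1 - u n) <= k / 2 ^+ n) ->
  exists l, forall n, nc (u n - l) <= 4 * k / 2 ^+ n.
Proof.
move=> H.
have ReB (x y : C) : complex.Re (x - y) = complex.Re x - complex.Re y by case: x; case: y.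
have ImB (x y : C) : complex.Im (x - y) = complex.Im x - complex.Im y by case: x; case: y.
have [|a Ha] := @geo_limR (fun n => complex.Re (u n)) k.
  by move=> n; apply: le_trans (H n); have [] := nc_ReIm (u n.+1 - u n); rewrite ReB.
have [|b Hb] := @geo_limR (fun n => complex.Im (u n)) k.
  by move=> n; apply: le_trans (H n); have [] := nc_ReIm (u n.+1 - u n); rewrite ImB.
exists (Complex a b) => n; have [_ _ h] := nc_ReIm (u n - Complex a b).
apply: le_trans h _; rewrite ReB ImB /=.
have := Ha n; have := Hb n; rewrite -!mulrA; lra.
Qed.
End RealLimits.

Section Midpoints.
Variables (R : realType) (K : numFieldType) (iota : {rmorphism K -> R[i]}).
Notation C := R[i].
Notation pt := 'rV[K]_5.
Notation nv := (@nv R K iota).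
Definition mid (p q : pt) : pt := 2^-1 *: (p + q).
Lemma nv_half (u : pt) : nv (2^-1 *: u) = nv u / 2.
Proof. by rewrite nvZ fmorphV rmorph_nat nc2V mulrC. Qed.
Lemma mid_l (p q : pt) : mid p q - p = 2^-1 *: (q - p).
Proof. by apply/rowP => i; rewrite !mxE; field. Qed.
Lemma mid_r (p q : pt) : q - mid p q = 2^-1 *: (q - p).
Proof. by apply/rowP => i; rewrite !mxE; field. Qed.

Lemma nv_mid_l (p q : pt) : nv (mid p q - p) = nv (q - p) / 2.
Proof. by rewrite mid_l nv_half. Qed.
Lemma nv_mid_r (p q : pt) : nv (q - mid p q) = nv (q - p) / 2.
Proof. by rewrite mid_r nv_half. Qed.

Lemma le_pow2 (a b : R) : (forall n, a <= b / 2 ^+ n) -> a <= 0.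
Proof.
move=> H; rewrite leNgt; apply/negP => a0.
have b0 : 0 <= b by have := H 0%N; rewrite expr0 divr1; lra.
have := archi_boundP (divr_ge0 b0 (ltW a0)); set n := Num.bound _.
have := H n; rewrite ler_pdivlMr ?exprn_gt0 // ltr_pdivrMr // => h1 h2.
have h3 : (n%:R : R) <= 2 ^+ n by rewrite -natrX ler_nat ltnW // ltn_expl.
have : n%:R * a <= 2 ^+ n * a by rewrite ler_pM2r.
lra.
Qed.

(** Chooses the subdivision for which a strip of width d is cut into squares of side
about d. *)
Lemma dyadic (d : R) : 0 < d -> d <= 1 -> exists n, 1 <= 2 ^+ n * d /\ 2 ^+ n * d <= 2.
Proof.
move=> d0 d1.
have ex : exists n, 1 <= 2 ^+ n * d.
  have di : 0 <= d^-1 by rewrite invr_ge0 ltW.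
  have := archi_boundP di.
  set n := Num.bound _ => h; exists n; rewrite -ler_pdivrMr // div1r.
  by apply: le_trans (ltW h) _; rewrite -natrX ler_nat ltnW // ltn_expl.
exists (ex_minn ex); case: ex_minnP => -[|n] h1 h2; first by rewrite expr0 mul1r in h1 *; split=> //; lra.
split=> //; have := h2 n; case: (leP 1 (2 ^+ n * d)) => [_ /(_ isT)|h _]; first by rewrite ltnn.
by rewrite exprS; lra.
Qed.

End Midpoints.

Section GrowthRate.
Variables (R : realType) (c : R).
Hypothesis c0 : 0 <= c.
(** An upper bound for the norm of the transport over a segment of length t; the factor
2 absorbs the quadratic term of a step. *)
Definition growth (t : R) : R := expR (2 * c * t).
Lemma growthD s t : growth (s + t) = growth s * growth t.
Proof. by rewrite /growth mulrDr expRD. Qed.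
Lemma growth_half t : growth t = growth (t / 2) * growth (t / 2).
Proof. by rewrite -growthD; congr growth; field. Qed.
Lemma growth_ge1 t : 0 <= t -> 1 <= growth t.
Proof. by move=> t0; rewrite -expR0 ler_expR !mulr_ge0. Qed.
Lemma growth_gt0 t : 0 < growth t.
Proof. exact: expR_gt0. Qed.
Lemma growth_le s t : s <= t -> growth s <= growth t.
Proof. by move=> st; rewrite ler_expR ler_wpM2l // mulr_ge0. Qed.

End GrowthRate.

Section Limit.
Variables (R : realType) (K : numFieldType) (iota : {rmorphism K -> R[i]}).
Notation C := R[i].
Notation pt := 'rV[K]_5.
Notation nv := (@nv R K iota).
Variables (r : nat) (B : pt -> Prop) (S : pt -> pt -> 'M[C]_r) (c k : R).
Notation mat := 'M[C]_r.
Notation E := (growth c).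
Hypothesis c0 : 0 <= c.
Hypothesis k0 : 0 <= k.
Hypothesis Bmid : forall p q, B p -> B q -> B (mid p q).
Hypothesis Bdiam : forall p q, B p -> B q -> nv (q - p) <= 1.
Hypothesis S_bd : forall p q, B p -> B q -> nm (S p q - 1%:M) <= E (nv (q - p)) - 1.
Hypothesis triangle : forall p q s (d : R), B p -> B q -> B s -> 0 <= d -> d <= 1 ->
  nv (q - p) <= d -> nv (s - q) <= d -> nm (S q s *m S p q - S p s) <= k * d ^+ 3.

Fixpoint dyadic_product n p q : mat :=
  if n is n'.+1 then dyadic_product n' (mid p q) q *m dyadic_product n' p (mid p q) else S p q.
Lemma dyadic_product_bound n p q : B p -> B q -> nm (dyadic_product n p q - 1%:M) <= E (nv (q - p)) - 1.
Proof.
elim: n p q => [|n IH] p q Bp Bq; first exact: S_bd.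
have Bm := Bmid Bp Bq.
have h1 := IH _ _ Bm Bq; have h2 := IH _ _ Bp Bm.
rewrite nv_mid_r in h1; rewrite nv_mid_l in h2.
by rewrite growth_half; exact: nm_mul11 h1 h2.
Qed.

(** Halving once changes the product by a triangle defect, of third order in the length;
at the next level there are twice as many defects, each eight times smaller. *)
Lemma dyadic_product_cauchy n p q : B p -> B q ->
  nm (dyadic_product n.+1 p q - dyadic_product n p q) <= k * nv (q - p) ^+ 3 * E (nv (q - p)) / 4 ^+ n.
Proof.
elim: n p q => [|n IH] p q Bp Bq; have Bm := Bmid Bp Bq; set l := nv (q - p);
  have l0 : 0 <= l := nv_ge0 iota _.
  rewrite expr0 divr1.
  have H := @triangle p (mid p q) q (l / 2) Bp Bm Bq.
  have l1 := Bdiam Bp Bq; rewrite -/l in l1.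
  rewrite nv_mid_l nv_mid_r -/l lexx in H.
  have {H}H := H ltac:(lra) ltac:(lra) isT isT.
  apply: le_trans H _; rewrite -/k -mulrA ler_wpM2l //.
  have l3 : 0 <= l ^+ 3 by rewrite exprn_ge0.
  have := ler_wpM2l l3 (growth_ge1 c0 l0); rewrite mulr1.
  have -> : (l / 2) ^+ 3 = l ^+ 3 / 8 by field.
  lra.
have h1 := IH _ _ Bm Bq; have h2 := IH _ _ Bp Bm.
rewrite nv_mid_r -/l in h1; rewrite nv_mid_l -/l in h2.
have b1 := dyadic_product_bound n Bm Bq; have b2 := dyadic_product_bound n.+1 Bp Bm.
rewrite nv_mid_r -/l in b1; rewrite nv_mid_l -/l in b2.
have -> : dyadic_product n.+2 p q - dyadic_product n.+1 p q =
  (dyadic_product n.+1 (mid p q) q - dyadic_product n (mid p q) q) *m dyadic_product n.+1 p (mid p q) +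
  dyadic_product n (mid p q) q *m (dyadic_product n.+1 p (mid p q) - dyadic_product n p (mid p q)).
  rewrite [dyadic_product n.+2 p q]/= [dyadic_product n.+1 p q in LHS]/= mulmxBl mulmxBr.
  by rewrite addrA subrK.
apply: le_trans (nmD_le (nm_mul1r h1 b2) (nm_mul1l h2 b1)) _.
rewrite [E l]growth_half [4 ^+ n.+1]exprSr le_eqVlt; apply/orP; left; apply/eqP.
have p4 : (4 ^+ n : R) != 0 by rewrite expf_neq0.
by field.
Qed.

Definition weight p q : R := nv (q - p) ^+ 3 * E (nv (q - p)).
Lemma weight_ge0 p q : 0 <= weight p q.
Proof. by rewrite /weight mulr_ge0 ?exprn_ge0 ?nv_ge0 // ltW // growth_gt0. Qed.

Lemma product_integral_exists : exists (T : pt -> pt -> mat) (kk : R), 0 <= kk /\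
  forall n p q, B p -> B q -> nm (dyadic_product n p q - T p q) <= kk * weight p q / 2 ^+ n.
Proof.
pose T p q : mat := \matrix_(i, j)
  xget 0 [set l | forall n, Normc.normc (dyadic_product n p q i j - l) <= 4 * (k * weight p q) / 2 ^+ n].
exists T, ((r * r)%:R * (4 * k)); split; first by rewrite !mulr_ge0.
move=> n p q.
have -> : (r * r)%:R * (4 * k) * weight p q / 2 ^+ n = (r * r)%:R * (4 * (k * weight p q) / 2 ^+ n) by rewrite !mulrA.
move=> Bp Bq; apply: nm_bound => i j; rewrite !mxE.
have [|l Hl] := @geo_lim R (fun n => dyadic_product n p q i j) (k * weight p q).
  move=> m; have := nm_entry (dyadic_product m.+1 p q - dyadic_product m p q) i j; rewrite mx_addE mx_oppE.
  move=> /le_trans; apply; apply: le_trans (dyadic_product_cauchy m Bp Bq) _.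
  rewrite -[k * _ * _]mulrA -/(weight p q) (ler_wpM2l (mulr_ge0 k0 (weight_ge0 _ _))) // lef_pV2 ?posrE ?exprn_gt0 //.
  by rewrite lerXn2r ?nnegrE //; lra.
have := @xgetPex _ 0 [set l | forall n, Normc.normc (dyadic_product n p q i j - l) <= 4 * (k * weight p q) / 2 ^+ n].
by move=> /(_ (ex_intro _ l Hl)) /(_ n).
Qed.

Variables (T : pt -> pt -> mat) (kk : R).
Hypothesis kk0 : 0 <= kk.
Hypothesis T_lim : forall n p q, B p -> B q -> nm (dyadic_product n p q - T p q) <= kk * weight p q / 2 ^+ n.
Lemma product_integral_bound p q : B p -> B q -> nm (T p q - 1%:M) <= E (nv (q - p)) - 1.
Proof.
move=> Bp Bq; rewrite -subr_le0; apply: (@le_pow2 _ _ (kk * weight p q)) => n.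
have h := T_lim n Bp Bq.
have h1 : nm (T p q - dyadic_product n p q) <= kk * weight p q / 2 ^+ n by rewrite -nmN opprB.
by have := nm_tri h1 (dyadic_product_bound n Bp Bq); lra.
Qed.

(** Multiplicativity over the two halves passes to the limit, which lets the strip
estimate proceed by bisection. *)
Lemma product_integral_mul p q : B p -> B q -> T p q = T (mid p q) q *m T p (mid p q).
Proof.
move=> Bp Bq; have Bm := Bmid Bp Bq.
apply/eqP; rewrite -subr_eq0; apply/eqP/nm_le0.
have T1 := product_integral_bound Bm Bq.
apply: (@le_pow2 _ _ (kk * weight p q + (kk * weight (mid p q) q * E (nv (mid p q - p)) +
   E (nv (q - mid p q)) * (kk * weight p (mid p q))))) => n.
have h0 : nm (T p q - dyadic_product n.+1 p q) <= kk * weight p q / 2 ^+ n.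
  rewrite -nmN opprB; apply: le_trans (T_lim n.+1 Bp Bq) _.
  by rewrite (ler_wpM2l (mulr_ge0 kk0 (weight_ge0 _ _))) // lef_pV2 ?posrE ?exprn_gt0 // exprS ler_peMl ?exprn_ge0; lra.
have h1 := nm_mul1r (T_lim n Bm Bq) (dyadic_product_bound n Bp Bm).
have h2 := nm_mul1l (T_lim n Bp Bm) T1.
have h3 : nm (dyadic_product n.+1 p q - T (mid p q) q *m T p (mid p q)) <= _ := le_trans _ (nmD_le h1 h2).
apply: le_trans (nm_tri h0 (h3 _)) _.
  by rewrite mulmxBl mulmxBr addrA subrK.
rewrite le_eqVlt; apply/orP; left; apply/eqP.
by move: (weight _ _) (weight _ _) (weight _ _) (E _) (E _) ((2 ^+ n)^-1) => ? ? ? ? ? ?; ring.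
Qed.

Lemma product_integral_step p q : B p -> B q -> nm (T p q - S p q) <= kk * weight p q.
Proof. by move=> Bp Bq; rewrite -nmN opprB; have := T_lim 0 Bp Bq; rewrite expr0 divr1. Qed.

(** Transport along two nearby sides of a thin quadrilateral differs by the accumulated
defect of about 1/d squares of side d, each of third order: the total is of second
order in d. The induction bisects the strip. *)
Lemma strip_defect n p q p' q' (d : R) : B p -> B q -> B p' -> B q' -> 0 <= d -> d <= 1 ->
  nv (q - p) <= 2 ^+ n * d -> nv (q' - p') <= 2 ^+ n * d -> nv (p' - p) <= d -> nv (q' - q) <= d ->
  nm (T p' q' *m S p p' - S q q' *m T p q) <= 2 ^+ n * (2 * (kk + k) * d ^+ 3 * E d) * E (2 ^+ n * d).
Proof.
elim: n p q p' q' => [|n IH] p q p' q' Bp Bq Bp' Bq' d0 d1 pq pq' pp qq.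
  rewrite expr0 !mul1r in pq pq' *.
  have LE x y : nv (y - x) <= d -> kk * weight x y <= kk * (d ^+ 3 * E d).
    move=> h; rewrite ler_wpM2l // ler_pM ?exprn_ge0 ?nv_ge0 //; [exact: ltW (growth_gt0 _ _)| |exact: (growth_le c0)].
    by rewrite lerXn2r ?nnegrE ?nv_ge0.
  have h1 := le_trans (product_integral_step Bp' Bq') (LE _ _ pq').
  have h2 := le_trans (product_integral_step Bp Bq) (LE _ _ pq).
  have e1 : nm (S p p' - 1%:M) <= E d - 1.
    by apply: le_trans (S_bd Bp Bp') _; rewrite lerD2r (growth_le c0).
  have e2 : nm (S q q' - 1%:M) <= E d - 1.
    by apply: le_trans (S_bd Bq Bq') _; rewrite lerD2r (growth_le c0).
  have h3 := triangle Bp Bp' Bq' d0 d1 pp pq'.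
  have h4 := triangle Bp Bq Bq' d0 d1 pq qq.
  have -> : T p' q' *m S p p' - S q q' *m T p q =
    (T p' q' - S p' q') *m S p p' + (S p' q' *m S p p' - S p q')
    - ((S q q' *m S p q - S p q') + S q q' *m (T p q - S p q)).
    rewrite mulmxBl mulmxBr.
    move: (T p' q' *m _) (S p' q' *m _) (_ *m T p q) (_ *m S p q) (S p q') => t1 t2 t3 t4 t5.
    by apply/matrixP => i j; rewrite !mx_linE; ring.
  apply: le_trans (nmB_le (nmD_le (nm_mul1r h1 e1) h3) (nmD_le h4 (nm_mul1l h2 e2))) _.
  have E1 := growth_ge1 c0 d0; have d3 : 0 <= d ^+ 3 by rewrite exprn_ge0.
  have kd : 0 <= k * d ^+ 3 by rewrite mulr_ge0.
  have : k * d ^+ 3 * 1 <= k * d ^+ 3 * (E d * E d).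
    by rewrite ler_wpM2l // -[1]mulr1 ler_pM.
  rewrite -/k; lra.
have Bm := Bmid Bp Bq; have Bm' := Bmid Bp' Bq'.
have mm : nv (mid p' q' - mid p q) <= d.
  have -> : mid p' q' - mid p q = 2^-1 *: ((p' - p) + (q' - q)).
    by apply/rowP => i; rewrite !mxE; field.
  by rewrite nv_half; have := nvD iota (p' - p) (q' - q); lra.
have pn : (0 : R) <= 2 ^+ n * d by rewrite mulr_ge0 ?exprn_ge0.
have half x : x <= 2 ^+ n.+1 * d -> x / 2 <= 2 ^+ n * d by rewrite exprS; lra.
have i1 := IH p (mid p q) p' (mid p' q') Bp Bm Bp' Bm' d0 d1.
rewrite !nv_mid_l in i1; have {}i1 := i1 (half _ pq) (half _ pq') pp mm.
have i2 := IH (mid p q) q (mid p' q') q' Bm Bq Bm' Bq' d0 d1.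
rewrite !nv_mid_r in i2; have {}i2 := i2 (half _ pq) (half _ pq') mm qq.
have b1 : nm (T (mid p' q') q' - 1%:M) <= E (2 ^+ n * d) - 1.
  by apply: le_trans (product_integral_bound Bm' Bq') _; rewrite lerD2r (growth_le c0) // nv_mid_r half.
have b2 : nm (T p (mid p q) - 1%:M) <= E (2 ^+ n * d) - 1.
  by apply: le_trans (product_integral_bound Bp Bm) _; rewrite lerD2r (growth_le c0) // nv_mid_l half.
rewrite (product_integral_mul Bp Bq) (product_integral_mul Bp' Bq').
have -> : T (mid p' q') q' *m T p' (mid p' q') *m S p p' - S q q' *m (T (mid p q) q *m T p (mid p q)) =
  T (mid p' q') q' *m (T p' (mid p' q') *m S p p' - S (mid p q) (mid p' q') *m T p (mid p q)) +
  (T (mid p' q') q' *m S (mid p q) (mid p' q') - S q q' *m T (mid p q) q) *m T p (mid p q).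
  by rewrite mulmxBr mulmxBl !mulmxA addrA subrK.
apply: le_trans (nmD_le (nm_mul1l i1 b1) (nm_mul1r i2 b2)) _.
have -> : E (2 ^+ n.+1 * d) = E (2 ^+ n * d) * E (2 ^+ n * d).
  by rewrite -growthD exprS; congr E; ring.
rewrite [2 ^+ n.+1]exprS le_eqVlt; apply/orP; left; apply/eqP.
by move: (E (2 ^+ n * d)) (2 ^+ n) (E d) => x y z; ring.
Qed.

Lemma product_integral_refl p : B p -> S p p = 1%:M -> T p p = 1%:M.
Proof.
move=> Bp Spp.
have mpp : mid p p = p by apply/rowP => i; rewrite !mxE; field.
have Tnpp n : dyadic_product n p p = 1%:M by elim: n => //= n IH; rewrite mpp IH mulmx1.
apply/eqP; rewrite -subr_eq0; apply/eqP/nm_le0.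
apply: (@le_pow2 _ _ (kk * weight p p)) => n; rewrite -(Tnpp n) -nmN opprB.
exact: T_lim.
Qed.

End Limit.

Section Propagator.
Variables (R : realType) (K : numFieldType) (iota : {rmorphism K -> R[i]}).
Notation C := R[i].
Notation pt := 'rV[K]_5.
Notation nv := (@nv R K iota).
Variable r : nat.
Notation mat := 'M[C]_r.
Variables (B : pt -> Prop) (A : pt -> pt -> mat) (D : pt -> pt -> pt -> mat) (c : R).
Hypothesis Bmid : forall p q, B p -> B q -> B (mid p q).
Hypothesis Bdiam : forall p q, B p -> B q -> nv (q - p) <= 1.
Hypothesis AD : forall y u v, A y (u + v) = A y u + A y v.
Hypothesis DD1 : forall y u v w, D y (u + v) w = D y u w + D y v w.
Hypothesis DD2 : forall y u v w, D y w (u + v) = D y w u + D y w v.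
Hypothesis DZ : forall y u v, D y (2^-1 *: u) v = 2^-1 *: D y u v.
Hypothesis c1 : 1 <= c.
Hypothesis hA : forall y h, B y -> nm (A y h) <= c * nv h.
Hypothesis hD : forall z u h, B z -> nm (D z u h) <= c * nv u * nv h.
Hypothesis hT : forall y z h, B y -> B z ->
  nm (A y h - A z h - D z (y - z) h) <= c * nv (y - z) ^+ 2 * nv h.
Hypothesis flat : forall z u v, B z ->
  D z u v - D z v u + A z u *m A z v - A z v *m A z u = 0.

Definition midstep p q : mat := step (A (mid p q) (q - p)).
Let c0 : 0 <= c.
Proof. exact: le_trans ler01 c1. Qed.
Notation E := (growth c).
Let form_at0 y : A y 0 = 0.
Proof. by apply: (addrI (A y 0)); rewrite -AD !addr0. Qed.
Let deriv_opp y u w : D y (- u) w = - D y u w.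
Proof.
have D10 : D y 0 w = 0 by apply: (addrI (D y 0 w)); rewrite -DD1 !addr0.
by apply/eqP; rewrite -addr_eq0 -DD1 addNr D10.
Qed.
(** Expanding the form at the common vertex q, the second order part of the defect is
D(u,v) - D(v,u) + [A u, A v], up to a factor one half, and this vanishes by
flatness. *)
Lemma triangle_defect p q s (d : R) : B p -> B q -> B s -> 0 <= d -> d <= 1 ->
  nv (q - p) <= d -> nv (s - q) <= d ->
  nm (midstep q s *m midstep p q - midstep p s) <= 50 * c ^+ 4 * d ^+ 3.
Proof.
move=> Bp Bq Bs d0 d1 pq qs.
set u := q - p in pq *; set v := s - q in qs *.
have us : s - p = u + v by apply/rowP => i; rewrite !mxE; ring.
have m1 : mid p q - q = - (2^-1 *: u) by rewrite -mid_r opprB.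
have m2 : mid q s - q = 2^-1 *: v by rewrite mid_l.
have m3 : mid p s - q = 2^-1 *: (v - u).
  by apply/rowP => i; rewrite !mxE; field.
have nvu := nv_ge0 iota u; have nvv := nv_ge0 iota v.
have nuv : nv (v - u) <= 2 * d by apply: le_trans (nvD _ _ _) _; rewrite nvN; lra.
have nuv' : nv (u + v) <= 2 * d by apply: le_trans (nvD _ _ _) _; lra.
rewrite /midstep us -/u -/v; clearbody u v.
have [e1 E1] : exists e, e = A (mid p q) u - A q u - D q (mid p q - q) u by eexists.
have [e2 E2] : exists e, e = A (mid q s) v - A q v - D q (mid q s - q) v by eexists.
have [e3 E3] : exists e, e = A (mid p s) (u + v) - A q (u + v) - D q (mid p s - q) (u + v) by eexists.
have d2 : 0 <= d ^+ 2 by rewrite exprn_ge0.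
have d3 : 0 <= d ^+ 3 by rewrite exprn_ge0.
have cd3 : 0 <= c * d ^+ 3 by rewrite mulr_ge0.
have d2m (x y : R) : 0 <= x -> 0 <= y -> x <= d / 2 -> y <= d -> c * x ^+ 2 * y <= c * d ^+ 3 / 4.
  move=> x0 y0 xd yd; rewrite -!mulrA ler_wpM2l //.
  have : x * (x * y) <= (d / 2) * ((d / 2) * d) by rewrite !ler_pM ?mulr_ge0.
  lra.
have B1 := Bmid Bp Bq; have B2 := Bmid Bq Bs; have B3 := Bmid Bp Bs.
have h1 : nm e1 <= c * d ^+ 3 / 4.
  by rewrite E1; apply: le_trans (hT _ B1 Bq) _; rewrite m1 nvN nv_half; apply: d2m => //; lra.
have h2 : nm e2 <= c * d ^+ 3 / 4.
  by rewrite E2; apply: le_trans (hT _ B2 Bq) _; rewrite m2 nv_half; apply: d2m => //; lra.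
have h3 : nm e3 <= c * d ^+ 3 * 2.
  rewrite E3; apply: le_trans (hT _ B3 Bq) _; rewrite m3 nv_half.
  have n0 := nv_ge0 iota (v - u); have n1 := nv_ge0 iota (u + v).
  have : (nv (v - u) / 2) ^+ 2 * nv (u + v) <= d ^+ 2 * (2 * d).
    by rewrite ler_pM ?exprn_ge0 ?divr_ge0 // lerXn2r ?nnegrE ?divr_ge0 //; lra.
  by move=> /(ler_wpM2l c0); move: (nv _) (nv _) => n3 n4; lra.
have b1E : A (mid p q) u = A q u + (e1 - 2^-1 *: D q u u).
  rewrite E1 m1 deriv_opp DZ opprK; move: (A _ u) (A _ u) (_ *: _) => x y z.
  by rewrite addrK addrC subrK.
have b2E : A (mid q s) v = A q v + (e2 + 2^-1 *: D q v v).
  by rewrite E2 m2 DZ subrK addrC subrK.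
have b3E : A (mid p s) (u + v) = A q u + A q v + (e3 + 2^-1 *: D q (v - u) (u + v)).
  by rewrite E3 m3 DZ -(AD q u v); move: (A _ _) (A _ _) (_ *: _) => x y z; rewrite subrK addrC subrK.
rewrite b1E b2E b3E.
have hDD x y (a b : R) : nv x <= a -> nv y <= b -> nm (2^-1 *: D q x y) <= 2^-1 * (c * (a * b)).
  move=> xa yb; rewrite nmZ nc2V ler_pM2l //; apply: le_trans (hD _ _ Bq) _.
  by rewrite -mulrA ler_wpM2l // ler_pM ?nv_ge0.
have cd23 : c * d ^+ 3 <= c * d ^+ 2.
  by rewrite ler_wpM2l // [d ^+ 3]exprSr ler_piMr.
have cdd : c * (d * d) = c * d ^+ 2 by rewrite expr2.
apply: step_defect_le => //.
- by apply: le_trans (hA _ Bq) _; rewrite ler_wpM2l.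
- by apply: le_trans (hA _ Bq) _; rewrite ler_wpM2l.
- by apply: le_trans (nmB_le h1 (hDD _ _ _ _ pq pq)) _; lra.
- by apply: le_trans (nmD_le h2 (hDD _ _ _ _ qs qs)) _; lra.
- by apply: le_trans (nmD_le h3 (hDD _ _ _ _ nuv nuv')) _; lra.
have -> : e3 + 2^-1 *: D q (v - u) (u + v) - (e1 - 2^-1 *: D q u u) - (e2 + 2^-1 *: D q v v)
  - 2^-1 *: (A q u *m A q v - A q v *m A q u) = e3 - e1 - e2.
  have := flat u v Bq => F.
  rewrite DD2 !DD1 !deriv_opp.
  have -> : A q u *m A q v - A q v *m A q u = D q v u - D q u v.
    apply/eqP; rewrite -subr_eq0; apply/eqP; rewrite -[RHS]F.
    move: (A q u *m A q v) (A q v *m A q u) (D q v u) (D q u v) => t1 t2 t3 t4.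
    by apply/matrixP => i j; rewrite !mx_linE; ring.
  move: (D q v u) (D q u v) (D q u u) (D q v v) => t1 t2 t3 t4.
  by apply/matrixP => i j; rewrite !mx_linE; field.
by apply: le_trans (nmB_le (nmB_le h3 h1) h2) _; lra.
Qed.

Lemma midstep_bound p q : B p -> B q -> nm (midstep p q - 1%:M) <= E (nv (q - p)) - 1.
Proof.
move=> Bp Bq; set l := nv (q - p); have l0 : 0 <= l := nv_ge0 iota _.
have ha := hA (q - p) (Bmid Bp Bq); rewrite /midstep /step -/l in ha *.
move: (A _ _) ha => a ha.
have -> : 1%:M - a + 2^-1 *: (a *m a) - 1%:M = 2^-1 *: (a *m a) - a.
  by move: (a *m a) => b; apply/matrixP => i j; rewrite !mx_linE; ring.
apply: le_trans (nmB_le (a := 2^-1 * ((c * l) * (c * l))) _ ha) _.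
  by rewrite nmZ nc2V; apply: ler_wpM2l => //; exact: (nmM_le ha ha).
have cl0 : 0 <= c * l by rewrite mulr_ge0.
have h := expR_ge1Dx (c * l).
have -> : E l = expR (c * l) * expR (c * l) by rewrite -expRD /E; congr expR; ring.
have : (1 + c * l) * (1 + c * l) <= expR (c * l) * expR (c * l).
  by rewrite ler_pM ?addr_ge0.
have : 0 <= (c * l) * (c * l) by rewrite mulr_ge0.
lra.
Qed.

Lemma midstep_linear x y : B x -> B y ->
  nm (midstep x y - 1%:M + A x (y - x)) <= (4 * c ^+ 2) * nv (y - x) ^+ 2.
Proof.
move=> Bx By; have Bm := Bmid Bx By; set u := y - x; set l := nv u.
have l0 : 0 <= l := nv_ge0 iota _; have l1 : l <= 1 := Bdiam Bx By.
have h1 := hT u Bm Bx; rewrite mid_l -/u DZ nv_half -/l in h1.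
have h2 := hD u u Bx; rewrite -/l in h2.
have h3 := hA u Bm; rewrite -/l in h3.
rewrite /midstep -/u /step; move: (A x u) (A (mid x y) u) (D x u u) h1 h2 h3 => b a e h1 h2 h3.
have -> : 1%:M - a + 2^-1 *: (a *m a) - 1%:M + b = 2^-1 *: (a *m a) - ((a - b - 2^-1 *: e) + 2^-1 *: e).
  by move: (a *m a) => z; apply/matrixP => i j; rewrite !mx_linE; ring.
have ha : nm (2^-1 *: (a *m a)) <= 2^-1 * ((c * l) * (c * l)).
  by rewrite nmZ nc2V; apply: ler_wpM2l => //; exact: (nmM_le h3 h3).
have he : nm (2^-1 *: e) <= 2^-1 * (c * l * l) by rewrite nmZ nc2V ler_wpM2l.
apply: le_trans (nmB_le ha (nmD_le h1 he)) _.
have l2 : 0 <= l ^+ 2 by rewrite exprn_ge0.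
have cc : c <= c ^+ 2 by rewrite expr2 ler_peMl.
have q1 : c * l ^+ 2 * l <= c ^+ 2 * l ^+ 2 * 1 by rewrite !ler_pM ?mulr_ge0 ?exprn_ge0.
have q2 : c * l ^+ 2 <= c ^+ 2 * l ^+ 2 by rewrite ler_wpM2r.
have q3 : 0 <= c * l ^+ 2 by rewrite mulr_ge0.
have -> : c * (l / 2) ^+ 2 * l = (c * l ^+ 2 * l) / 4 by field.
have -> : c * l * l = c * l ^+ 2 by ring.
have -> : c * l * (c * l) = c ^+ 2 * l ^+ 2 by ring.
lra.
Qed.

(** By the strip estimate T y is midstep x y times T x up to second order, and midstep x
y is 1 - A (y - x) up to second order. *)
Theorem propagator x0 : B x0 -> exists T : pt -> mat, T x0 = 1%:M /\ exists M : R, forall x y, B x -> B y ->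
  nm (T y - T x + A x (y - x) *m T x) <= M * nv (y - x) ^+ 2.
Proof.
move=> B0; pose k := 50 * c ^+ 4.
have k0 : 0 <= k by rewrite mulr_ge0 ?exprn_ge0.
have tri := triangle_defect : forall p q s (d : R), _ -> _ -> _ -> _ -> _ -> _ -> _ -> _ <= k * d ^+ 3.
have [T [kk [kk0 T_lim]]] := product_integral_exists c0 k0 Bmid Bdiam midstep_bound tri.
have TB p q := @product_integral_bound _ _ _ _ _ _ _ Bmid midstep_bound _ _ T_lim p q.
have TR p : B p -> T p p = 1%:M.
  move=> Bp; apply: (product_integral_refl T_lim) => //.
  by rewrite /midstep subrr form_at0 /step subr0 mulmx0 scaler0 addr0.
exists (T x0); split; first exact: TR.
exists (2 * (2 * (kk + k) * E 1) * E 2 + 4 * c ^+ 2 * (nm (1%:M : mat) + (E 1 - 1))) => x y Bx By.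
have [yx|yx] := eqVneq y x; first by rewrite yx !subrr nv0 form_at0 mul0mx add0r nm0 expr0n mulr0.
set d := nv (y - x).
have d0 : 0 < d.
  rewrite lt0r nv_ge0 andbT; apply: contra yx => /eqP dz; rewrite -subr_eq0; apply/eqP/rowP => i.
  rewrite [RHS]mxE; apply/eqP; rewrite -(fmorph_eq0 iota); apply/eqP/nc_eq0/le_anti.
  rewrite nc_ge0 andbT -dz /d /nv [leRHS](bigD1 i) //= lerDl.
  by apply: sumr_ge0 => j _; exact: nc_ge0.
have d1 : d <= 1 := Bdiam Bx By.
have [n [n1 n2]] := dyadic d0 d1.
have H := strip_defect c0 k0 Bmid midstep_bound tri kk0 T_lim (n := n) (d := d) B0 Bx B0 By (ltW d0) d1 (le_trans (Bdiam B0 Bx) n1) (le_trans (Bdiam B0 By) n1).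
rewrite subrr nv0 in H; have {H} := H (ltW d0) (lexx _).
have Sxx : midstep x0 x0 = 1%:M by rewrite /midstep subrr form_at0 /step subr0 mulmx0 scaler0 addr0.
rewrite Sxx mulmx1 => H.
have Tb : nm (T x0 x) <= nm (1%:M : mat) + (E 1 - 1).
  have -> : T x0 x = 1%:M + (T x0 x - 1%:M) by rewrite addrC subrK.
  apply: nmD_le => //; apply: le_trans (TB _ _ B0 Bx) _.
  by rewrite lerD2r (growth_le c0) // Bdiam.
have -> : T x0 y - T x0 x + A x (y - x) *m T x0 x = (T x0 y - midstep x y *m T x0 x) +
  (midstep x y - 1%:M + A x (y - x)) *m T x0 x.
  move: (midstep x y) (A x _) (T x0 y) (T x0 x) => t1 t2 t3 t4; rewrite mulmxDl mulmxBl mul1mx.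
  move: (t1 *m _) (t2 *m _) => t5 t6; by apply/matrixP => i j; rewrite !mx_linE; ring.
apply: le_trans (nmD_le H (nmM_le (midstep_linear Bx By) Tb)) _; rewrite -/d.
have E1 := growth_le c0 d1; have E2 := growth_le c0 n2; have e0 := ltW (growth_gt0 c d); have f0 := ltW (growth_gt0 c (2 ^+ n * d)).
have d2 : 0 <= d ^+ 2 by rewrite exprn_ge0 // ltW.
have kk2 : 0 <= 2 * (kk + k) by rewrite mulr_ge0 ?addr_ge0.
have : (2 ^+ n * d) * (2 * (kk + k) * E d) * E (2 ^+ n * d) <= 2 * (2 * (kk + k) * E 1) * E 2.
  have q0 : 0 <= 2 ^+ n * d by rewrite mulr_ge0 ?exprn_ge0 // ltW.
  have q1 := ler_wpM2l kk2 E1; have q2 : 0 <= 2 * (kk + k) * E d by rewrite mulr_ge0.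
  by apply: ler_pM => //; [exact: mulr_ge0|apply: ler_pM].
have -> : 2 ^+ n * (2 * (kk + k) * d ^+ 3 * E d) * E (2 ^+ n * d) =
  (2 ^+ n * d) * (2 * (kk + k) * E d) * E (2 ^+ n * d) * d ^+ 2 by ring.
move=> /(ler_wpM2r d2) H1; rewrite [leRHS]mulrDl; apply: lerD => //.
by rewrite mulrAC.
Qed.
End Propagator.

(** * Linear differential systems *)

(** The smallest radius and the sum of the absolute values of the bounds work for all
indices. *)
Lemma finite_uniform_bounds (R : realType) (I : finType) (P : I -> R -> R -> Prop) :
  (forall i (s m s' m' : R), P i s m -> s' <= s -> m <= m' -> P i s' m') ->
  (forall i, exists s m : R, 0 < s /\ P i s m) ->
  exists s m : R, [/\ 0 < s, 0 <= m & forall i, P i s m].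
Proof.
move=> mono H.
have [s Hs] := choice H; have [m Hm] := choice Hs.
have [s0 s00 ss] := finite_lower_bound (fun i => proj1 (Hm i)).
exists s0, (\sum_i `|m i|); split => //; first exact: sumr_ge0.
move=> i; have [_ Hi] := Hm i; apply: mono Hi (ss i) _.
by apply: le_trans (ler_norm _) _; rewrite (bigD1 i) //= lerDl sumr_ge0.
Qed.

Section Local.
Variables (R : realType) (K : numFieldType) (iota : {rmorphism K -> R[i]}).
Variable gr : ground iota.
Notation C := R[i].
Notation pt := 'rV[K]_5.
Notation nc := (@Normc.normc R).
Notation nv := (@nv R K iota).
Notation rl := (gr_real gr).
Notation cD := (cD gr).
Notation cdiff := (cdiff gr).
Notation csmooth := (csmooth gr).
Implicit Types (F G : pt -> C) (x h : pt).

Definition nball x (s : R) : set pt := [set y | nv (y - x) < s].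
Lemma nball_open x s : open (nball x s).
Proof.
rewrite openE => y; rewrite /nball /= => ys.
have e0 : 0 < s - nv (y - x) by rewrite subr_gt0.
apply: filterS (nv_ball gr y e0) => z /= zy.
by have := nv_dist iota z y x; lra.
Qed.
Lemma nball_center x (s : R) : 0 < s -> nball x s x.
Proof. by rewrite /nball /= subrr nv0. Qed.
Lemma nball_sub (U : set pt) x : open U -> U x -> exists2 s : R, 0 < s & nball x s `<=` U.
Proof.
move=> oU Ux; have [s s0 H] := near_nv gr (open_near oU Ux (fun y Uy => Uy)).
by exists s.
Qed.
Lemma nball_le x (s t : R) : s <= t -> nball x s `<=` nball x t.
Proof. by move=> st y; rewrite /nball /= => /lt_le_trans; exact. Qed.
Lemma nball_seg x (s t : R) p q : 0 <= t <= 1 -> nball x s p -> nball x s q ->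
  nball x s (rl t *: (q - p) + p).
Proof.
rewrite /nball /= => /andP[t0 t1] ps qs.
have -> : rl t *: (q - p) + p - x = rl t *: (q - x) + rl (1 - t) *: (p - x).
  by rewrite rlB rl1; apply/rowP => i; rewrite !mxE; ring.
apply: le_lt_trans (nvD _ _ _) _; rewrite !nvZr !ger0_norm ?subr_ge0 //.
have := nv_ge0 iota (p - x); have := nv_ge0 iota (q - x).
by case: (ltgtP t 0) t0 => // [tp|->] _; nra.
Qed.
Lemma nball_mid x (s : R) p q : nball x s p -> nball x s q -> nball x s (mid p q).
Proof.
rewrite /nball /= => ps qs.
have -> : mid p q - x = 2^-1 *: ((p - x) + (q - x)).
  by apply/rowP => i; rewrite !mxE; field.
by rewrite nv_half; have := nvD iota (p - x) (q - x); lra.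
Qed.

Lemma cdiff_bounded F x : cdiff F x ->
  exists s m : R, 0 < s /\ forall y, nball x s y -> nc (F y) <= m.
Proof.
move=> /has_D_cD/(_ 1 ltr01)[d d0 H].
exists (Num.min d 1), (nc (F x) + (\sum_i nc (cD i F x) + 1)); rewrite lt_min d0 ltr01; split => //.
move=> y; rewrite /nball /= lt_min => /andP[yd y1].
have := H _ yd; rewrite subrK; set S := \sum_i _ => h.
have -> : F y = F x + ((F y - F x - S) + S) by ring.
apply: le_trans (ncD _ _) _; rewrite lerD2l; apply: le_trans (ncD _ _) _.
rewrite addrC; apply: lerD; last by apply: le_trans h _; rewrite mul1r ltW.
apply: le_trans (nc_sum _ _ _) _; apply: ler_sum => i _; rewrite ncM ler_piMl ?nc_ge0 //.
apply: le_trans (ltW y1); rewrite /nv (bigD1 i) //= lerDl.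
by apply: sumr_ge0 => j _; exact: nc_ge0.
Qed.

Lemma lin_bound (c : 'I_5 -> C) h (m : R) : (forall i, nc (c i) <= m) ->
  nc (\sum_i iota (h 0 i) * c i) <= m * nv h.
Proof.
move=> H; apply: le_trans (nc_sum _ _ _) _; rewrite /nv mulr_sumr; apply: ler_sum => i _.
by rewrite ncM mulrC ler_wpM2r ?nc_ge0.
Qed.

Lemma lipschitz F (U : set pt) x s (m : R) p q : csmooth U F -> nball x s `<=` U ->
  (forall i y, nball x s y -> nc (cD i F y) <= m) -> nball x s p -> nball x s q ->
  nc (F q - F p) <= m * nv (q - p).
Proof.
move=> sF sU H ps qs.
have := @mean_value R K iota gr F (fun=> 0) m p (q - p) (fun t i => cD i F (rl t *: (q - p) + p)).
have z : \sum_i iota ((q - p) 0 i) * (0 : C) = 0 by apply: big1 => i _; rewrite mulr0.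
rewrite subrK z subr0; apply.
  by move=> t t01; apply: has_D_cD; apply: csmooth_diff sF _; apply: sU; exact: nball_seg.
by move=> t t01; apply: lin_bound => i; rewrite subr0; apply: H; exact: nball_seg.
Qed.

(** Quadratic remainders uniform in the base point: the form of smoothness that the
product integral needs. *)
Definition taylor_bounds F x (s m : R) := forall p, nball x s p ->
  [/\ nc (F p) <= m, forall i, nc (cD i F p) <= m &
      forall q, nball x s q ->
        nc (F q - F p - \sum_i iota ((q - p) 0 i) * cD i F p) <= m * nv (q - p) ^+ 2].

Lemma taylor_mono F x (s m s' m' : R) : taylor_bounds F x s m -> s' <= s -> m <= m' ->
  taylor_bounds F x s' m'.
Proof.
move=> H ss mm p ps; have [h1 h2 h3] := H p (nball_le ss ps); split.
- exact: le_trans h1 mm.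
- by move=> i; exact: le_trans (h2 i) mm.
move=> q qs; apply: le_trans (h3 q (nball_le ss qs)) _.
by rewrite ler_wpM2r // exprn_ge0 // nv_ge0.
Qed.

Lemma taylor_exists F (U : set pt) x : open U -> U x -> csmooth U F ->
  exists s m : R, 0 < s /\ taylor_bounds F x s m.
Proof.
move=> oU Ux sF; have [s0 s00 sU] := nball_sub oU Ux.
have [s1 [m1 [s10 H1]]] := cdiff_bounded (csmooth_diff sF Ux).
have [|i|s2 [m2 [s20 m20 H2]]] := @finite_uniform_bounds R 'I_5 (fun i s m => forall y, nball x s y -> nc (cD i F y) <= m).
- by move=> ? s m s' m' H ss mm y /(nball_le ss)/H/le_trans; exact.
- by have [s [m []]] := cdiff_bounded (csmooth_diff (csmooth_cD i oU sF) Ux); exists s, m.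
have [|i|s3 [m3 [s30 m30 H3]]] := @finite_uniform_bounds R ('I_5 * 'I_5)%type
   (fun i s m => forall y, nball x s y -> nc (cD i.1 (cD i.2 F) y) <= m).
- by move=> ? s m s' m' H ss mm y /(nball_le ss)/H/le_trans; exact.
- have [s [m []]] := cdiff_bounded (csmooth_diff (csmooth_cD i.1 oU (csmooth_cD i.2 oU sF)) Ux).
  by exists s, m.
pose s := Num.min (Num.min s0 s1) (Num.min s2 s3).
have [l0 l1 l2 l3] : [/\ s <= s0, s <= s1, s <= s2 & s <= s3].
  by rewrite /s; split; rewrite !ge_min lexx ?orbT.
exists s, (m1 + m2 + m3); split; first by rewrite !lt_min s00 s10 s20 s30.
have m10 : 0 <= m1 := le_trans (nc_ge0 _) (H1 x (nball_center _ s10)).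
move=> p ps; split.
- by have := H1 p (nball_le l1 ps); lra.
- by move=> i; have := H2 i p (nball_le l2 ps); lra.
move=> q qs; set l := nv (q - p); have l_0 : 0 <= l := nv_ge0 iota _.
have Us y : nball x s y -> U y by move=> /(nball_le l0)/sU.
have := @mean_value R K iota gr F (fun i => cD i F p) (m3 * l) p (q - p) (fun t i => cD i F (rl t *: (q - p) + p)).
rewrite subrK -/l => H.
apply: (@le_trans _ _ (m3 * l * l)); last first.
  by rewrite -mulrA -expr2 ler_wpM2r ?exprn_ge0 //; lra.
apply: H => t t01; have zs := nball_seg t01 ps qs.
  by apply: has_D_cD; apply: csmooth_diff sF _; exact: Us.
apply: lin_bound => i.
apply: le_trans (@lipschitz (cD i F) U x s m3 p (rl t *: (q - p) + p) _ _ _ ps zs) _ => //.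
- exact: csmooth_cD.
- by move=> j y ys; apply: (H3 (j, i)); exact: nball_le ys.
by rewrite addrK nvZr ler_wpM2l // ger0_norm; case/andP: t01 => t0 t1 //; rewrite ler_piMl.
Qed.

Lemma of_class_sum (U : set pt) m (I : Type) (r : seq I) (P : pred I) (F : I -> pt -> K) : open U ->
  (forall i, P i -> of_class_C m U (F i)) -> of_class_C m U (fun y => \sum_(i <- r | P i) F i y).
Proof.
move=> oU HF; elim: r => [|i r IH].
  by apply: (of_class_ext oU _ (of_class_cst oU m 0)) => x _; rewrite big_nil.
case Pi: (P i); last by apply: (of_class_ext oU _ IH) => x _; rewrite big_cons Pi.
by apply: (of_class_ext oU _ (of_classD oU (HF i Pi) IH)) => x _; rewrite big_cons Pi.
Qed.

(** Bootstrap: the system expresses the derivatives of u through u, so class C^m gives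
class C^(m+1). *)
Lemma linear_smooth (I : finType) (U : set pt) (A : 'I_5 -> I -> I -> pt -> C) (u : I -> pt -> C) :
  open U -> (forall i a b, csmooth U (A i a b)) ->
  (forall a x, U x -> cdiff (u a) x) ->
  (forall i a x, U x -> cD i (u a) x = \sum_b A i a b x * u b x) ->
  forall a, csmooth U (u a).
Proof.
move=> oU sA du Du a k m; elim: m a k => [|m IH] a k.
  by move=> x Ux; apply: differentiable_continuous; exact: du.
split=> [x Ux|i]; first exact: du.
apply: (@of_class_ext K m U (fun x => \sum_b \sum_p \sum_q gr_co gr k (gr_bas gr p * gr_bas gr q) *
    (gr_co gr p (A i a b x) * gr_co gr q (u b x)))) => //.
  move=> x Ux; rewrite -co_cD Du // co_sum; apply: eq_bigr => b _.
  by rewrite (coM k (A i a b) (u b)).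
do 3 (apply: of_class_sum => // ? _).
apply: of_classM => //; first exact: of_class_cst.
by apply: of_classM => //; exact: sA.
Qed.

(** A solution vanishing at x is halved by each application of the mean value inequality
on a ball whose radius is small against the coefficients. *)
Lemma linear_unique (I : finType) (U : set pt) (A : 'I_5 -> I -> I -> pt -> C) (u : I -> pt -> C) x :
  open U -> U x -> (forall i a b, csmooth U (A i a b)) -> (forall a, csmooth U (u a)) ->
  (forall i a x, U x -> cD i (u a) x = \sum_b A i a b x * u b x) ->
  (forall a, u a x = 0) -> exists2 s : R, 0 < s & forall a y, nball x s y -> u a y = 0.
Proof.
move=> oU Ux sA su Du u0; have [s0 s00 sU] := nball_sub oU Ux.
have [|i|s1 [m1 [s10 m10 H1]]] := @finite_uniform_bounds R ('I_5 * (I * I))%type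
   (fun i s m => forall y, nball x s y -> nc (A i.1 i.2.1 i.2.2 y) <= m).
- by move=> ? s m s' m' H ss mm y /(nball_le ss)/H/le_trans; exact.
- by have [s [m []]] := cdiff_bounded (csmooth_diff (sA i.1 i.2.1 i.2.2) Ux); exists s, m.
have [|i|s2 [m2 [s20 m20 H2]]] := @finite_uniform_bounds R I (fun a s m => forall y, nball x s y -> nc (u a y) <= m).
- by move=> ? s m s' m' H ss mm y /(nball_le ss)/H/le_trans; exact.
- by have [s [m []]] := cdiff_bounded (csmooth_diff (su i) Ux); exists s, m.
(* N bounds the operator norm of the coefficients; on a ball of radius 1 / (2 N) the estimate halves *)
pose N : R := #|I|%:R * m1 + 1.
have N0 : 0 < N by rewrite ltr_wpDl // mulr_ge0.
pose s := Num.min (Num.min s0 s1) (Num.min s2 (N^-1 / 2)).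
have [l0 l1 l2 l3] : [/\ s <= s0, s <= s1, s <= s2 & s <= N^-1 / 2].
  by rewrite /s; split; rewrite !ge_min lexx ?orbT.
have s_0 : 0 < s by rewrite !lt_min s00 s10 s20 divr_gt0 // invr_gt0.
exists s => //.
have key n : forall a y, nball x s y -> nc (u a y) <= m2 / 2 ^+ n.
  elim: n => [|n IH] a y ys; first by rewrite expr0 divr1; apply: H2; exact: nball_le ys.
  have m2n : 0 <= m2 / 2 ^+ n by rewrite divr_ge0 // exprn_ge0.
  have -> : u a y = u a y - u a x by rewrite u0 subr0.
  apply: le_trans (@lipschitz (u a) U x s (N * (m2 / 2 ^+ n)) x y _ _ _ _ ys) _ => //.
  - by move=> z /(nball_le l0)/sU.
  - move=> i z zs; rewrite Du; last by apply: sU; exact: nball_le zs.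
    apply: le_trans (nc_sum _ _ _) _; apply: (@le_trans _ _ (\sum_(b : I) m1 * (m2 / 2 ^+ n))).
      apply: ler_sum => b _; rewrite ncM ler_pM ?nc_ge0 //; last exact: IH.
      by apply: (H1 (i, (a, b))); exact: nball_le zs.
    rewrite -mulr_suml sumr_const -[m1 *+ _]mulr_natl; apply: ler_wpM2r => //.
    by rewrite /N lerDl.
  - exact: nball_center.
  have : nv (y - x) * N <= 2^-1.
    by rewrite -ler_pdivlMr // mulrC; apply: le_trans l3; exact: ltW.
  move=> /(ler_wpM2r m2n) h.
  have -> : m2 / 2 ^+ n.+1 = 2^-1 * (m2 / 2 ^+ n).
    by rewrite exprS invfM mulrCA.
  by rewrite mulrC [nv _ * (N * _)]mulrA.
move=> a y ys; apply/nc_eq0/le_anti; rewrite nc_ge0 andbT.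
by apply: (@le_pow2 _ _ m2) => n; exact: key.
Qed.

Section Frobenius.
Variables (r : nat) (A : 'I_5 -> pt -> 'M[C]_r) (U : set pt) (x0 : pt).
Hypothesis oU : open U.
Hypothesis Ux0 : U x0.
Hypothesis sA : forall i a b, csmooth U (fun y => A i y a b).
Hypothesis flatA : forall y, U y -> forall i j a b,
  cD i (fun z => A j z a b) y - cD j (fun z => A i z a b) y
  + (A i y *m A j y - A j y *m A i y) a b = 0.

Let Af (y h : pt) : 'M[C]_r := \sum_i iota (h 0 i) *: A i y.
Let dA i j y : 'M[C]_r := \matrix_(a, b) cD i (fun z => A j z a b) y.
Let Df (y u h : pt) : 'M[C]_r := \sum_i \sum_j (iota (u 0 i) * iota (h 0 j)) *: dA i j y.

Let flatf (z u v : pt) : U z -> Df z u v - Df z v u + Af z u *m Af z v - Af z v *m Af z u = 0.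
Proof.
move=> Uz.
have -> : Df z v u = \sum_i \sum_j (iota (u 0 i) * iota (v 0 j)) *: dA j i z.
  by rewrite /Df exchange_big; do 2 (apply: eq_bigr => ? _); rewrite mulrC.
have Auv (u' v' : pt) : Af z u' *m Af z v' = \sum_i \sum_j (iota (u' 0 i) * iota (v' 0 j)) *: (A i z *m A j z).
  rewrite /Af mulmx_suml; apply: eq_bigr => i _; rewrite mulmx_sumr; apply: eq_bigr => j _.
  by rewrite -scalemxAl -scalemxAr scalerA.
have -> : Af z v *m Af z u = \sum_i \sum_j (iota (u 0 i) * iota (v 0 j)) *: (A j z *m A i z).
  by rewrite Auv exchange_big; do 2 (apply: eq_bigr => ? _); rewrite mulrC.
rewrite Auv -sumrB -big_split -sumrB big1 // => i _ /=.
rewrite -sumrB -big_split -sumrB big1 // => j _ /=.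
rewrite -scalerBr -scalerDr -scalerBr (_ : _ - _ = 0) ?scaler0 //.
apply/matrixP => a b; rewrite [RHS]mxE -(flatA Uz i j a b) !mx_linE !mxE /=; ring.
Qed.

(** The fundamental matrix is the product integral from x0; its expansion identifies its
derivatives, and the linear system makes it smooth. *)
Theorem frobenius : exists (V : set pt) (Phi : pt -> 'M[C]_r),
  [/\ open V /\ V `<=` U, V x0, Phi x0 = 1%:M, forall a b, csmooth V (fun y => Phi y a b)
    & forall y, V y -> forall i a b, cD i (fun z => Phi z a b) y = - (A i y *m Phi y) a b].
Proof.
have [s0 s00 sU] := nball_sub oU Ux0.
have [||s1 [m1 [s10 m10 H1]]] := @finite_uniform_bounds R ('I_5 * ('I_r * 'I_r))%type
   (fun i s m => taylor_bounds (fun y => A i.1 y i.2.1 i.2.2) x0 s m).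
- by move=> i s m s' m' H ss mm; exact: taylor_mono H ss mm.
- by move=> i; exact: taylor_exists oU Ux0 (sA _ _ _).
(* radius 1 / 4 keeps all distances below 1, so that cubic errors are dominated by quadratic ones *)
pose s := Num.min (Num.min s0 s1) (1 / 4).
have [l0 l1 l2] : [/\ s <= s0, s <= s1 & s <= 1 / 4].
  by rewrite /s; split; rewrite !ge_min lexx ?orbT.
have s_0 : 0 < s by rewrite !lt_min s00 s10 divr_gt0.
pose V := nball x0 s; pose c : R := 1 + (r * r)%:R * m1.
have c1 : 1 <= c by rewrite /c lerDl mulr_ge0.
have cb (X : 'M[C]_r) (b : R) : 0 <= b -> (forall i j, nc (X i j) <= m1 * b) -> nm X <= c * b.
  move=> b0 H; apply: le_trans (nm_bound H) _; rewrite mulrA ler_wpM2r // /c; lra.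
have VU y : V y -> U y by move=> /(nball_le l0)/sU.
have AfE y h a b : Af y h a b = \sum_i iota (h 0 i) * A i y a b.
  by rewrite /Af summxE; apply: eq_bigr => i _; rewrite mxE.
have DfE y u h a b : Df y u h a b = \sum_j iota (h 0 j) * \sum_i iota (u 0 i) * cD i (fun z => A j z a b) y.
  rewrite /Df exchange_big summxE; apply: eq_bigr => j _; rewrite summxE mulr_sumr; apply: eq_bigr => i _.
  by rewrite !mxE; ring.
have [|||||||||||Phi [P0 [M HM]]] := @propagator R K iota r V Af Df c _ _ _ _ _ _ c1 _ _ _ _ x0.
- by move=> p q; exact: nball_mid.
- move=> p q Vp Vq; have := nv_dist iota q x0 p; rewrite [nv (x0 - p)]nvBC.
  by move: Vp Vq; rewrite /V /nball /=; lra.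
- move=> y u v; rewrite /Af -big_split; apply: eq_bigr => i _ /=.
  by rewrite mxE rmorphD scalerDl.
- move=> y u v w; rewrite /Df -big_split; apply: eq_bigr => i _ /=.
  by rewrite -big_split; apply: eq_bigr => j _ /=; rewrite mxE rmorphD mulrDl scalerDl.
- move=> y u v w; rewrite /Df -big_split; apply: eq_bigr => i _ /=.
  by rewrite -big_split; apply: eq_bigr => j _ /=; rewrite mxE rmorphD mulrDr scalerDl.
- move=> y u v; rewrite /Df scaler_sumr; apply: eq_bigr => i _.
  rewrite scaler_sumr; apply: eq_bigr => j _.
  by rewrite mxE rmorphM fmorphV rmorph_nat scalerA mulrA.
- move=> y h Vy; apply: cb; first exact: nv_ge0.
  move=> a b; rewrite AfE; apply: lin_bound => i.
  by have [] := H1 (i, (a, b)) y (nball_le l1 Vy).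
- move=> z u h Vz; rewrite -mulrA; apply: cb; first by rewrite mulr_ge0 ?nv_ge0.
  move=> a b; rewrite DfE mulrA; apply: lin_bound => j; apply: lin_bound => i.
  by have [_ + _] := H1 (j, (a, b)) z (nball_le l1 Vz); apply.
- move=> y z h Vy Vz; rewrite -mulrA; apply: cb; first by rewrite mulr_ge0 ?exprn_ge0 ?nv_ge0.
  move=> a b; rewrite !mx_linE !AfE DfE -!sumrB mulrA.
  rewrite (_ : \sum_i _ = \sum_i iota (h 0 i) * (A i y a b - A i z a b -
    \sum_j iota ((y - z) 0 j) * cD j (fun w => A i w a b) z)).
    apply: lin_bound => i.
    by have [_ _] := H1 (i, (a, b)) z (nball_le l1 Vz); apply; exact: nball_le Vy.
  by apply: eq_bigr => i _; ring.
- by move=> z u v Vz; apply: flatf; exact: VU.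
- exact: nball_center.
have hD y a b : V y -> has_D iota (fun z => Phi z a b) y (fun i => - (A i y *m Phi y) a b).
  move=> Vy e e0; have [s2 s20 s2V] := nball_sub (@nball_open x0 s) Vy.
  have M0 : 0 < `|M| + 1 by rewrite ltr_wpDl.
  exists (Num.min s2 (e / (`|M| + 1))); first by rewrite lt_min s20 divr_gt0.
  move=> h; rewrite lt_min => /andP[hs he].
  have Vh : V (h + y) by apply: s2V; rewrite /nball /= addrK.
  have := HM _ _ Vy Vh; rewrite addrK => /(le_trans (nm_entry _ a b)).
  rewrite !mx_linE; rewrite (_ : (Af y h *m Phi y) a b = \sum_i iota (h 0 i) * (A i y *m Phi y) a b); last first.
    rewrite /Af mulmx_suml summxE; apply: eq_bigr => i _.
    by rewrite -scalemxAl mxE.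
  rewrite (eq_bigr _ (fun i _ => mulrN _ _)) sumrN opprK => /le_trans; apply.
  have h0 := nv_ge0 iota h; rewrite expr2 mulrA; apply: ler_wpM2r => //.
  apply: le_trans (_ : (`|M| + 1) * nv h <= _); last by rewrite mulrC -ler_pdivlMr // ltW.
  by apply: ler_wpM2r => //; have := ler_norm M; lra.
have cPhi y a b : V y -> cdiff (fun z => Phi z a b) y.
  by move=> Vy; have [] := cD_of_has_D gr (hD y a b Vy).
have DPhi y a b i : V y -> cD i (fun z => Phi z a b) y = - (A i y *m Phi y) a b.
  by move=> Vy; have [_ ->] := cD_of_has_D gr (hD y a b Vy).
exists V, Phi; split=> //; first by split; [exact: nball_open|exact: VU].
- exact: nball_center.
- move=> a b; apply: (@linear_smooth 'I_r V (fun i a c y => - A i y a c) (fun a y => Phi y a b)).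
  + exact: nball_open.
  + by move=> i a' b'; apply: csmoothN; [exact: nball_open|exact: csmooth_sub (sA _ _ _)].
  + by move=> a' y; exact: cPhi.
  + move=> i a' y Vy; rewrite DPhi // mxE -sumrN.
    by apply: eq_bigr => j _; rewrite mulNr.
by move=> y Vy i a b; exact: DPhi.
Qed.
End Frobenius.
End Local.

(** * The tractor connection *)

Section Pairing.
Variable R : realType.
Notation C := R[i].
Notation vec := 'cV[C]_7.
(** The split symmetric form preserved by G2 in its seven-dimensional representation. *)
Definition hf (v w : vec) : C := \sum_a v a 0 * w (rev_ord a) 0.
Lemma hfC v w : hf v w = hf w v.
Proof.
rewrite /hf (reindex_inj rev_ord_inj) /=; apply: eq_bigr => a _.
by rewrite rev_ordK mulrC.
Qed.
Lemma hfDl u v w : hf (u + v) w = hf u w + hf v w.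
Proof. by rewrite /hf -big_split; apply: eq_bigr => a _ /=; rewrite mxE mulrDl. Qed.
Lemma hfZl c v w : hf (c *: v) w = c * hf v w.
Proof. by rewrite /hf mulr_sumr; apply: eq_bigr => a _; rewrite mxE mulrA. Qed.
Lemma hfNl v w : hf (- v) w = - hf v w.
Proof. by rewrite -scaleN1r hfZl mulN1r. Qed.
Lemma hf0l w : hf 0 w = 0.
Proof. by rewrite -(scale0r 0) hfZl mul0r. Qed.
Lemma hfBl u v w : hf (u - v) w = hf u w - hf v w.
Proof. by rewrite hfDl hfNl. Qed.
Lemma hf_suml (I : Type) (r : seq I) (P : pred I) (v : I -> vec) w :
  hf (\sum_(i <- r | P i) v i) w = \sum_(i <- r | P i) hf (v i) w.
Proof. by elim/big_rec2: _ => [|i y z _ <-]; rewrite ?hf0l ?hfDl. Qed.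
Lemma hfDr u v w : hf w (u + v) = hf w u + hf w v.
Proof. by rewrite hfC hfDl !(hfC w). Qed.
Lemma hfZr c v w : hf w (c *: v) = c * hf w v.
Proof. by rewrite hfC hfZl (hfC w). Qed.
Lemma hfNr v w : hf w (- v) = - hf w v.
Proof. by rewrite hfC hfNl (hfC w). Qed.
Lemma hf0r w : hf w 0 = 0.
Proof. by rewrite hfC hf0l. Qed.
Lemma hfBr u v w : hf w (u - v) = hf w u - hf w v.
Proof. by rewrite hfDr hfNr. Qed.
Lemma hf_sumr (I : Type) (r : seq I) (P : pred I) (v : I -> vec) w :
  hf w (\sum_(i <- r | P i) v i) = \sum_(i <- r | P i) hf w (v i).
Proof. by rewrite hfC hf_suml; apply: eq_bigr => i _; rewrite hfC. Qed.
End Pairing.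

Local Opaque cD.
Section Covariant.
Variables (R : realType) (K : numFieldType) (iota : {rmorphism K -> R[i]}).
Variable gr : ground iota.
Notation C := R[i].
Notation pt := 'rV[K]_5.
Notation vec := 'cV[C]_7.
Notation cD := (cD gr).
Notation cdiff := (cdiff gr).
Notation csmooth := (csmooth gr).
Variable Th : 'I_5 -> pt -> 'M[C]_7.

Definition vsmooth (W : set pt) (v : pt -> vec) := forall a, csmooth W (fun y => v y a 0).
Definition nabla i (v : pt -> vec) (y : pt) : vec := \col_a cD i (fun z => v z a 0) y + Th i y *m v y.
Definition curvf i j y : 'M[C]_7 := \matrix_(a, b) (cD i (fun z => Th j z a b) y - cD j (fun z => Th i z a b) y)
   + (Th i y *m Th j y - Th j y *m Th i y).

Section OnW.
Variable W : set pt.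
Hypothesis oW : open W.
Hypothesis sTh : forall i a b, csmooth W (fun y => Th i y a b).

Lemma vsmoothD v w : vsmooth W v -> vsmooth W w -> vsmooth W (fun y => v y + w y).
Proof.
move=> sv sw a; apply: csmooth_ext oW _ (csmoothD oW (sv a) (sw a)) => y _.
by rewrite mxE.
Qed.
Lemma vsmoothZ f v : csmooth W f -> vsmooth W v -> vsmooth W (fun y => f y *: v y).
Proof.
move=> sf sv a; apply: csmooth_ext oW _ (csmoothM oW sf (sv a)) => y _.
by rewrite mxE.
Qed.
Lemma vsmooth_sum (I : Type) (r : seq I) (P : pred I) (v : I -> pt -> vec) :
  (forall i, P i -> vsmooth W (v i)) -> vsmooth W (fun y => \sum_(i <- r | P i) v i y).
Proof.
move=> sv a; apply: (@csmooth_ext _ _ _ gr W (fun y => \sum_(i <- r | P i) v i y a 0)) => //.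
  by move=> y _; rewrite summxE.
by apply: csmooth_sum => // i Pi; exact: sv.
Qed.
Lemma vsmooth_nabla i v : vsmooth W v -> vsmooth W (nabla i v).
Proof.
move=> sv a.
apply: (@csmooth_ext _ _ _ gr W (fun y => cD i (fun z => v z a 0) y + \sum_b Th i y a b * v y b 0)) => //.
  by move=> y _; rewrite !mxE.
apply: csmoothD => //; first exact: csmooth_cD.
by apply: csmooth_sum => // b _; apply: csmoothM.
Qed.
Lemma vsmooth_hf v w : vsmooth W v -> vsmooth W w -> csmooth W (fun y => hf (v y) (w y)).
Proof. by move=> sv sw; apply: csmooth_sum => // a _; apply: csmoothM => //. Qed.

Lemma nabla_ext i v w y : W y -> (forall z, W z -> v z = w z) -> nabla i v y = nabla i w y.
Proof.
move=> Wy vw; rewrite /nabla (vw y Wy); congr (_ + _); apply/colP => a; rewrite [LHS]mxE [RHS]mxE.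
by apply: (cD_ext _ _ oW Wy) => z /vw ->.
Qed.
Lemma nablaZ i f v y : W y -> csmooth W f -> vsmooth W v ->
  nabla i (fun z => f z *: v z) y = cD i f y *: v y + f y *: nabla i v y.
Proof.
move=> Wy sf sv; apply/colP => a; rewrite /nabla -scalemxAr !mx_linE !mxE.
rewrite (_ : (fun z => (f z *: v z) a 0) = (fun z => f z * v z a 0)); last first.
  by apply: funext => z; rewrite mxE.
rewrite cDM; [|exact: csmooth_diff sf Wy|exact: csmooth_diff (sv a) Wy].
move: (\sum_j _) => S; ring.
Qed.
Lemma nablaD i v w y : W y -> vsmooth W v -> vsmooth W w ->
  nabla i (fun z => v z + w z) y = nabla i v y + nabla i w y.
Proof.
move=> Wy sv sw; apply/colP => a; rewrite /nabla mulmxDr !mx_linE.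
rewrite ![(\col_b _) a 0]mxE.
rewrite (_ : (fun z => (v z + w z) a 0) = (fun z => v z a 0 + w z a 0)); last first.
  by apply: funext => z; rewrite mxE.
rewrite cDD; [|exact: csmooth_diff (sv a) Wy|exact: csmooth_diff (sw a) Wy].
ring.
Qed.

Hypothesis skew : forall y i v w, W y -> hf (Th i y *m v) w = - hf v (Th i y *m w).

Lemma cD_hf i v w y : W y -> vsmooth W v -> vsmooth W w ->
  cD i (fun z => hf (v z) (w z)) y = hf (nabla i v y) (w y) + hf (v y) (nabla i w y).
Proof.
move=> Wy sv sw; have dv a := csmooth_diff (sv a) Wy; have dw a := csmooth_diff (sw a) Wy.
rewrite /nabla hfDl hfDr skew // addrACA addNr addr0 /hf cD_sum; last by move=> a _; apply: cdiffM.
rewrite -big_split; apply: eq_bigr => a _ /=; rewrite cDM //.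
by rewrite !mxE.
Qed.

Lemma commutator_sum (l1 l2 p q1 q2 w1 w2 s t u v c1 c2 : C) :
  l1 = c1 + (s + t) + w1 + q1 -> l2 = c2 + (u + v) + w2 + q2 -> c1 = c2 -> w1 = v -> w2 = t ->
  p = s - u -> l1 - l2 = p + (q1 - q2).
Proof. by move=> -> -> -> -> -> ->; ring. Qed.

(** The symbols of order two cancel by the symmetry of second derivatives. *)
Lemma ricci_identity i j v y : W y -> vsmooth W v ->
  nabla i (nabla j v) y - nabla j (nabla i v) y = curvf i j y *m v y.
Proof.
move=> Wy sv; have dv a := csmooth_diff (sv a) Wy.
have dT k a b := csmooth_diff (sTh k a b) Wy.
have E k l a : (nabla k (nabla l v) y) a 0 = cD k (cD l (fun z => v z a 0)) y +
   (\sum_b cD k (fun z => Th l z a b) y * v y b 0 + \sum_b Th l y a b * cD k (fun z => v z b 0) y) +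
   (Th k y *m \col_b cD l (fun z => v z b 0) y) a 0 + (Th k y *m Th l y *m v y) a 0.
  rewrite /nabla -mulmxA mulmxDr !mx_addE addrA; congr (_ + _ + _); rewrite mxE.
  rewrite (_ : (fun z => _) = (fun z => cD l (fun z => v z a 0) z + \sum_b Th l z a b * v z b 0)); last first.
    by apply: funext => z; rewrite !mxE.
  rewrite cDD; last 2 first.
  - exact: csmooth_diff (csmooth_cD l oW (sv a)) Wy.
  - by apply: cdiff_sum => b _; apply: cdiffM.
  congr (_ + _).
  rewrite cD_sum; last by move=> b _; apply: cdiffM.
  by rewrite -big_split; apply: eq_bigr => b _ /=; rewrite cDM.
pose P : 'M[C]_7 := \matrix_(a, b) (cD i (fun z => Th j z a b) y - cD j (fun z => Th i z a b) y).
have -> : curvf i j y *m v y = P *m v y + (Th i y *m Th j y *m v y - Th j y *m Th i y *m v y).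
  by rewrite -mulmxBl -mulmxDl.
apply/colP => a.
have col k l : (Th k y *m \col_b cD l (fun z => v z b 0) y) a 0 = \sum_b Th k y a b * cD l (fun z => v z b 0) y.
  by rewrite [LHS]mxE; apply: eq_bigr => b _; rewrite [X in _ * X]mxE.
have EP : (P *m v y) a 0 =
  \sum_b cD i (fun z => Th j z a b) y * v y b 0 - \sum_b cD j (fun z => Th i z a b) y * v y b 0.
  by rewrite [LHS]mxE -sumrB; apply: eq_bigr => b _; rewrite [X in X * _]mxE mulrBl.
have e1 := E i j a; have e2 := E j i a.
have sch := schwarz i j oW Wy (sv a).
transitivity ((nabla i (nabla j v) y) a 0 - (nabla j (nabla i v) y) a 0); first by rewrite [LHS]mxE [X in _ + X]mxE.
transitivity ((P *m v y) a 0 + ((Th i y *m Th j y *m v y) a 0 - (Th j y *m Th i y *m v y) a 0)); last first.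
  by rewrite [RHS]mxE [X in _ = _ + X]mxE [X in _ = _ + (_ + X)]mxE.
exact: (commutator_sum e1 e2 sch (col i j) (col j i) EP).
Qed.
End OnW.
End Covariant.

(** * Parallel tractors and the almost-Einstein equation *)

Section SmoothInverse.
Variable K : numFieldType.
Notation pt := 'rV[K]_5.
Variable U : set pt.
Hypothesis oU : open U.
Lemma smooth_det n (g : pt -> 'M[K]_n) : (forall i j, smooth U (fun x => g x i j)) ->
  smooth U (fun x => \det (g x)).
Proof.
move=> sg; apply: smooth_sum => // s _; apply: smoothM => //; first exact: smooth_cst.
by apply: smooth_prod => // i _; exact: sg.
Qed.
(** Cramer's rule writes the inverse through determinants. *)
Lemma smooth_invmx n (g : pt -> 'M[K]_n) : (forall i j, smooth U (fun x => g x i j)) ->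
  (forall x, U x -> g x \in unitmx) -> forall i j, smooth U (fun x => invmx (g x) i j).
Proof.
case: n g => [|n] g sg ug i j; first by case: i.
apply: (@smooth_ext K U (fun x => (\det (g x))^-1 *
   ((-1) ^+ (j + i) * \det (row' j (col' i (g x)))))) => //.
  by move=> x Ux; rewrite /invmx ug // !mxE.
apply: smoothM => //.
  apply: smoothV => //; last exact: smooth_det.
  by move=> x /ug; rewrite unitmxE unitfE.
apply: smoothM => //; first exact: smooth_cst.
apply: smooth_det => a b; apply: smooth_ext oU _ (sg (lift j a) (lift i b)) => x _.
by rewrite !mxE.
Qed.
End SmoothInverse.

Section Contraction.
Variable F : fieldType.
Variables (gi G : 'I_5 -> 'I_5 -> F).
Hypothesis giG : forall i j, \sum_k gi i k * G k j = (i == j)%:R.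
Hypothesis Gsym : forall i j, G i j = G j i.
Hypothesis gisym : forall i j, gi i j = gi j i.
Lemma sum_delta (f : 'I_5 -> F) i : \sum_k (i == k)%:R * f k = f i.
Proof.
rewrite (bigD1 i) //= eqxx mul1r big1 ?addr0 // => k; rewrite eq_sym => /negbTE->.
by rewrite mul0r.
Qed.
Lemma contract (f : 'I_5 -> 'I_5 -> F) :
  \sum_k \sum_p gi k p * (\sum_r G r p * f k r) = \sum_k f k k.
Proof.
apply: eq_bigr => k _; under eq_bigr do rewrite mulr_sumr.
rewrite exchange_big /= -[RHS](sum_delta (f k) k); apply: eq_bigr => r _.
under eq_bigr do rewrite mulrA.
rewrite -mulr_suml; congr (_ * _); rewrite -(giG k r).
by apply: eq_bigr => p _; rewrite Gsym.
Qed.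
Lemma trace_id : \sum_k \sum_p gi k p * G k p = 5.
Proof.
rewrite (eq_bigr (fun=> 1)); first by rewrite sumr_const card_ord.
move=> k _; have <- : \sum_p gi k p * G p k = 1 by rewrite giG eqxx.
by apply: eq_bigr => p _; rewrite Gsym.
Qed.
(** The purely algebraic part of the computation of the Ricci tensor: contracting the
Gauss equation in dimension 5 yields 3 Q + (tr Q) g. *)
Lemma trace_curvature (P P' Q : 'I_5 -> 'I_5 -> F) i j : Q i j = Q j i ->
  \sum_k \sum_p gi k p * ((\sum_r G r p * P k r) - Q i j * G k p - G i j * Q k p
    - ((\sum_r G r p * P' k r) - Q i k * G j p - G i k * Q j p)) =
  \sum_k P k k - \sum_k P' k k - 3 * Q i j - (\sum_k \sum_p gi k p * Q k p) * G i j.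
Proof.
move=> Qij.
have E1 : \sum_k \sum_p gi k p * (Q i j * G k p) = 5 * Q i j.
  rewrite -trace_id mulr_suml; apply: eq_bigr => k _; rewrite mulr_suml; apply: eq_bigr => p _.
  by rewrite mulrCA mulrC.
have E2 : \sum_k \sum_p gi k p * (G i j * Q k p) = (\sum_k \sum_p gi k p * Q k p) * G i j.
  rewrite mulr_suml; apply: eq_bigr => k _; rewrite mulr_suml; apply: eq_bigr => p _.
  by rewrite mulrCA mulrC.
have E3 : \sum_k \sum_p gi k p * (Q i k * G j p) = Q i j.
  rewrite -(sum_delta (Q i) j); apply: eq_bigr => k _; rewrite eq_sym -(giG k j) mulr_suml.
  by apply: eq_bigr => p _; rewrite Gsym; ring.
have E4 : \sum_k \sum_p gi k p * (G i k * Q j p) = Q i j.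
  rewrite exchange_big /= Qij -(sum_delta (Q j) i); apply: eq_bigr => p _.
  rewrite eq_sym -(giG p i) mulr_suml; apply: eq_bigr => k _.
  by rewrite gisym (Gsym i k) mulrA.
transitivity (\sum_k P k k - 5 * Q i j - (\sum_k \sum_p gi k p * Q k p) * G i j
   - (\sum_k P' k k - Q i j - Q i j)); last by move: (\sum_k \sum_p _) => t; ring.
rewrite -[X in _ - 5 * _ - _ - (_ - X - _)]E3 -[X in _ - 5 * _ - _ - (_ - _ - X)]E4 -E1 -E2.
rewrite -(contract P) -(contract P') -!sumrB; apply: eq_bigr => k _.
by rewrite -!sumrB; apply: eq_bigr => p _; ring.
Qed.
End Contraction.

Section Tractor.
Variables (R : realType) (K : numFieldType) (iota : {rmorphism K -> R[i]}).
Variable gr : ground iota.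
Notation C := R[i].
Notation pt := 'rV[K]_5.
Notation vec := 'cV[C]_7.
Notation cD := (cD gr).
Notation cdiff := (cdiff gr).
Notation csmooth := (csmooth gr).
Variables (Th : 'I_5 -> pt -> 'M[C]_7) (U : set pt) (X Y : pt -> vec) (g : pt -> 'M[K]_5).
Notation nabla := (nabla gr Th).
Notation curvf := (curvf gr Th).
Notation vsmooth := (vsmooth gr).
Notation m i := (nabla i X).
Hypothesis oU : open U.
Hypothesis sTh : forall i a b, csmooth U (fun y => Th i y a b).
Hypothesis skew : forall y i v w, U y -> hf (Th i y *m v) w = - hf v (Th i y *m w).
Hypothesis FX : forall i j y, U y -> curvf i j y *m X y = 0.
Hypothesis sX : vsmooth U X.
Hypothesis sY : vsmooth U Y.
Hypothesis sg : forall i j, smooth U (fun x => g x i j).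
Hypothesis gsym : forall x i j, U x -> g x i j = g x j i.
Hypothesis ug : forall x, U x -> g x \in unitmx.
Hypothesis hXX : forall x, U x -> hf (X x) (X x) = 0.
Hypothesis hXY : forall x, U x -> hf (X x) (Y x) = 1.
Hypothesis hYY : forall x, U x -> hf (Y x) (Y x) = 0.
Hypothesis hmY : forall x i, U x -> hf (m i x) (Y x) = 0.
Hypothesis hmm : forall x i j, U x -> hf (m i x) (m j x) = iota (g x i j).
Hypothesis nondeg : forall x v, U x -> hf (X x) v = 0 -> (forall i, hf (m i x) v = 0) ->
  hf (Y x) v = 0 -> v = 0.
Notation G i j x := (iota (g x i j)).
Notation gi i j x := (iota (invmx (g x) i j)).
Hypothesis normal : forall x i v, U x ->
  \sum_k \sum_l gi k l x * hf (curvf k i x *m v) (m l x) = 0.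
Notation Gam k i j x := (iota (christoffel g k i j x)).
(** The X-component of the second derivatives of X, which normality identifies with the
Schouten tensor. *)
Definition tractor_schouten i j x : C := - hf (nabla i (m j) x) (Y x).
Notation Q := tractor_schouten.
Let L i j k x : C := hf (nabla i (m j) x) (m k x).

Let smi i : vsmooth U (m i).
Proof. exact: vsmooth_nabla. Qed.
Let sDm i j : vsmooth U (nabla i (m j)).
Proof. by apply: vsmooth_nabla => //; exact: smi. Qed.

Lemma cD_zero i (f : pt -> C) x a : U x -> (forall y, U y -> f y = a) -> cD i f x = 0.
Proof. by move=> Ux H; rewrite (cD_ext gr i oU Ux H) cD_cst. Qed.

Lemma hf_X_frame x i : U x -> hf (X x) (m i x) = 0.
Proof.
move=> Ux; have := cD_hf skew i Ux sX sX.
rewrite (cD_zero i Ux hXX) [hf (nabla i X x) _]hfC => /esym/eqP.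
by rewrite -mulr2n mulrn_eq0 => /eqP.
Qed.

(** The curvature annihilates X, so its second derivatives commute: the induced
connection is torsion free. *)
Lemma second_derivative_sym x i j : U x -> nabla i (m j) x = nabla j (m i) x.
Proof.
move=> Ux; apply/eqP; rewrite -subr_eq0 (ricci_identity oU sTh i j Ux sX) FX //.
Qed.

Lemma hf_X_second_derivative x i j : U x -> hf (X x) (nabla i (m j) x) = - G i j x.
Proof.
move=> Ux; have := cD_hf skew i Ux sX (smi j).
rewrite (cD_zero i Ux (fun y Uy => hf_X_frame j Uy)) hmm // => /esym/eqP.
by rewrite addrC addr_eq0 => /eqP.
Qed.

Lemma cD_metric x i j k : U x -> cD i (fun y => G j k y) x = L i j k x + L i k j x.
Proof.
move=> Ux; rewrite -(cD_ext gr i oU Ux (F := fun y => hf (m j y) (m k y))); last by move=> y Uy; exact: hmm.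
by rewrite (cD_hf skew i Ux (smi j) (smi k)) /L [hf (m j x) _]hfC.
Qed.

Lemma partial_metric x i j k : U x -> iota (partial i (fun y => g y j k) x) = L i j k x + L i k j x.
Proof.
by move=> Ux; rewrite -cD_metric // cD_iota //; exact: smooth_diff (sg j k) Ux.
Qed.

Lemma first_kind_sym x i j k : U x -> L i j k x = L j i k x.
Proof. by move=> Ux; rewrite /L second_derivative_sym. Qed.

(** The metric is the Gram matrix of the m_i and second derivatives of X are symmetric,
so Koszul's formula applies verbatim. *)
Lemma koszul x i j k : U x -> Gam k i j x = \sum_l gi k l x * L i j l x.
Proof.
move=> Ux; rewrite /christoffel rmorphM rmorph_sum mulr_sumr; apply: eq_bigr => l _.
rewrite rmorphM rmorphB rmorphD !partial_metric // (first_kind_sym j i l Ux) (first_kind_sym l i j Ux) (first_kind_sym l j i Ux).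
move: (L i j l x) (L i l j x) (L j l i x) (iota (invmx _ _ _)) => a b c d.
by rewrite fmorphV rmorph_nat; field.
Qed.

Lemma inverse_metricl x i j : U x -> \sum_k gi i k x * G k j x = (i == j)%:R.
Proof.
move=> Ux; under eq_bigr do rewrite -rmorphM.
rewrite -rmorph_sum; have := mulVmx (ug Ux) => /matrixP/(_ i j).
by rewrite !mxE => ->; rewrite rmorph_nat.
Qed.
Lemma inverse_metric_sym x i j : U x -> gi i j x = gi j i x.
Proof.
move=> Ux; congr (iota _); have gT : (g x)^T = g x by apply/matrixP => a b; rewrite mxE gsym.
by rewrite -[in LHS]gT -trmx_inv mxE.
Qed.
Lemma inverse_metricr x i j : U x -> \sum_k G i k x * gi k j x = (i == j)%:R.
Proof.
move=> Ux; under eq_bigr do rewrite -rmorphM.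
rewrite -rmorph_sum; have := mulmxV (ug Ux) => /matrixP/(_ i j).
by rewrite !mxE => ->; rewrite rmorph_nat.
Qed.
Lemma first_kind_metric x i j p : U x -> L i j p x = \sum_q G q p x * Gam q i j x.
Proof.
move=> Ux; rewrite -(sum_delta (fun l => L i j l x) p).
under [RHS]eq_bigr do rewrite (koszul _ _ _ Ux) mulr_sumr.
rewrite exchange_big; apply: eq_bigr => l _ /=.
under eq_bigr do rewrite mulrA.
by rewrite -mulr_suml -(inverse_metricr p l Ux); congr (_ * _); apply: eq_bigr => q _; rewrite (gsym _ _ Ux).
Qed.

Lemma hf_inj x v w : U x -> hf (X x) v = hf (X x) w -> (forall i, hf (m i x) v = hf (m i x) w) ->
  hf (Y x) v = hf (Y x) w -> v = w.
Proof.
move=> Ux h1 h2 h3; apply/eqP; rewrite -subr_eq0; apply/eqP; apply: (nondeg Ux).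
- by rewrite hfBr h1 subrr.
- by move=> i; rewrite hfBr h2 subrr.
- by rewrite hfBr h3 subrr.
Qed.

(** Each component is read off by pairing with the frame X, m_p, Y. *)
Lemma gauss x i j : U x -> nabla i (m j) x =
  \sum_k Gam k i j x *: m k x - Q i j x *: X x - G i j x *: Y x.
Proof.
move=> Ux; apply: (hf_inj Ux).
- rewrite hf_X_second_derivative // !hfBr hf_sumr big1; last by move=> k _; rewrite hfZr hf_X_frame // mulr0.
  by rewrite !hfZr hXX // hXY // mulr0 mulr1 subrr sub0r.
- move=> p; rewrite !hfBr hf_sumr !hfZr hmY // [hf (m p x) (X x)]hfC hf_X_frame // !mulr0 !subr0.
  rewrite hfC -/(L i j p x) first_kind_metric //; apply: eq_bigr => q _.
  by rewrite hfZr hmm // (gsym _ _ Ux) mulrC.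
rewrite !hfBr hf_sumr big1; last by move=> k _; rewrite hfZr hfC hmY // mulr0.
by rewrite !hfZr hYY // [hf (Y x) (X x)]hfC hXY // mulr0 mulr1 subr0 sub0r /Q hfC opprK.
Qed.

Lemma tractor_schouten_sym x i j : U x -> Q i j x = Q j i x.
Proof. by move=> Ux; rewrite /Q second_derivative_sym. Qed.

Lemma smooth_christoffel k i j : smooth U (christoffel g k i j).
Proof.
rewrite /christoffel; apply: smoothZ => //; apply: smooth_sum => // l _.
apply: smoothM => //; first exact: smooth_invmx.
by apply: smoothD => //; [apply: smoothD => //|apply: smoothN => //]; exact: smooth_partial.
Qed.

Lemma third_aux (a b c d e f : C) : a + b + c = d + (b + e + f) -> d = a + c - e - f.
Proof. by move=> H; rewrite -[LHS](addrK (b + e + f)) -H; ring. Qed.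

(** Differentiating the pairing of second derivatives with the frame produces the
tangential part of the Riemann tensor. *)
Lemma third_order x k i j p : U x -> hf (nabla k (nabla i (m j)) x) (m p x) =
  \sum_r G r p x * (iota (partial k (christoffel g r i j) x) +
     \sum_q Gam r k q x * Gam q i j x) - Q i j x * G k p x - G i j x * Q k p x.
Proof.
move=> Ux; have := cD_hf skew k Ux (sDm i j) (smi p).
rewrite (cD_ext gr k oU Ux (G := fun y => \sum_q G q p y * Gam q i j y)); last first.
  by move=> y Uy; rewrite -first_kind_metric.
have sG q : csmooth U (fun y => G q p y) by apply: csmooth_iota => //.
have sC q : csmooth U (fun y => Gam q i j y) by apply: csmooth_iota => //; exact: smooth_christoffel.
rewrite cD_sum; last first.
  by move=> q _; apply: cdiffM; [exact: csmooth_diff (sG q) Ux|exact: csmooth_diff (sC q) Ux].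
have E q : cD k (fun y => G q p y * Gam q i j y) x = L k q p x * Gam q i j x + L k p q x * Gam q i j x
   + G q p x * iota (partial k (christoffel g q i j) x).
  rewrite cDM; [|exact: csmooth_diff (sG q) Ux|exact: csmooth_diff (sC q) Ux].
  by rewrite cD_metric // mulrDl cD_iota //; exact: smooth_diff (smooth_christoffel q i j) Ux.
rewrite (eq_bigr _ (fun q _ => E q)) !big_split /=.
have -> : hf (nabla i (m j) x) (nabla k (m p) x) = \sum_q L k p q x * Gam q i j x + Q i j x * G k p x + G i j x * Q k p x.
  rewrite {1}(gauss i j Ux) !hfBl hf_suml !hfZl hf_X_second_derivative // [hf (Y x) _]hfC /Q !mulrN opprK.
  congr (_ + _ + _); first by apply: eq_bigr => q _; rewrite hfZl hfC mulrC.
have -> : \sum_r G r p x * (iota (partial k (christoffel g r i j) x) + \sum_q Gam r k q x * Gam q i j x) =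
  \sum_q L k q p x * Gam q i j x + \sum_q G q p x * iota (partial k (christoffel g q i j) x).
  under eq_bigr do rewrite mulrDr; rewrite big_split addrC /=; congr (_ + _).
  under eq_bigr do rewrite mulr_sumr; rewrite exchange_big; apply: eq_bigr => q _ /=.
  by rewrite first_kind_metric // mulr_suml; apply: eq_bigr => r _; rewrite mulrA.
exact: third_aux.
Qed.

Lemma four_term_aux (a b c d : C) : a - b + (c - d) = a + c - (b + d).
Proof. by ring. Qed.

Lemma ricci_aux (a b c d : C) : a - b - 3 * d - c = 0 -> a - b = 3 * d + c.
Proof. by move=> H; apply/eqP; rewrite -subr_eq0 -H; apply/eqP; ring. Qed.

Lemma trace_aux (a b c t : C) : a * (3 * b + t * c) = 3 * (a * b) + t * (a * c).
Proof. by ring. Qed.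

Lemma schouten_aux (a b t : C) : 3^-1 * (3 * a + t * b - 8 * t / 8 * b) = a.
Proof. by field. Qed.

(** The trace of the curvature acting on m_i vanishes; the Gauss equation expresses it
through the Ricci tensor and Q. *)
Lemma ricciE x i j : U x ->
  iota (ricci g x i j) = 3 * Q i j x + (\sum_k \sum_p gi k p x * Q k p x) * G i j x.
Proof.
move=> Ux; pose P k r := iota (partial k (christoffel g r i j) x) + \sum_q Gam r k q x * Gam q i j x.
pose P' k r := iota (partial j (christoffel g r i k) x) + \sum_q Gam r j q x * Gam q i k x.
have RE : iota (ricci g x i j) = \sum_k P k k - \sum_k P' k k.
  rewrite /ricci mxE rmorph_sum -sumrB; apply: eq_bigr => k _.
  rewrite rmorphD rmorphB rmorph_sum /P /P'.
  have -> : \sum_l iota (christoffel g k k l x * christoffel g l i j x - christoffel g k j l x * christoffel g l i k x)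
    = \sum_q Gam k k q x * Gam q i j x - \sum_q Gam k j q x * Gam q i k x.
    by rewrite -sumrB; apply: eq_bigr => l _; rewrite rmorphB !rmorphM.
  exact: four_term_aux.
have Fkj k p : hf (curvf k j x *m m i x) (m p x) =
  (\sum_r G r p x * P k r) - Q i j x * G k p x - G i j x * Q k p x
  - ((\sum_r G r p x * P' k r) - Q i k x * G j p x - G i k x * Q j p x).
  rewrite -(ricci_identity oU sTh k j Ux (smi i)) hfBl.
  rewrite (@nabla_ext _ _ _ gr Th U oU k _ _ x Ux (fun y Uy => second_derivative_sym j i Uy)).
  rewrite (@nabla_ext _ _ _ gr Th U oU j _ _ x Ux (fun y Uy => second_derivative_sym k i Uy)).
  exact: (congr2 (fun a b : C => a - b) (third_order k i j p Ux) (third_order j i k p Ux)).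
have N := normal j (m i x) Ux.
have T := @trace_curvature C (fun k p => gi k p x) (fun k p => G k p x)
  (fun a b => inverse_metricl a b Ux) (fun a b => congr1 iota (gsym a b Ux)) (fun a b => inverse_metric_sym a b Ux)
  P P' (fun a b => Q a b x) i j (tractor_schouten_sym i j Ux).
rewrite RE; apply: ricci_aux; rewrite -[LHS]T -[RHS]N.
by apply: eq_bigr => k _; apply: eq_bigr => p _; rewrite Fkj.
Qed.

Lemma schoutenE x i j : U x -> iota (schouten g x i j) = Q i j x.
Proof.
move=> Ux; pose t := \sum_k \sum_p gi k p x * Q k p x.
have trE : iota (metric_trace g x (ricci g x)) = 8 * t.
  rewrite /metric_trace rmorph_sum.
  have -> : 8 * t = \sum_k \sum_p (3 * (gi k p x * Q k p x)) + t * \sum_k \sum_p gi k p x * G k p x.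
    rewrite (eq_bigr (fun k => 3 * \sum_p gi k p x * Q k p x)); last by move=> k _; rewrite mulr_sumr.
    rewrite -mulr_sumr -/t.
    rewrite (@trace_id C (fun k p => gi k p x) (fun k p => G k p x)
      (fun a b => inverse_metricl a b Ux) (fun a b => congr1 iota (gsym a b Ux))).
    by move: (t) => t'; ring.
  rewrite mulr_sumr -big_split; apply: eq_bigr => k _ /=.
  rewrite rmorph_sum mulr_sumr -big_split; apply: eq_bigr => p _ /=.
  by rewrite rmorphM ricciE // -/t; exact: trace_aux.
have E : schouten g x i j = 3^-1 * (ricci g x i j - metric_trace g x (ricci g x) / 8 * g x i j).
  by rewrite /schouten; move: (ricci g x) => r; rewrite !mxE.
rewrite E rmorphM rmorphB !rmorphM trE ricciE // -/t !fmorphV !rmorph_nat.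
exact: schouten_aux.
Qed.

Section Scales.
Variable W : set pt.
Hypothesis oW : open W.
Hypothesis WU : W `<=` U.
Let skewW y i v w : W y -> hf (Th i y *m v) w = - hf v (Th i y *m w).
Proof. by move=> /WU; exact: skew. Qed.
Let sThW i a b : csmooth W (fun y => Th i y a b).
Proof. exact: csmooth_sub WU (sTh i a b). Qed.
Let vsW v : vsmooth U v -> vsmooth W v.
Proof. by move=> sv a; exact: csmooth_sub WU (sv a). Qed.

(** The almost-Einstein equation with an explicit trace part: the Hessian of S plus S
times the Schouten tensor is - rho times the metric. *)
Definition scale_eq (S : pt -> C) (rho : pt -> C) x := forall i j,
  cD i (cD j S) x = \sum_k Gam k i j x * cD k S x - iota (schouten g x i j) * S x - G i j x * rho x.

Lemma dscale s i x : W x -> vsmooth W s -> (forall i x, W x -> nabla i s x = 0) ->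
  cD i (fun y => hf (X y) (s y)) x = hf (m i x) (s x).
Proof. by move=> Wx sS Ds; rewrite (cD_hf skewW i Wx (vsW sX) sS) Ds // hf0r addr0. Qed.

(** Pairing the Gauss formula with s gives the equation, with rho the Y-component of s. *)
Lemma scale_of_parallel s : vsmooth W s -> (forall i x, W x -> nabla i s x = 0) ->
  csmooth W (fun y => hf (X y) (s y)) /\
  forall x, W x -> scale_eq (fun y => hf (X y) (s y)) (fun y => hf (Y y) (s y)) x.
Proof.
move=> sS Ds; split; first by apply: vsmooth_hf => //; exact: vsW.
move=> x Wx i j; have Ux := WU Wx.
rewrite (cD_ext gr i oW Wx (G := fun y => hf (m j y) (s y))); last by move=> y Wy; exact: dscale.
rewrite (cD_hf skewW i Wx (vsW (smi j)) sS) Ds // hf0r addr0 schoutenE //.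
rewrite (gauss i j Ux) !hfBl hf_suml !hfZl; congr (_ - _ - _).
by apply: eq_bigr => k _; rewrite hfZl dscale.
Qed.

Lemma frame_inj x v w : W x -> hf (X x) v = hf (X x) w -> (forall i, hf (m i x) v = hf (m i x) w) ->
  hf (Y x) v = hf (Y x) w -> v = w.
Proof. by move=> /WU; exact: hf_inj. Qed.

Lemma zeta_aux (x u w v : vec) (a b c d : C) : hf x v = 0 ->
  hf (a *: x + b *: u - (c *: x + d *: w)) v = b * hf u v - d * hf w v.
Proof. by move=> H; rewrite hfBl !hfDl !hfZl H !mulr0 !add0r. Qed.

Lemma div5_aux (a b c r : C) : a = b - c - 5 * r -> r = 5^-1 * (b - c - a).
Proof. by move=> ->; field. Qed.

(** The pairings of s with X, m_i and Y are forced to be S, its derivatives and rho. The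
equation says that nabla_i s is a multiple of X with factor z_i; the trace of the
curvature on s then gives four times z_i equal to 0. *)
Lemma parallel_of_scale S rho : csmooth W S -> (forall x, W x -> scale_eq S rho x) ->
  exists s, [/\ vsmooth W s, forall i x, W x -> nabla i s x = 0 & forall x, W x -> hf (X x) (s x) = S x].
Proof.
move=> sS HS.
have sC k i j : csmooth W (fun y => Gam k i j y).
  by apply: csmooth_sub WU _; apply: csmooth_iota => //; exact: smooth_christoffel.
have sgi i j : csmooth W (fun y => gi i j y).
  by apply: csmooth_sub WU _; apply: csmooth_iota => //; exact: smooth_invmx.
have sQ i j : csmooth W (Q i j).
  apply: csmoothN => //; apply: vsmooth_hf => //; first exact: vsW (sDm i j).
  exact: vsW.
(* rho is smooth because the trace of the equation solves for it *)
pose rh y := 5^-1 * (\sum_i \sum_j gi i j y * (\sum_k Gam k i j y * cD k S y)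
   - \sum_i \sum_j gi i j y * (Q i j y * S y) - \sum_i \sum_j gi i j y * cD i (cD j S) y).
have rhE y : W y -> rho y = rh y.
  move=> Wy; have Uy := WU Wy; apply: div5_aux.
  rewrite -(@trace_id C (fun k p => gi k p y) (fun k p => G k p y)
      (fun a b => inverse_metricl a b Uy) (fun a b => congr1 iota (gsym a b Uy))) mulr_suml -!sumrB.
  apply: eq_bigr => i _; rewrite mulr_suml -!sumrB; apply: eq_bigr => j _.
  by rewrite HS // schoutenE // !mulrBr !mulrA.
have srh : csmooth W rh.
  apply: csmoothM => //; first exact: csmooth_cst.
  apply: csmoothB => //; first apply: csmoothB => //.
  - do 2 (apply: csmooth_sum => // ? _); apply: csmoothM => //; apply: csmooth_sum => // k _.
    by apply: csmoothM => //; exact: csmooth_cD.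
  - by do 2 (apply: csmooth_sum => // ? _); apply: csmoothM => //; exact: csmoothM.
  - by do 2 (apply: csmooth_sum => // ? _); apply: csmoothM => //; do 2 (apply: csmooth_cD => //).
pose s y := S y *: Y y + \sum_k \sum_l (gi k l y * cD k S y) *: m l y + rh y *: X y.
have ss : vsmooth W s.
  apply: vsmoothD => //; first apply: vsmoothD => //.
  - by apply: vsmoothZ => //; exact: vsW.
  - do 2 (apply: vsmooth_sum => // ? _); apply: vsmoothZ => //; last exact: vsW (smi _).
    by apply: csmoothM => //; exact: csmooth_cD.
  - by apply: vsmoothZ => //; exact: vsW.
have hX y : W y -> hf (X y) (s y) = S y.
  move=> Wy; have Uy := WU Wy; rewrite /s !hfDr !hfZr hXY // hXX // hf_sumr big1.
    by rewrite mulr1 mulr0 !addr0.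
  by move=> k _; rewrite hf_sumr big1 // => l _; rewrite hfZr hf_X_frame // mulr0.
have hm i y : W y -> hf (m i y) (s y) = cD i S y.
  move=> Wy; have Uy := WU Wy; rewrite /s !hfDr !hfZr hmY // [hf (m i y) (X y)]hfC hf_X_frame // !mulr0 add0r addr0.
  rewrite hf_sumr -(sum_delta (fun k => cD k S y) i); apply: eq_bigr => k _.
  rewrite hf_sumr eq_sym -(inverse_metricl k i Uy) mulr_suml; apply: eq_bigr => l _.
  by rewrite hfZr hmm // (gsym _ _ Uy) mulrAC.
have hY y : W y -> hf (Y y) (s y) = rho y.
  move=> Wy; have Uy := WU Wy; rewrite /s !hfDr !hfZr hYY // [hf (Y y) (X y)]hfC hXY // mulr0 mulr1 add0r.
  rewrite hf_sumr big1 ?add0r ?rhE // => k _; rewrite hf_sumr big1 // => l _.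
  by rewrite hfZr [hf (Y y) _]hfC hmY // mulr0.
have DsX i y : W y -> hf (X y) (nabla i s y) = 0.
  move=> Wy; have := cD_hf skewW i Wy (vsW sX) ss.
  rewrite (cD_ext gr i oW Wy hX) hm // => H; apply: (addrI (cD i S y)).
  by rewrite addr0 -H.
have Dsm i j y : W y -> hf (m j y) (nabla i s y) = 0.
  move=> Wy; have Uy := WU Wy; have := cD_hf skewW i Wy (vsW (smi j)) ss.
  rewrite (cD_ext gr i oW Wy (hm j)) HS // schoutenE // {1}(gauss i j Uy) !hfBl hf_suml !hfZl hX // hY //.
  have -> : \sum_k hf (Gam k i j y *: m k y) (s y) = \sum_k Gam k i j y * cD k S y.
    by apply: eq_bigr => k _; rewrite hfZl hm.
  by move=> H; apply: (addrI (\sum_k Gam k i j y * cD k S y - Q i j y * S y - G i j y * rho y)); rewrite addr0 -H.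
pose z i y := hf (Y y) (nabla i s y).
have Dsz i y : W y -> nabla i s y = z i y *: X y.
  move=> Wy; have Uy := WU Wy; apply: (frame_inj Wy).
  - by rewrite DsX // hfZr hXX // mulr0.
  - by move=> j; rewrite Dsm // hfZr [hf (m j y) _]hfC hf_X_frame // mulr0.
  - by rewrite hfZr [hf _ (X y)]hfC hXY // mulr1.
have sz i : csmooth W (z i).
  by apply: vsmooth_hf => //; [exact: vsW|exact: vsmooth_nabla].
have z0 i y : W y -> z i y = 0.
  move=> Wy; have Uy := WU Wy; have := normal i (s y) Uy.
  have Fs k l : hf (curvf k i y *m s y) (m l y) = z i y * G k l y - z k y * G i l y.
    rewrite -(ricci_identity oW sThW k i Wy ss).
    rewrite (@nabla_ext _ _ _ gr Th W oW k _ _ y Wy (fun u => Dsz i u)).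
    rewrite (@nabla_ext _ _ _ gr Th W oW i _ _ y Wy (fun u => Dsz k u)).
    rewrite (nablaZ Th k Wy (sz i) (vsW sX)) (nablaZ Th i Wy (sz k) (vsW sX)).
    rewrite -(hmm k l Uy) -(hmm i l Uy); exact: (zeta_aux _ _ _ _ _ _ (hf_X_frame l Uy)).
  rewrite (eq_bigr (fun k => \sum_l (z i y * (gi k l y * G k l y)) - (k == i)%:R * z k y)); last first.
    move=> k _; rewrite -(inverse_metricl k i Uy) mulr_suml -sumrB; apply: eq_bigr => l _.
    by rewrite Fs (gsym i l Uy) mulrBr mulrCA; congr (_ - _); rewrite mulrCA mulrC.
  rewrite sumrB (eq_bigr (fun k => z i y * \sum_l gi k l y * G k l y)); last by move=> k _; rewrite mulr_sumr.
  rewrite -mulr_sumr (@trace_id C (fun k p => gi k p y) (fun k p => G k p y)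
      (fun a b => inverse_metricl a b Uy) (fun a b => congr1 iota (gsym a b Uy))).
  rewrite (eq_bigr (fun k => (i == k)%:R * z k y)); last by move=> k _; rewrite eq_sym.
  rewrite (sum_delta (fun k => z k y)); move: (z i y) => t H.
  (* the trace of z_i g_kl - z_k g_il is (5 - 1) z_i *)
  have H4 : 4 * t = 0 by rewrite -[RHS]H; ring.
  by apply/eqP; move/eqP: H4; rewrite mulf_eq0 pnatr_eq0.
by exists s; split=> // i x Wx; rewrite Dsz // z0 // scale0r.
Qed.
End Scales.
End Tractor.

(** * The Lie algebra of type G2 *)

Section G2Algebra.
Variable R : realType.
Notation C := R[i].
Notation g2mx := (@g2mx R).

Ltac all7 i := case: i => [[|[|[|[|[|[|[|//]]]]]]] ?].

Lemma g2mxD z1 z2 a01 a10 a11 a21 a31 a32 b01 b10 b11 b21 b31 b32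
  z1' z2' a01' a10' a11' a21' a31' a32' b01' b10' b11' b21' b31' b32' :
  g2mx z1 z2 a01 a10 a11 a21 a31 a32 b01 b10 b11 b21 b31 b32 +
  g2mx z1' z2' a01' a10' a11' a21' a31' a32' b01' b10' b11' b21' b31' b32' =
  g2mx (z1 + z1') (z2 + z2') (a01 + a01') (a10 + a10') (a11 + a11') (a21 + a21') (a31 + a31')
    (a32 + a32') (b01 + b01') (b10 + b10') (b11 + b11') (b21 + b21') (b31 + b31') (b32 + b32').
Proof.
apply/matrixP => i j; rewrite !mxE; move: (sqrtC 2) => r.
all7 i; all7 j; rewrite /= ?addr0 //; ring.
Qed.
Lemma g2mxZ c z1 z2 a01 a10 a11 a21 a31 a32 b01 b10 b11 b21 b31 b32 :
  c *: g2mx z1 z2 a01 a10 a11 a21 a31 a32 b01 b10 b11 b21 b31 b32 =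
  g2mx (c * z1) (c * z2) (c * a01) (c * a10) (c * a11) (c * a21) (c * a31)
    (c * a32) (c * b01) (c * b10) (c * b11) (c * b21) (c * b31) (c * b32).
Proof.
apply/matrixP => i j; rewrite !mxE; move: (sqrtC 2) => r.
all7 i; all7 j; rewrite /= ?mulr0 //; ring.
Qed.
Lemma g2mxN z1 z2 a01 a10 a11 a21 a31 a32 b01 b10 b11 b21 b31 b32 :
  - g2mx z1 z2 a01 a10 a11 a21 a31 a32 b01 b10 b11 b21 b31 b32 =
  g2mx (- z1) (- z2) (- a01) (- a10) (- a11) (- a21) (- a31)
    (- a32) (- b01) (- b10) (- b11) (- b21) (- b31) (- b32).
Proof. by rewrite -scaleN1r g2mxZ !mulN1r. Qed.
Lemma g2mx0 : g2mx 0 0 0 0 0 0 0 0 0 0 0 0 0 0 = 0.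
Proof. by rewrite -(scale0r (g2mx 0 0 0 0 0 0 0 0 0 0 0 0 0 0)) g2mxZ !mul0r. Qed.

(** Membership in the matrix realisation with explicit parameters, which is the form
used in computations. *)
Definition isG2 (A : 'M[C]_7) := exists z1 z2 a01 a10 a11 a21 a31 a32 b01 b10 b11 b21 b31 b32,
  A = g2mx z1 z2 a01 a10 a11 a21 a31 a32 b01 b10 b11 b21 b31 b32.

Lemma isG2_D A B : isG2 A -> isG2 B -> isG2 (A + B).
Proof.
move=> [? [? [? [? [? [? [? [? [? [? [? [? [? [? ->]]]]]]]]]]]]]].
move=> [? [? [? [? [? [? [? [? [? [? [? [? [? [? ->]]]]]]]]]]]]]].
by rewrite g2mxD; do 14 eexists.
Qed.
Lemma isG2_Z c A : isG2 A -> isG2 (c *: A).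
Proof.
move=> [? [? [? [? [? [? [? [? [? [? [? [? [? [? ->]]]]]]]]]]]]]].
by rewrite g2mxZ; do 14 eexists.
Qed.
Lemma isG2_0 : isG2 0.
Proof. by rewrite -g2mx0; do 14 eexists. Qed.
Lemma isG2_sum (I : Type) (r : seq I) (P : pred I) (F : I -> 'M[C]_7) :
  (forall i, P i -> isG2 (F i)) -> isG2 (\sum_(i <- r | P i) F i).
Proof. by move=> H; elim/big_rec: _ => [|i A Pi HA]; [exact: isG2_0|apply: isG2_D => //; exact: H]. Qed.

Lemma g2_antisym A a b : isG2 A -> A a b = - A (rev_ord b) (rev_ord a).
Proof.
move=> [? [? [? [? [? [? [? [? [? [? [? [? [? [? ->]]]]]]]]]]]]]].
rewrite !mxE; move: (sqrtC 2) => r.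
all7 a; all7 b; rewrite /= ?opprK ?oppr0 //; ring.
Qed.
Lemma g2_skew A v w : isG2 A -> hf (A *m v) w = - hf v (A *m w).
Proof.
move=> HA; rewrite /hf.
under eq_bigr do rewrite mxE mulr_suml.
rewrite exchange_big -sumrN; apply: eq_bigr => b _ /=.
rewrite mxE mulr_sumr -sumrN (reindex_inj rev_ord_inj); apply: eq_bigr => a _ /=.
by rewrite rev_ordK (g2_antisym (rev_ord a) b HA) rev_ordK; ring.
Qed.

(** The row of the first column that holds the a-th coordinate on g/p, up to the factor
sqrt 2 in the middle one. *)
Definition mi (a : 'I_5) : 'I_7 := inord a.+1.
Lemma rev_mi a : rev_ord (mi a) = mi (rev_ord a).
Proof.
apply: val_inj; rewrite /= /mi !inordK; case: a => [[|[|[|[|[|//]]]]] ?] //.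
Qed.
Lemma sum7 (V : nmodType) (f : 'I_7 -> V) : \sum_a f a = f ord0 + \sum_a f (mi a) + f ord_max.
Proof.
rewrite big_ord_recl big_ord_recr /= addrA; congr (_ + _ + _).
  by apply: eq_bigr => a _; congr f; apply: val_inj; rewrite /= /mi inordK // ltnS ltnW // ltnS; case: a.
by congr f; apply: val_inj.
Qed.
Lemma hf7 (v w : 'cV[C]_7) : hf v w = v ord0 0 * w ord_max 0 +
  \sum_a v (mi a) 0 * w (mi (rev_ord a)) 0 + v ord_max 0 * w ord0 0.
Proof.
rewrite /hf sum7; congr (_ * w _ 0 + _ + _ * w _ 0); try by apply: val_inj.
by apply: eq_bigr => a _; rewrite rev_mi.
Qed.
Lemma g2_corner A : isG2 A -> A ord_max ord0 = 0.
Proof. by move=> [? [? [? [? [? [? [? [? [? [? [? [? [? [? ->]]]]]]]]]]]]]]; rewrite mxE. Qed.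

Lemma inord7 k (kl : (k < 7)%N) : inord k = Ordinal kl :> 'I_7.
Proof. by apply: val_inj; rewrite /= inordK. Qed.

Lemma r2_neq0 : sqrtC (2 : C) != 0.
Proof. by rewrite sqrtC_eq0 pnatr_eq0. Qed.

Lemma dfE z1 z2 a01 a10 a11 a21 a31 a32 b01 b10 b11 b21 b31 b32 :
  let A := g2mx z1 z2 a01 a10 a11 a21 a31 a32 b01 b10 b11 b21 b31 b32 in
  [/\ df10 A = a10, df11 A = a11, df21 A = a21, df31 A = a31 & df32 A = a32].
Proof.
have k1 : (1 < 7)%N by []. have k2 : (2 < 7)%N by []. have k3 : (3 < 7)%N by [].
have k4 : (4 < 7)%N by []. have k5 : (5 < 7)%N by [].
rewrite /df10 /df11 /df21 /df31 /df32 (inord7 k1) (inord7 k2) (inord7 k3) (inord7 k4) (inord7 k5).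
split; rewrite mxE //=.
by rewrite mulrAC divff ?mul1r // r2_neq0.
Qed.

(** The conformal quadratic form on g/p is half the pairing of the first column with
itself, as the middle entry carries the factor sqrt 2. *)
Lemma nurowskiE A : isG2 A -> nurowski_form A = 2^-1 * hf (A *m delta_mx ord0 0) (A *m delta_mx ord0 0).
Proof.
move=> HA; have c0 a : (A *m delta_mx ord0 0) a 0 = A a ord0.
  rewrite mxE (bigD1 ord0) //= mxE !eqxx mulr1 big1 ?addr0 // => b /negbTE b0.
  by rewrite mxE b0 mulr0.
rewrite hf7 !c0 (g2_corner HA) mulr0 mul0r add0r addr0 !big_ord_recl big_ord0 !c0.
rewrite /nurowski_form /df10 /df11 /df21 /df31 /df32 expr_div_n sqrtCK /mi /=.
by rewrite /bump /=; field.
Qed.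

Lemma col0_mi (A : 'M[C]_7) a : (A *m delta_mx ord0 0 : 'cV_7) a 0 = A a ord0.
Proof.
rewrite mxE (bigD1 ord0) //= mxE !eqxx mulr1 big1 ?addr0 // => b /negbTE b0.
by rewrite mxE b0 mulr0.
Qed.

Lemma span_ind (K : fieldType) (V : vectType K) (P : V -> Prop) (s : seq V) :
  P 0 -> (forall x y, P x -> P y -> P (x + y)) -> (forall c x, P x -> P (c *: x)) ->
  (forall i, (i < size s)%N -> P s`_i) -> forall v, v \in << s >>%VS -> P v.
Proof.
move=> P0 PD PZ Ps v vs; rewrite (@coord_span _ _ _ (in_tuple s) v vs).
by elim/big_rec: _ => // i x _ Px; apply: PD => //; apply: PZ; exact: Ps.
Qed.

Lemma g2_span A : isG2 A <-> A \in g2 R.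
Proof.
split.
  move=> [z1 [z2 [a01 [a10 [a11 [a21 [a31 [a32 [b01 [b10 [b11 [b21 [b31 [b32 ->]]]]]]]]]]]]]].
  rewrite (_ : g2mx _ _ _ _ _ _ _ _ _ _ _ _ _ _ = z1 *: Z1 R + z2 *: Z2 R + a01 *: f01 R + a10 *: f10 R
    + a11 *: f11 R + a21 *: f21 R + a31 *: f31 R + a32 *: f32 R + b01 *: e01 R + b10 *: e10 R + b11 *: e11 R
    + b21 *: e21 R + b31 *: e31 R + b32 *: e32 R); last first.
    by rewrite !g2mxZ !g2mxD !(mulr0, mulr1, addr0, add0r).
  by rewrite !rpredD // rpredZ // memv_span // !inE eqxx ?orbT.
apply: span_ind; [exact: isG2_0|exact: isG2_D|exact: isG2_Z|].
by move=> [|[|[|[|[|[|[|[|[|[|[|[|[|[|i]]]]]]]]]]]]]] //= _; do 14 eexists.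
Qed.

(** The parabolic is the stabiliser of the first basis line. *)
Lemma parab_col0 A : A \in g2 R -> (forall a, A (mi a) ord0 = 0) -> A \in parab R.
Proof.
move=> /g2_span[z1 [z2 [a01 [a10 [a11 [a21 [a31 [a32 [b01 [b10 [b11 [b21 [b31 [b32 ->]]]]]]]]]]]]]] H.
have [h1 h2 h3 h4 h5] := dfE z1 z2 a01 a10 a11 a21 a31 a32 b01 b10 b11 b21 b31 b32.
have k1 := H (@Ordinal 5 0 isT). have k2 := H (@Ordinal 5 1 isT). have k3 := H (@Ordinal 5 2 isT).
have k4 := H (@Ordinal 5 3 isT). have k5 := H (@Ordinal 5 4 isT).
rewrite /mi /= in k1 k2 k3 k4 k5.
rewrite /df10 k1 in h1; rewrite /df11 k2 in h2; rewrite /df21 k3 mul0r in h3.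
rewrite /df31 k4 in h4; rewrite /df32 k5 in h5.
rewrite -h1 -h2 -h3 -h4 -h5.
rewrite (_ : g2mx _ _ _ _ _ _ _ _ _ _ _ _ _ _ = z1 *: Z1 R + z2 *: Z2 R + a01 *: f01 R
  + b01 *: e01 R + b10 *: e10 R + b11 *: e11 R
  + b21 *: e21 R + b31 *: e31 R + b32 *: e32 R); last first.
  by rewrite !g2mxZ !g2mxD !(mulr0, mulr1, addr0, add0r).
by rewrite !rpredD // rpredZ // memv_span // !inE eqxx ?orbT.
Qed.
End G2Algebra.

(** * The tractor frame of a chart with values in G2 *)

Lemma vec7E (R : realType) (v : 'cV[R[i]]_7) : v = v ord0 0 *: delta_mx ord0 0 +
  \sum_b v (mi b) 0 *: delta_mx (mi b) 0 + v ord_max 0 *: delta_mx ord_max 0.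
Proof. by rewrite [LHS]matrix_sum_delta sum7 !big_ord1; congr (_ + _ + _); apply: eq_bigr => b _; rewrite big_ord1. Qed.
Section CartanModel.
Variables (R : realType) (K : numFieldType) (iota : {rmorphism K -> R[i]}).
Variable gr : ground iota.
Notation C := R[i].
Notation pt := 'rV[K]_5.
Notation vec := 'cV[C]_7.
Notation cD := (cD gr).
Notation csmooth := (csmooth gr).
Variables (Th : 'I_5 -> pt -> 'M[C]_7) (U : set pt) (g : pt -> 'M[K]_5).
Variables (Om : pt -> K) (lam : C) (kap : 'M[C]_7 -> 'M[C]_7 -> 'M[C]_7).
Notation nabla := (nabla gr Th).
Notation curvf := (curvf gr Th).
Notation vsmooth := (vsmooth gr).
Notation e1 := (delta_mx ord0 0 : vec).
Hypothesis oU : open U.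
Hypothesis sTh : forall i a b, csmooth U (fun y => Th i y a b).
Hypothesis ThG2 : forall i x, U x -> isG2 (Th i x).
Hypothesis FFE : forall i j x, U x -> curvf i j x = kap (Th i x) (Th j x).
Hypothesis kapG2 : forall x y, isG2 (kap x y).
Hypothesis kap_e1 : forall x y, kap x y *m e1 = 0.
Hypothesis kap_lin : forall x y, kap x y = \sum_a x (mi a) ord0 *: kap (delta_mx (mi a) ord0) y.
Hypothesis kap_normal : forall y c, isG2 y -> \sum_a (kap (delta_mx (mi a) ord0) y) (mi a) c = 0.
Hypothesis coframe : forall x (v : 'I_5 -> C), U x ->
  (forall a, \sum_i v i * Th i x (mi a) ord0 = 0) -> forall i, v i = 0.
Hypothesis lam0 : lam != 0.
Hypothesis sOm : smooth U Om.
Hypothesis Om0 : forall x, U x -> Om x != 0.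
Hypothesis gsym : forall x i j, U x -> g x i j = g x j i.
Hypothesis gE : forall x (v : pt), U x -> iota ((v *m g x *m v^T) 0 0) =
  lam * iota (Om x) ^+ 2 * (2^-1 * hf (\sum_i iota (v 0 i) *: (Th i x *m e1)) (\sum_i iota (v 0 i) *: (Th i x *m e1))).

Let c : C := sqrtC (lam / 2).
Let c0 : c != 0.
Proof. by rewrite sqrtC_eq0 mulf_neq0 // invr_eq0 pnatr_eq0. Qed.
Let cc : c ^+ 2 = lam / 2.
Proof. exact: sqrtCK. Qed.
Let t i x : vec := Th i x *m e1.
Let f x : C := c * iota (Om x).
(** The factor is chosen so that hf m_i m_j is the metric and not merely a multiple of
it. *)
Definition X_tractor x : vec := f x *: e1.
Notation X := X_tractor.
Notation m i := (nabla i X).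

Let f0 x : U x -> f x != 0.
Proof. by move=> Ux; rewrite mulf_neq0 // fmorph_eq0 Om0. Qed.
Let sf : csmooth U f.
Proof. by apply: csmoothM => //; [exact: csmooth_cst|exact: csmooth_iota]. Qed.
Let skew y i v w : U y -> hf (Th i y *m v) w = - hf v (Th i y *m w).
Proof. by move=> Uy; apply: g2_skew; exact: ThG2. Qed.

Let se1 : vsmooth U (fun=> e1).
Proof. by move=> a; exact: csmooth_cst. Qed.
Lemma smooth_X : vsmooth U X.
Proof. exact: vsmoothZ. Qed.

Let mE i x : U x -> m i x = cD i f x *: e1 + f x *: t i x.
Proof.
move=> Ux; rewrite (nablaZ Th i Ux sf se1); congr (_ + _ *: _).
rewrite /t -[RHS]add0r; congr (_ + _); apply/colP => a; rewrite mxE [RHS]mxE; exact: cD_cst.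
Qed.

Let e1e1 : hf e1 e1 = 0.
Proof.
rewrite hf7 !mxE /= mulr0 mul0r addr0 add0r big1 // => a _.
by rewrite !mxE /mi -val_eqE /= inordK ?mul0r // ltnS ltnW // ltnS; case: a.
Qed.
Let e1h v : hf e1 v = v ord_max 0.
Proof.
rewrite hf7 !mxE !eqxx /= mul0r addr0 mul1r big1 ?addr0 // => a _.
by rewrite !mxE /mi -val_eqE /= inordK ?mul0r // ltnS ltnW // ltnS; case: a.
Qed.
Let t_last i x : U x -> t i x ord_max 0 = 0.
Proof. by move=> Ux; rewrite col0_mi g2_corner //; exact: ThG2. Qed.
Let e1t i x : U x -> hf e1 (t i x) = 0.
Proof. by move=> Ux; rewrite e1h t_last. Qed.

Lemma hf_XX x : U x -> hf (X x) (X x) = 0.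
Proof. by move=> Ux; rewrite hfZl hfZr e1e1 !mulr0. Qed.

Let hmt_aux (p q u h : C) : p * (q * 0) + p * (u * 0) + (u * (q * 0) + u * (u * h)) = u ^+ 2 * h.
Proof. by ring. Qed.
Let hmt i j x : U x -> hf (m i x) (m j x) = f x ^+ 2 * hf (t i x) (t j x).
Proof.
move=> Ux; rewrite !mE // !hfDl !hfDr !hfZl !hfZr e1e1 e1t // [hf (t i x) e1]hfC e1t //.
Qed.

Lemma delta_quad (A : 'M[K]_5) (i j : 'I_5) : ((delta_mx 0 i : pt) *m A *m (delta_mx 0 j : pt)^T) 0 0 = A i j.
Proof. by rewrite -rowE trmx_delta -colE !mxE. Qed.

Let polar_aux (a b p q h h' u : C) : p = u * h -> q = u * h' ->
  p + a + (a + q) = u * (h + b + (b + h')) -> a = u * b.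
Proof.
move=> -> -> /eqP; rewrite -subr_eq0 => /eqP E; apply/eqP; rewrite -subr_eq0.
have : 2 * (a - u * b) = 0 by rewrite -E; ring.
by move=> /eqP; rewrite mulf_eq0 pnatr_eq0.
Qed.
Let f2_aux (d l o : C) : d ^+ 2 = l / 2 -> l * o ^+ 2 * 2^-1 = (d * o) ^+ 2.
Proof. by move=> H; rewrite exprMn H; ring. Qed.

Lemma hf_frame x i j : U x -> hf (m i x) (m j x) = iota (g x i j).
Proof.
move=> Ux; rewrite hmt //.
have dsum k : \sum_i0 iota ((delta_mx 0 k : pt) 0 i0) *: t i0 x = t k x.
  rewrite (bigD1 k) //= mxE !eqxx rmorph1 scale1r big1 ?addr0 // => l lk.
  by rewrite mxE (negbTE lk) andbF rmorph0 scale0r.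
have f2 := f2_aux (iota (Om x)) cc.
have Gd k : iota (g x k k) = f x ^+ 2 * hf (t k x) (t k x).
  by have := gE (delta_mx 0 k) Ux; rewrite delta_quad -!/(t _ x) dsum mulrA f2.
have := gE (delta_mx 0 i + delta_mx 0 j) Ux.
rewrite mulrA f2.
have -> : \sum_i0 iota ((delta_mx 0 i + delta_mx 0 j : pt) 0 i0) *: (Th i0 x *m e1) = t i x + t j x.
  rewrite -[t i x]dsum -[t j x]dsum -big_split; apply: eq_bigr => k _ /=.
  by rewrite -scalerDl mxE rmorphD.
rewrite linearD /= mulmxDl mulmxDr !mulmxDl.
have E (A B D F : 'M[K]_1) : (A + B + (D + F)) 0 0 = A 0 0 + B 0 0 + (D 0 0 + F 0 0) by rewrite !mxE.
rewrite E !delta_quad (gsym j i Ux) !rmorphD /=.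
rewrite hfDl !hfDr [hf (t j x) (t i x)]hfC.
by move=> H; rewrite (polar_aux (Gd i) (Gd j) H).
Qed.

Let J5 : 'M[C]_5 := \matrix_(a, b) (b == rev_ord a)%:R.
Let P x : 'M[C]_5 := \matrix_(i, a) t i x (mi a) 0.
Let J5J5 : J5 *m J5 = 1%:M.
Proof.
apply/matrixP => a b; rewrite !mxE (bigD1 (rev_ord a)) //= !mxE eqxx mul1r rev_ordK big1 ?addr0 ?(eq_sym b) //.
by move=> k kb; rewrite !mxE (negbTE kb) mul0r.
Qed.
Let J5u : J5 \in unitmx.
Proof. by have [] := mulmx1_unit J5J5. Qed.
Let Pu x : U x -> P x \in unitmx.
Proof.
move=> Ux; rewrite -row_free_unit; apply/row_freeP.
suff : row_free (P x) by move/row_freeP.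
rewrite -kermx_eq0; apply/eqP/row_matrixP => k; rewrite row0.
set v := row k _; have v0 : v *m P x = 0.
  by apply/sub_kermxP; exact: row_sub.
apply/rowP => i; rewrite [RHS]mxE; apply: (coframe (x := x) (v := fun i => v 0 i)) => // a.
have := congr1 (fun A : 'rV[C]_5 => A 0 a) v0; rewrite !mxE => E.
by rewrite -[RHS]E; apply: eq_bigr => l _; rewrite [X in _ = _ * X]mxE /t col0_mi.
Qed.
Let htP i j x : U x -> hf (t i x) (t j x) = (P x *m J5 *m (P x)^T) i j.
Proof.
move=> Ux; rewrite hf7 !t_last // mulr0 mul0r add0r addr0 mxE.
rewrite (reindex_inj rev_ord_inj) /=; apply: eq_bigr => a _.
rewrite [X in _ = X * _]mxE (bigD1 (rev_ord a)) //= big1 ?addr0; last first.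
  move=> k ka; rewrite [J5 _ _]mxE (_ : _ == _ = false) ?mulr0 //.
  by apply/negbTE; apply: contra ka => /eqP ->; rewrite rev_ordK.
by rewrite !mxE rev_ordK eqxx mulr1.
Qed.
Let mapG x : U x -> map_mx iota (g x) = f x ^+ 2 *: (P x *m J5 *m (P x)^T).
Proof. by move=> Ux; apply/matrixP => i j; rewrite mxE [RHS]mxE -htP // -hmt // hf_frame. Qed.

Lemma smooth_metric i j : smooth U (fun x => g x i j).
Proof.
apply: (smooth_iota oU (gr := gr)).
apply: (@csmooth_ext _ _ _ gr U (fun x => f x ^+ 2 * hf (t i x) (t j x))) => //.
  by move=> x Ux; rewrite -hmt // hf_frame.
have st k : vsmooth U (t k).
  by move=> a; apply: csmooth_ext (sTh k a ord0) => // y _; rewrite /t col0_mi.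
apply: csmoothM => //; first by rewrite -[X in csmooth U X]/(fun x => f x * f x); exact: csmoothM.
exact: vsmooth_hf.
Qed.
Lemma metric_unit x : U x -> g x \in unitmx.
Proof.
move=> Ux; rewrite -(map_unitmx iota) mapG //.
by rewrite unitmxZ ?unitfE ?expf_neq0 ?f0 // !unitmx_mul unitmx_tr J5u !Pu.
Qed.
Lemma curvf_X i j y : U y -> curvf i j y *m X y = 0.
Proof. by move=> Uy; rewrite FFE // -scalemxAr kap_e1 scaler0. Qed.

Notation gi i j x := (iota (invmx (g x) i j)).
Let PgP x a b : U x -> \sum_k \sum_l gi k l x * (P x k a * P x l b) = (f x ^+ 2)^-1 * J5 a b.
Proof.
move=> Ux; have Pux := Pu Ux; have f20 : f x ^+ 2 != 0 by rewrite expf_neq0 ?f0.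
have E : (P x)^T *m map_mx iota (invmx (g x)) *m P x = (f x ^+ 2)^-1 *: J5.
  have Ju : J5 *m (P x)^T \in unitmx by rewrite unitmx_mul unitmx_tr J5u Pux.
  have V : map_mx iota (invmx (g x)) *m map_mx iota (g x) = 1%:M by rewrite -map_mxM mulVmx ?metric_unit // map_mx1.
  move: V; rewrite mapG // -scalemxAr => V.
  apply: (can_inj (mulmxK Ju)); rewrite -scalemxAl [J5 *m (J5 *m _)]mulmxA J5J5 mul1mx.
  apply: (scalerI f20); rewrite scalerA mulfV // scale1r.
  have -> : (P x)^T *m map_mx iota (invmx (g x)) *m P x *m (J5 *m (P x)^T) =
    (P x)^T *m (map_mx iota (invmx (g x)) *m (P x *m J5 *m (P x)^T)) by rewrite !mulmxA.
  by rewrite scalemxAr V mulmx1.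
have := congr1 (fun A : 'M[C]_5 => A a b) E; rewrite [RHS]mxE => <-.
rewrite mxE exchange_big; apply: eq_bigr => l _ /=.
rewrite [X in _ = X * _]mxE mulr_suml; apply: eq_bigr => k _.
by rewrite [(P x)^T _ _]mxE [map_mx _ _ _ _]mxE mulrA [P x k a * _]mulrC.
Qed.

Let prod_aux (a b d e h : C) : a * (b * (- d * (e * h))) = a * (b * e) * (- d * h).
Proof. by ring. Qed.
Let normal_aux (B : 'I_5 -> 'M[C]_7) v x : U x -> (forall a, isG2 (B a)) -> (forall a, B a *m e1 = 0) ->
  (forall c, \sum_a (B a) (mi a) c = 0) ->
  \sum_k \sum_l gi k l x * hf ((\sum_a P x k a *: B a) *m v) (m l x) = 0.
Proof.
move=> Ux BG Be1 Bn.
have tE l : t l x = t l x ord0 0 *: e1 + \sum_b P x l b *: delta_mx (mi b) 0.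
  rewrite [LHS]vec7E t_last // scale0r addr0; congr (_ + _); apply: eq_bigr => b _.
  by rewrite [P x l b]mxE.
have hB l a : hf (B a *m v) (m l x) = - f x * \sum_b P x l b * hf v (col (mi b) (B a)).
  rewrite g2_skew // mE // mulmxDr -!scalemxAr Be1 scaler0 add0r tE mulmxDr -scalemxAr Be1 scaler0 add0r.
  rewrite hfZr mulmx_sumr hf_sumr mulNr; congr (- (_ * _)); apply: eq_bigr => b _.
  by rewrite -scalemxAr hfZr -colE.
have hc a b : hf v (col (mi b) (B a)) = - \sum_c v c 0 * B a (mi (rev_ord b)) c.
  rewrite /hf -sumrN; apply: eq_bigr => c0' _; rewrite mxE (g2_antisym _ _ (BG a)) rev_ordK rev_mi.
  by rewrite mulrN.
transitivity (\sum_a \sum_b (\sum_k \sum_l gi k l x * (P x k a * P x l b)) * (- f x * hf v (col (mi b) (B a)))).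
  under eq_bigr => k _.
    under eq_bigr => l _.
      rewrite mulmx_suml hf_suml mulr_sumr.
      under eq_bigr => a _ do rewrite -scalemxAl hfZl hB !mulr_sumr.
      over.
    over.
  rewrite /=; under eq_bigr => k _ do rewrite exchange_big /=.
  rewrite exchange_big /=; apply: eq_bigr => a _.
  under eq_bigr => k _ do rewrite exchange_big /=.
  rewrite exchange_big /=; apply: eq_bigr => b _.
  rewrite mulr_suml; apply: eq_bigr => k _; rewrite mulr_suml; apply: eq_bigr => l _.
  exact: prod_aux.
transitivity (\sum_a (f x ^+ 2)^-1 * (- f x * hf v (col (mi (rev_ord a)) (B a)))).
  apply: eq_bigr => a _; rewrite (bigD1 (rev_ord a)) //= PgP // mxE eqxx mulr1 big1 ?addr0 // => b ba.
  by rewrite PgP // mxE (negbTE ba) mulr0 mul0r.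
rewrite -mulr_sumr -mulr_sumr.
under eq_bigr => a _ do rewrite hc rev_ordK.
rewrite sumrN exchange_big /=; under eq_bigr => a _ do rewrite -mulr_sumr Bn mulr0.
by rewrite big1 // oppr0 !mulr0.
Qed.

(** In the frame of first columns the inverse metric is antidiagonal, so the contraction
with the metric becomes the contraction in kap_normal. *)
Lemma curvf_trace0 x i v : U x -> \sum_k \sum_l gi k l x * hf (curvf k i x *m v) (m l x) = 0.
Proof.
move=> Ux; have ThG := ThG2 i Ux.
rewrite -[RHS](@normal_aux (fun a => kap (delta_mx (mi a) ord0) (Th i x)) v x) //; last first.
  by move=> b; exact: kap_normal.
apply: eq_bigr => k _; apply: eq_bigr => l _; rewrite FFE // kap_lin.
congr (_ * hf (_ *m _) _); apply: eq_bigr => a _; congr (_ *: _).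
by rewrite mxE /t col0_mi.
Qed.

Let Y0 x : vec := (f x)^-1 *: delta_mx ord_max 0.
Let be k x := hf (m k x) (Y0 x).
Let Y1 x : vec := Y0 x - \sum_k \sum_l (gi k l x * be k x) *: m l x.
(** A Gram-Schmidt step makes the lift orthogonal to the m_i, and a multiple of X makes
it null. *)
Definition Y_tractor x : vec := Y1 x - (2^-1 * hf (Y1 x) (Y1 x)) *: X x.
Notation Y := Y_tractor.

Lemma smooth_Y : vsmooth U Y.
Proof.
have vB v w : vsmooth U v -> vsmooth U w -> vsmooth U (fun y => v y - w y).
  move=> sv sw a; apply: csmooth_ext (csmoothB oU (sv a) (sw a)) => // y _.
  by rewrite [RHS]mxE [X in _ = _ + X]mxE.
have sY0 : vsmooth U Y0.
  apply: vsmoothZ => //; last by move=> a; exact: csmooth_cst.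
  have sO : csmooth U (fun y => iota (Om y)^-1) by apply: csmooth_iota => //; exact: smoothV.
  have sc : csmooth U (fun=> c^-1) by exact: csmooth_cst.
  apply: csmooth_ext (csmoothM oU sc sO) => // y Uy.
  by rewrite fmorphV -invfM.
have sm k : vsmooth U (m k) by apply: (vsmooth_nabla oU sTh); exact: smooth_X.
have sY1 : vsmooth U Y1.
  apply: (vB _ _ sY0); apply: (vsmooth_sum oU) => k _; apply: (vsmooth_sum oU) => l _; apply: (vsmoothZ oU _ (sm l)).
  apply: (csmoothM oU); last exact: (vsmooth_hf oU (sm k) sY0).
  by apply: (csmooth_iota oU); apply: (smooth_invmx oU); [exact: smooth_metric|exact: metric_unit].
apply: (vB _ _ sY1); apply: (vsmoothZ oU _ smooth_X).
by apply: (csmoothM oU); [exact: csmooth_cst|exact: (vsmooth_hf oU sY1 sY1)].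
Qed.
Let hXm' x i : U x -> hf (X x) (m i x) = 0.
Proof. by move=> Ux; rewrite mE // hfDr !hfZl !hfZr e1e1 e1t // !mulr0 addr0. Qed.
Let hXY1 x : U x -> hf (X x) (Y1 x) = 1.
Proof.
move=> Ux; rewrite hfBr hf_sumr big1; last first.
  by move=> k _; rewrite hf_sumr big1 // => l _; rewrite hfZr hXm' // mulr0.
by rewrite subr0 hfZl hfZr e1h mxE !eqxx mulr1 mulfV ?f0.
Qed.
Lemma hf_XY x : U x -> hf (X x) (Y x) = 1.
Proof. by move=> Ux; rewrite hfBr hXY1 // hfZr hf_XX // mulr0 subr0. Qed.
Let null_correction (u v : vec) : hf u u = 0 -> hf u v = 1 ->
  hf (v - (2^-1 * hf v v) *: u) (v - (2^-1 * hf v v) *: u) = 0.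
Proof.
move=> uu uv; rewrite hfBl !hfBr !hfZr !hfZl uu uv [hf v u]hfC uv; move: (hf v v) => a; by field.
Qed.
Lemma hf_YY x : U x -> hf (Y x) (Y x) = 0.
Proof. by move=> Ux; exact: null_correction (hf_XX Ux) (hXY1 Ux). Qed.
Lemma hf_frame_Y x i : U x -> hf (m i x) (Y x) = 0.
Proof.
move=> Ux; rewrite hfBr hfZr [hf (m i x) (X x)]hfC hXm' // mulr0 subr0 hfBr hf_sumr.
have -> : \sum_k hf (m i x) (\sum_l (gi k l x * be k x) *: m l x) = \sum_k be k x * (i == k)%:R.
  apply: eq_bigr => k _; rewrite hf_sumr.
  under eq_bigr => l _ do rewrite hfZr hf_frame // mulrAC mulrC.
  rewrite -mulr_sumr; congr (_ * _).
  have := congr1 (fun A : 'M[K]_5 => iota (A k i)) (mulVmx (metric_unit Ux)).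
  rewrite !mxE rmorph_sum rmorph_nat eq_sym => <-; apply: eq_bigr => l _.
  by rewrite rmorphM (gsym i l Ux).
rewrite (bigD1 i) //= eqxx mulr1 big1 ?addr0 ?subrr // => k ki.
by rewrite eq_sym (negbTE ki) mulr0.
Qed.

Lemma frame_nondegenerate x v : U x -> hf (X x) v = 0 -> (forall i, hf (m i x) v = 0) -> hf (Y x) v = 0 -> v = 0.
Proof.
move=> Ux Xv mv Yv.
have fx := f0 Ux.
have vmax : v ord_max 0 = 0.
  by move: Xv; rewrite hfZl e1h => /eqP; rewrite mulf_eq0 (negbTE fx) => /eqP.
have Pv : P x *m (\col_a v (mi (rev_ord a)) 0) = 0.
  apply/colP => i; rewrite [RHS]mxE; apply: (mulfI fx); rewrite mulr0.
  have := mv i; rewrite mE // hfDl !hfZl e1h vmax mulr0 add0r => <-; congr (_ * _).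
  rewrite hf7 t_last // vmax mulr0 mul0r addr0 add0r mxE; apply: eq_bigr => a _.
  by rewrite !mxE.
have vm a : v (mi a) 0 = 0.
  have := congr1 (fun A : 'cV[C]_5 => (invmx (P x) *m A) (rev_ord a) 0) Pv.
  by rewrite mulKmx ?Pu // mulmx0 !mxE rev_ordK.
have vE : v = v ord0 0 *: e1.
  by rewrite [LHS]vec7E vmax scale0r addr0 big1 ?addr0 // => a _; rewrite vm scale0r.
move: Yv; rewrite vE hfC hfZl.
have : hf e1 (Y x) != 0.
  by apply/eqP => E; have := hf_XY Ux; rewrite hfZl E mulr0 => /esym/eqP; rewrite oner_eq0.
by move=> /negbTE E /eqP; rewrite mulf_eq0 E orbF => /eqP ->; rewrite scale0r.
Qed.

Section OnW.
Variable W : set pt.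
Hypothesis oW : open W.
Hypothesis WU : W `<=` U.

Let tensor_aux (p q s p' r G : K) : p - q + s * p' = r * G -> p = q - p' * s + r * G.
Proof. by move=> <-; ring. Qed.
(** A vanishing trace-free part means equality with a multiple of the metric; the factor
is minus the rho of the scale equation. *)
Lemma parallel_of_AE sigma : almost_einstein_scale W g sigma -> exists s,
  [/\ vsmooth W s, forall i x, W x -> nabla i s x = 0 & forall x, W x -> hf (X x) (s x) = iota (sigma x)].
Proof.
move=> [ss HE].
apply: (@parallel_of_scale R K iota gr Th U X Y g oU sTh skew curvf_X smooth_X smooth_Y smooth_metric gsym metric_unit hf_XX hf_XY hf_YY hf_frame_Y hf_frame
  frame_nondegenerate curvf_trace0 W oW WU (fun y => iota (sigma y)) (fun y => - iota (metric_trace g y (hessian g sigma y +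
    sigma y *: schouten g y) / 5))).
  exact: csmooth_iota.
move=> x Wx i j.
have dS k y : W y -> cD k (fun y => iota (sigma y)) y = iota (partial k sigma y).
  by move=> Wy; apply: cD_iota; exact: smooth_diff ss Wy.
rewrite (cD_ext gr i oW Wx (dS j)) cD_iota; last exact: smooth_diff (smooth_partial j ss) Wx.
under eq_bigr => k _ do rewrite dS // -rmorphM.
have := HE x Wx; rewrite /tracefree => /eqP; rewrite subr_eq0 => /eqP.
set r := _ / 5 => E; have := congr1 (fun A : 'M[K]_5 => A i j) E; rewrite !mxE => /tensor_aux ->.
by rewrite rmorphD rmorphB rmorph_sum !rmorphM mulrN opprK [iota (g x i j) * _]mulrC.
Qed.

Let tensor_aux2 (q s p r G : K) : q - p * s - G * r - q + s * p = - r * G.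
Proof. by ring. Qed.
(** The equation has coefficients in K, so each K-coordinate of a C-valued solution
solves it. *)
Lemma AE_of_parallel s k : vsmooth W s -> (forall i x, W x -> nabla i s x = 0) ->
  almost_einstein_scale W g (fun y => gr_co gr k (hf (X y) (s y))).
Proof.
move=> sS Ds.
have [sH HE] := @scale_of_parallel R K iota gr Th U X Y g oU sTh skew curvf_X smooth_X smooth_metric gsym metric_unit hf_XX hf_XY hf_YY hf_frame_Y hf_frame
  frame_nondegenerate curvf_trace0 W oW WU s sS Ds.
split; first exact: sH.
move=> x Wx; have Ux := WU Wx.
set S := fun y => hf (X y) (s y); rewrite -/S in sH HE.
set smooth_metric := fun y => gr_co gr k (S y).
have p1 j : partial j smooth_metric = (fun y => gr_co gr k (cD j S y)).
  by apply: funext => y; rewrite co_cD.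
have T : hessian g smooth_metric x + smooth_metric x *: schouten g x = - gr_co gr k (hf (Y x) (s x)) *: g x.
  apply/matrixP => i j.
  rewrite [LHS]mxE [X in X + _]mxE [(smooth_metric x *: schouten g x) i j]mxE [RHS]mxE p1 -co_cD HE //.
  rewrite !coB co_sum !gr_coZ.
  under eq_bigr => l _ do rewrite gr_coZ co_cD.
  exact: tensor_aux2.
rewrite /tracefree T.
have -> : metric_trace g x (- gr_co gr k (hf (Y x) (s x)) *: g x) = - gr_co gr k (hf (Y x) (s x)) * 5.
  rewrite /metric_trace.
  under eq_bigr => i _ do (under eq_bigr => j _ do rewrite mxE mulrCA (gsym i j Ux)).
  under eq_bigr => i _ do rewrite -mulr_sumr.
  rewrite -mulr_sumr; congr (_ * _).
  transitivity (\tr (1%:M : 'M[K]_5)); last by rewrite mxtrace1.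
  rewrite -(mulVmx (metric_unit Ux)); apply: eq_bigr => i _; by rewrite mxE.
by rewrite mulfK ?subrr // pnatr_eq0.
Qed.

(** Differentiating hf X s = 0 twice shows that s is orthogonal to X, to the m_i and, by
the Gauss formula, to Y: a scale is determined by its 2-jet. *)
Lemma parallel_inj s : vsmooth W s -> (forall i x, W x -> nabla i s x = 0) ->
  (forall x, W x -> hf (X x) (s x) = 0) -> forall x, W x -> s x = 0.
Proof.
move=> sS Ds H0 x Wx; have Ux := WU Wx.
have skewW y i v w : W y -> hf (Th i y *m v) w = - hf v (Th i y *m w) by move=> /WU; exact: skew.
have vW v : vsmooth U v -> vsmooth W v by move=> sv a; exact: csmooth_sub WU (sv a).
have sm i : vsmooth W (m i) by apply: vW; apply: (vsmooth_nabla oU sTh); exact: smooth_X.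
have H1 i y : W y -> hf (m i y) (s y) = 0.
  move=> Wy; have := cD_hf skewW i Wy (vW _ smooth_X) sS.
  by rewrite Ds // hf0r addr0 (cD_ext gr i oW Wy H0) cD_cst.
have H2 i j : hf (nabla i (m j) x) (s x) = 0.
  have := cD_hf skewW i Wx (sm j) sS.
  by rewrite Ds // hf0r addr0 (cD_ext gr i oW Wx (H1 j)) cD_cst.
apply: (frame_nondegenerate Ux (H0 x Wx)) => [i|]; first exact: H1.
apply/eqP/negP => /negP y0.
have g0 : g x = 0.
  apply/matrixP => i j; rewrite [RHS]mxE; apply/eqP; rewrite -(fmorph_eq0 iota).
  have := H2 i j.
  rewrite (@gauss R K iota gr Th U X Y g oU sTh skew curvf_X smooth_X smooth_metric gsym metric_unit hf_XX hf_XY hf_YY hf_frame_Y hf_frame frame_nondegenerate x i j Ux).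
  rewrite !hfBl hf_suml big1; last by move=> k _; rewrite hfZl H1 // mulr0.
  rewrite (hfZl (tractor_schouten gr Th X Y i j x)) (H0 x Wx) mulr0 subr0 sub0r hfZl => /eqP; rewrite oppr_eq0 mulf_eq0 (negbTE y0) orbF.
  by [].
by have := metric_unit Ux; rewrite g0 unitmxE det0 unitr0.
Qed.
End OnW.
End CartanModel.

(** * Germs of scales *)

Section Germs.
Variables (R : realType) (K : numFieldType) (iota : {rmorphism K -> R[i]}).
Variable gr : ground iota.
Notation C := R[i].
Notation pt := 'rV[K]_5.
Notation vec := 'cV[C]_7.
Notation cD := (cD gr).
Notation csmooth := (csmooth gr).
Variables (Th : 'I_5 -> pt -> 'M[C]_7) (U : set pt) (g : pt -> 'M[K]_5) (X : pt -> vec).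
Notation nabla := (nabla gr Th).
Notation curvf := (curvf gr Th).
Notation vsmooth := (vsmooth gr).
Definition parallel (W : set pt) (s : pt -> vec) := vsmooth W s /\ forall i x, W x -> nabla i s x = 0.
Hypothesis oU : open U.
Hypothesis sTh : forall i a b, csmooth U (fun y => Th i y a b).

Lemma parallel_sub W W' s : W' `<=` W -> parallel W s -> parallel W' s.
Proof.
move=> WW [sS Ds]; split; first by move=> a; exact: csmooth_sub WW (sS a).
by move=> i x /WW; exact: Ds.
Qed.
Lemma parallelZ W (a : C) s : open W -> parallel W s -> parallel W (fun y => a *: s y).
Proof.
move=> oW [sS Ds]; have sa : csmooth W (fun=> a) by exact: csmooth_cst.
split; first exact: vsmoothZ.
move=> i x Wx; rewrite (nablaZ Th i Wx sa sS) Ds // scaler0 addr0.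
by rewrite (cD_cst gr) scale0r.
Qed.
Lemma parallelD W s t : open W -> parallel W s -> parallel W t -> parallel W (fun y => s y + t y).
Proof.
move=> oW [sS Ds] [sT Dt]; split; first exact: vsmoothD.
by move=> i x Wx; rewrite (nablaD Th i Wx sS sT) Ds // Dt // addr0.
Qed.
Lemma parallel0 W : open W -> parallel W (fun=> 0).
Proof.
move=> oW; split; first by move=> a; exact: csmooth_cst.
by move=> i x Wx; rewrite /nabla mulmx0 addr0; apply/colP => a; rewrite !mxE cD_cst.
Qed.
Lemma parallel_sum W (I : Type) (r : seq I) (a : I -> C) (s : I -> pt -> vec) : open W ->
  (forall i, parallel W (s i)) -> parallel W (fun y => \sum_(i <- r) a i *: s i y).
Proof.
move=> oW sS; elim: r => [|i r IH].
  rewrite (_ : (fun _ => _) = (fun=> 0)); first exact: parallel0.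
  by apply: funext => y; rewrite big_nil.
rewrite (_ : (fun _ => _) = (fun y => a i *: s i y + \sum_(i <- r) a i *: s i y)).
  by apply: parallelD => //; exact: parallelZ.
by apply: funext => y; rewrite big_cons.
Qed.

(** Parallel sections solve a linear system. *)
Lemma parallel_eq0_near W s x : open W -> W `<=` U -> W x -> parallel W s -> s x = 0 ->
  exists W', [/\ open W', W' x, W' `<=` W & forall y, W' y -> s y = 0].
Proof.
move=> oW WU Wx [sS Ds] s0.
have [||||r r0 H] := @linear_unique R K iota gr 'I_7 W (fun i a b y => - Th i y a b) (fun a y => s y a 0) x oW Wx.
- by move=> i a b; apply: csmoothN => //; exact: csmooth_sub WU (sTh i a b).
- exact: sS.
- move=> i a y Wy; have := congr1 (fun v : vec => v a 0) (Ds i y Wy).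
  rewrite [X in _ = X -> _]mxE [X in X = _ -> _]mxE [X in X + _]mxE => /eqP; rewrite addr_eq0 => /eqP ->.
  by rewrite mxE -sumrN; apply: eq_bigr => b _; rewrite mulNr.
- by move=> a; rewrite s0 mxE.
exists (W `&` nball iota x r); split => //.
- by apply: openI => //; exact: nball_open.
- by split => //; exact: nball_center.
by move=> y [_ Hy]; apply/colP => a; rewrite H // mxE.
Qed.

Hypothesis T1 : forall W sigma, open W -> W `<=` U -> almost_einstein_scale W g sigma ->
  exists s, parallel W s /\ forall x, W x -> hf (X x) (s x) = iota (sigma x).
Hypothesis T2 : forall W s k, open W -> W `<=` U -> parallel W s ->
  almost_einstein_scale W g (fun y => gr_co gr k (hf (X y) (s y))).
Hypothesis T3 : forall W s, open W -> W `<=` U -> parallel W s ->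
  (forall x, W x -> hf (X x) (s x) = 0) -> forall x, W x -> s x = 0.

Lemma no_scales : (forall W s, open W -> W `<=` U -> parallel W s -> forall x, W x -> s x = 0) ->
  only_trivial_scales U g.
Proof.
move=> H W sigma oW WU /(T1 oW WU)[s [ps sE]] x Wx.
by apply/eqP; rewrite -(fmorph_eq0 iota) -sE // (H W s) // hf0r.
Qed.

Section Dim.
Variables (r : nat) (N : 'M[C]_(7, r)) (N' : 'M[C]_(r, 7)).
Hypothesis NN : N' *m N = 1%:M.
Hypothesis ThN : forall i x, U x -> Th i x *m N = N *m (N' *m Th i x *m N).
Hypothesis FN : forall i j x, U x -> curvf i j x *m N = 0.
Hypothesis up : forall W s, open W -> W `<=` U -> parallel W s -> forall x, W x -> s x = N *m (N' *m s x).

Let conj_comm (D1 D2 P1 P2 : 'M[C]_7) : N' *m (D1 - D2 + (P1 - P2)) *m N =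
  N' *m D1 *m N - N' *m D2 *m N + (N' *m P1 *m N - N' *m P2 *m N).
Proof. by rewrite mulmxDr mulmxDl !mulmxBr !mulmxBl. Qed.
(** In the constant subspace spanned by the columns of N the connection is flat with
form N' Theta N, and its fundamental matrix gives the frame. *)
Lemma parallel_frame x0 : U x0 -> exists V (s : 'I_r -> pt -> vec),
  [/\ open V, V x0, V `<=` U, forall a, parallel V (s a) & forall a, N' *m s a x0 = delta_mx a 0].
Proof.
move=> Ux0; pose A i y := N' *m Th i y *m N.
have sA i a b : csmooth U (fun y => A i y a b).
  apply: (@csmooth_ext _ _ _ gr U (fun y => \sum_d (\sum_c N' a c * Th i y c d) * N d b)) => //.
    by move=> y _; rewrite [RHS]mxE; apply: eq_bigr => d _; rewrite mxE.
  apply: csmooth_sum => // d _; apply: csmoothM => //; last exact: csmooth_cst.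
  by apply: csmooth_sum => // c _; apply: csmoothM => //; exact: csmooth_cst.
have flat y : U y -> forall i j a b, cD i (fun z => A j z a b) y - cD j (fun z => A i z a b) y
    + (A i y *m A j y - A j y *m A i y) a b = 0.
  move=> Uy i j a b.
  have dT k l c d := csmooth_diff (sTh k c d) Uy.
  have dA k l : cD k (fun z => A l z a b) y = (N' *m (\matrix_(c, d) cD k (fun z => Th l z c d) y) *m N) a b.
    rewrite (_ : (fun z => _) = (fun z => \sum_d \sum_c (N' a c * N d b) * Th l z c d)); last first.
      apply: funext => z; rewrite [LHS]mxE; apply: eq_bigr => d _; rewrite [X in X * _]mxE mulr_suml.
      by apply: eq_bigr => c _; rewrite mulrAC.
    rewrite cD_sum; last by move=> d _; apply: cdiff_sum => c _; apply: cdiffZ; exact: dT.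
    rewrite [RHS]mxE; apply: eq_bigr => d _; rewrite cD_sum; last by move=> c _; apply: cdiffZ; exact: dT.
    rewrite [X in _ = X * _]mxE mulr_suml; apply: eq_bigr => c _; rewrite cDZ; last exact: dT.
    by rewrite [X in _ = _ * X * _]mxE mulrAC.
  have AA k l : A k y *m A l y = N' *m (Th k y *m Th l y) *m N.
    by rewrite /A -(mulmxA (_ *m Th k y)) -ThN // !mulmxA.
  have := congr1 (fun B : 'M[C]_(7, r) => (N' *m B) a b) (FN i j Uy); rewrite mulmx0 [RHS]mxE => <-.
  pose D k l := \matrix_(c, d) cD k (fun z => Th l z c d) y : 'M[C]_7.
  have -> : curvf i j y = D i j - D j i + (Th i y *m Th j y - Th j y *m Th i y).
    by rewrite /curvf; congr (_ + _); apply/matrixP => c d; rewrite !mxE.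
  have E4 (B1 B2 B3 : 'M[C]_r) : (B1 - B2 + B3) a b = B1 a b - B2 a b + B3 a b.
    by rewrite [LHS]mxE [X in X + _]mxE [X in _ + X + _]mxE.
  by rewrite mulmxA conj_comm E4 !dA !AA.
have [V [Phi [[oV VU] Vx0 Phi0 sPhi DPhi]]] := frobenius oU Ux0 sA flat.
exists V, (fun a y => N *m col a (Phi y)); split => //; last first.
  by move=> a; rewrite mulmxA NN mul1mx Phi0 col1.
move=> a; split.
  move=> d; apply: (@csmooth_ext _ _ _ gr V (fun y => \sum_b N d b * Phi y b a)) => //.
    by move=> y _; rewrite mxE; apply: eq_bigr => b _; rewrite mxE.
  by apply: csmooth_sum => // b _; apply: csmoothM => //; exact: csmooth_cst.
move=> i y Vy; have Uy := VU _ Vy.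
rewrite /nabla mulmxA ThN // -mulmxA.
have -> : (\col_d cD i (fun z => (N *m col a (Phi z)) d 0) y) = N *m (\col_b - (A i y *m Phi y) b a).
  apply/colP => d; rewrite [LHS]mxE.
  rewrite (_ : (fun z => _) = (fun z => \sum_b N d b * Phi z b a)); last first.
    by apply: funext => z; rewrite mxE; apply: eq_bigr => b _; rewrite mxE.
  have dP b := csmooth_diff (sPhi b a) Vy.
  rewrite cD_sum; last by move=> b _; apply: cdiffZ; exact: dP.
  by rewrite [RHS]mxE; apply: eq_bigr => b _; rewrite cDZ; [rewrite DPhi // [in RHS]mxE|exact: dP].
rewrite -mulmxDr (_ : _ + _ = 0) ?mulmx0 //; apply/colP => b.
by rewrite [LHS]mxE [X in X + _]mxE [RHS]mxE colE mulmxA -colE [X in _ + X]mxE addNr.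
Qed.

(** The K-coordinates of the scales of a complex frame lift to parallel tractors z which
span it over C, so r of them form a C-basis. They form a K-basis of the germs of
scales: taking the coordinate along 1 of a C-linear expansion of a K-valued scale
gives a K-linear one, and K-linear relations among the scales lift to the tractors. *)
Theorem scales_dim : scales_of_dim r U g.
Proof.
move=> x0 Ux0; have [V [s [oV Vx0 VU ps s0]]] := parallel_frame Ux0.
have Hs (p : 'I_r * 'I_(gr_n gr)) := T1 oV VU (T2 p.2 oV VU (ps p.1)).
pose z p := sval (cid (Hs p)).
have pz p : parallel V (z p) by have [] := svalP (cid (Hs p)).
have zE p x : V x -> hf (X x) (z p x) = iota (gr_co gr p.2 (hf (X x) (s p.1 x))).
  by have [_ H] := svalP (cid (Hs p)); exact: H.
have sz a x : V x -> s a x = \sum_k gr_bas gr k *: z (a, k) x.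
  move=> Vx; apply/eqP; rewrite -subr_eq0; apply/eqP.
  apply: (T3 (s := fun y => s a y - \sum_k gr_bas gr k *: z (a, k) y) oV VU) => //.
    rewrite (_ : (fun _ => _) = (fun y => s a y + -1 *: \sum_k gr_bas gr k *: z (a, k) y)).
      by apply: parallelD => //; apply: parallelZ => //; apply: parallel_sum => // k; exact: pz.
    by apply: funext => y; rewrite scaleN1r.
  move=> y Vy; rewrite hfBr hf_sumr {1}(gr_coE gr (hf (X y) (s a y))) -sumrB big1 // => k _.
  by rewrite hfZr zE // mulrC subrr.
pose m := #|{: 'I_r * 'I_(gr_n gr)}|.
pose Z : 'M[C]_(m, r) := \matrix_(p, b) (N' *m z (enum_val p) x0) b 0.
have fZ : row_full Z.
  apply/row_fullP; exists (\matrix_(a, p) (if (enum_val p).1 == a then gr_bas gr (enum_val p).2 else 0)).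
  apply/matrixP => a b; rewrite mxE.
  transitivity (\sum_(p : 'I_r * 'I_(gr_n gr)) (if p.1 == a then gr_bas gr p.2 else 0) * (N' *m z p x0) b 0).
    rewrite [RHS](reindex (@enum_val _ predT)) /=; last exact: onW_bij (enum_val_bij _).
    by apply: eq_bigr => p _; rewrite !mxE.
  transitivity (\sum_p \sum_k (if p == a then gr_bas gr k else 0) * (N' *m z (p, k) x0) b 0).
    by rewrite pair_bigA /=; apply: eq_bigr => -[p k] _.
  rewrite (bigD1 a) //= eqxx [X in _ + X]big1 ?addr0; last first.
    by move=> p /negbTE pa; rewrite big1 // => k _; rewrite pa mul0r.
  have := congr1 (fun v : 'cV[C]_r => v b 0) (s0 a); rewrite sz // mulmx_sumr summxE => E.
  rewrite [LHS](_ : _ = \sum_k (N' *m (gr_bas gr k *: z (a, k) x0)) b 0).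
    by rewrite E !mxE andbT eq_sym.
  by apply: eq_bigr => k _; rewrite -scalemxAr [RHS]mxE.
pose ix j := enum_val (fullrankfun fZ j).
pose Zu := rowsub (fullrankfun fZ) Z.
have ZuE j b : Zu j b = (N' *m z (ix j) x0) b 0 by rewrite [LHS]mxE [LHS]mxE.
have Zu_unit : Zu \in unitmx by exact: fullrowsub_unit.
pose sg j x := gr_co gr (ix j).2 (hf (X x) (s (ix j).1 x)).
have sgE j x : V x -> hf (X x) (z (ix j) x) = iota (sg j x) by exact: zE.
exists V, sg; split => //; first by move=> j; exact: T2.
move=> W tau oW Wx0 WU tauE.
have [t [pt_ tE]] := T1 oW WU tauE.
pose c := (N' *m t x0)^T *m invmx Zu.
have WVo : open (W `&` V) by exact: openI.
have tx0 : t x0 = \sum_j c 0 j *: z (ix j) x0.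
  rewrite (up oW WU pt_ Wx0).
  under eq_bigr => j _ do rewrite (up oV VU (pz (ix j)) Vx0) scalemxAr scalemxAr.
  rewrite -mulmx_sumr; congr (_ *m _); apply/colP => b.
  have := congr1 (fun A : 'rV[C]_r => A 0 b) (mulmxKV Zu_unit (N' *m t x0)^T).
  rewrite -/c [RHS]mxE => <-; rewrite mxE summxE; apply: eq_bigr => j _.
  by rewrite -scalemxAr [RHS]mxE ZuE.
have [||W' [oW' Wx' WW' W'E]] := @parallel_eq0_near (W `&` V) (fun y => t y + -1 *: \sum_j c 0 j *: z (ix j) y) x0
  WVo (fun y Wy => WU y Wy.1) (conj Wx0 Vx0).
- apply: parallelD => //; first by apply: parallel_sub pt_ => y [].
  by apply: parallelZ => //; apply: parallel_sum => // j; apply: parallel_sub (pz (ix j)) => y [].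
- by rewrite scaleN1r tx0 subrr.
pose e : 'rV[K]_r := \row_j gr_co gr (gr_0 gr) (c 0 j).
have He x : W' x -> tau x = \sum_a e 0 a * sg a x.
  move=> W'x; have [Wx Vx] := WW' _ W'x.
  have := W'E x W'x; rewrite scaleN1r => /eqP; rewrite subr_eq0 => /eqP tx.
  have := congr1 (gr_co gr (gr_0 gr)) (tE x Wx).
  rewrite co_iota co_1 eqxx mulr1 => <-; rewrite tx hf_sumr co_sum; apply: eq_bigr => j _.
  by rewrite hfZr sgE // [c 0 j * _]mulrC gr_coZ [e 0 j]mxE mulrC.
have He' : \forall x \near x0, tau x = \sum_a e 0 a * sg a x.
  by near=> x; apply: He; near: x; exact: open_nbhs_nbhs.
exists e; split => // d Hd.
have Hn : \forall x \near x0, V x /\ \sum_a (e 0 a - d 0 a) * sg a x = 0.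
  near=> x; split; first by near: x; exact: open_nbhs_nbhs.
  transitivity (\sum_a e 0 a * sg a x - \sum_a d 0 a * sg a x).
    by rewrite -sumrB; apply: eq_bigr => j _; rewrite mulrBl.
  have -> : \sum_a e 0 a * sg a x = tau x by apply/esym; near: x.
  have -> : \sum_a d 0 a * sg a x = tau x by apply/esym; near: x.
  by rewrite subrr.
pose V' : set pt := interior [set x | V x /\ \sum_a (e 0 a - d 0 a) * sg a x = 0].
have V'x0 : V' x0 by exact: Hn.
have oV' : open V' by exact: open_interior.
have HV' y : V' y -> V y /\ \sum_a (e 0 a - d 0 a) * sg a y = 0 by move=> /interior_subset.
have V'V : V' `<=` V by move=> y /HV'[].
have psum : parallel V' (fun y => \sum_j iota (e 0 j - d 0 j) *: z (ix j) y).
  by apply: parallel_sum => // j; apply: parallel_sub (pz (ix j)).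
have := T3 oV' (fun y Vy => VU _ (V'V _ Vy)) psum _ V'x0.
have hz y : V' y -> hf (X y) (\sum_j iota (e 0 j - d 0 j) *: z (ix j) y) = 0.
  move=> V'y; rewrite hf_sumr.
  under eq_bigr => j _ do rewrite hfZr (sgE j y (V'V _ V'y)) -rmorphM.
  by rewrite -rmorph_sum; have [_ ->] := HV' _ V'y; rewrite rmorph0.
move=> /(_ hz) z0.
have rz : map_mx iota (e - d) *m Zu = 0.
  apply/rowP => b; rewrite [RHS]mxE.
  have := congr1 (fun v : vec => (N' *m v) b 0) z0; rewrite mulmx0 [RHS]mxE => <-.
  rewrite mulmx_sumr summxE mxE; apply: eq_bigr => j _.
  by rewrite -scalemxAr [RHS]mxE [X in X * _]mxE [X in iota X]mxE [X in iota (_ + X)]mxE ZuE.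
have : map_mx iota (e - d) = 0 by rewrite -[LHS](mulmxK Zu_unit) rz mul0mx.
by move=> /(congr1 (fun A : 'rV[C]_r => A)) /eqP; rewrite map_mx_eq0 subr_eq0 => /eqP.
Unshelve. all: by end_near.
Qed.
End Dim.
End Germs.

(** * Charts of the models over the two ground fields *)

Section Grounds.
Variable R : realType.
Notation C := R[i].
Definition complex_ground : ground (idfun : {rmorphism C -> C}).
Proof.
apply: (@Ground R C idfun (fun x => ncE x) (fun x y => erefl) (fun r => r%:C%C) (fun r => erefl)
  1 (fun=> 1) (fun _ z => z) _ _ _ _ _ ord0 erefl) => //.
- by move=> z; rewrite big_ord1 mulr1.
- by move=> k l; rewrite !ord1 eqxx.
Defined.

Definition real_ground : ground (real_complex R : {rmorphism R -> C}).
Proof.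
apply: (@Ground R R (real_complex R : {rmorphism R -> C}) _ _ id (fun r => erefl)
  2 (fun k => if k == ord0 then 1 else 'i%C) (fun k z => if k == ord0 then complex.Re z else complex.Im z)
  _ _ _ _ _ ord0 erefl).
- by move=> x; rewrite ncR.
- by move=> x y; rewrite ltcR.
- by move=> k [x1 x2] [y1 y2]; case: ifP.
- by move=> k a [x1 x2] /=; case: ifP => _; rewrite /= ?mul0r ?subr0 ?addr0.
- move=> [x y]; rewrite !big_ord_recl big_ord0 /= mulr1 addr0; apply/eqP; rewrite eq_complex /=.
  by rewrite !mulr0 !mul0r !mulr1 ?subr0 ?addr0 ?add0r ?subrr !eqxx.
- move=> k l; case: (unliftP ord0 k) => [k' ->|->]; case: (unliftP ord0 l) => [l' ->|->] //=.
  by rewrite !ord1.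
- move=> k [x y]; rewrite ncR /=; case: ifP => _ /=.
    by rewrite -sqrtr_sqr ler_sqrt ?lerDl ?addr_ge0 ?sqr_ge0.
  by rewrite -sqrtr_sqr ler_sqrt ?lerDr ?addr_ge0 ?sqr_ge0.
Defined.
End Grounds.

Section Link.
Variables (R : realType).
Notation C := R[i].
Notation vec := 'cV[C]_7.
Notation e1 := (delta_mx ord0 0 : vec).
Notation E a := (delta_mx (mi a) ord0 : 'M[C]_7).

(** The properties of the curvature function on which the tractor calculus depends;
adm_normal is normality of the Cartan geometry. *)
Record admissible (M : model R) : Prop := {
  adm_space : forall x, x \in mspace M -> isG2 x;
  adm_curv : forall x y, isG2 (curv M x y);
  adm_e1 : forall x y, curv M x y *m e1 = 0;
  adm_linl : forall x y, curv M x y = \sum_a x (mi a) ord0 *: curv M (E a) y;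
  adm_linr : forall x y, curv M x y = \sum_a y (mi a) ord0 *: curv M x (E a);
  adm_normal : forall y c, isG2 y -> \sum_a (curv M (E a) y) (mi a) c = 0 }.

Section Category.
Variables (K : numFieldType) (iota : {rmorphism K -> C}) (gr : ground iota).
Notation pt := 'rV[K]_5.

(** The data that a model chart provides over either ground field; the coframe is
independent over C, not only over K. *)
Record cartan_chart (M : model R) (Th : 'I_5 -> pt -> 'M[C]_7) (U : set pt) : Prop := {
  cc_open : open U;
  cc_smooth : forall i a b, csmooth gr U (fun y => Th i y a b);
  cc_space : forall i x, U x -> Th i x \in mspace M;
  cc_curv : forall i j x, U x -> curvf gr Th i j x = curv M (Th i x) (Th j x);
  cc_coframe : forall x (v : 'I_5 -> C), U x ->
    (forall a, \sum_i v i * Th i x (mi a) ord0 = 0) -> forall i, v i = 0 }.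

(** What the values of the Maurer-Cartan form have to satisfy: closed under K-linear
combinations, with K-independence modulo the parabolic implying C-independence. *)
Record rational_form (M : model R) (fK : set 'M[C]_7) : Prop := {
  rf_sub : forall x, fK x -> x \in mspace M;
  rf_lin : forall n (B : 'I_n -> 'M[C]_7) (c : 'I_n -> K), (forall k, fK (B k)) ->
    fK (\sum_k iota (c k) *: B k);
  rf_indep : forall h : 'I_5 -> 'M[C]_7, (forall i, fK (h i)) ->
    (forall v : 'I_5 -> K, \sum_i iota (v i) *: h i \in parab R -> forall i, v i = 0) ->
    forall v : 'I_5 -> C, \sum_i v i *: h i \in parab R -> forall i, v i = 0 }.

Variables (M : model R) (fK : set 'M[C]_7).
Hypothesis admM : admissible M.
Hypothesis rfM : rational_form M fK.
Variables (U : set pt) (g : pt -> 'M[K]_5).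
Hypothesis gU : local_model_metric iota M fK U g.

(** The Maurer-Cartan equation for the bracket of the model says that the curvature of
Theta as a form with values in gl_7 is kappa; the tractor frame then applies. *)
Theorem local_model_scales : exists (Th : 'I_5 -> pt -> 'M[C]_7) (X : pt -> vec),
  [/\ cartan_chart M Th U,
  forall W sigma, open W -> W `<=` U -> almost_einstein_scale W g sigma ->
    exists s, parallel gr Th W s /\ forall x, W x -> hf (X x) (s x) = iota (sigma x),
  forall W s k, open W -> W `<=` U -> parallel gr Th W s ->
    almost_einstein_scale W g (fun y => gr_co gr k (hf (X y) (s y))) &
  forall W s, open W -> W `<=` U -> parallel gr Th W s ->
    (forall x, W x -> hf (X x) (s x) = 0) -> forall x, W x -> s x = 0].
Proof.
have [n [B [theta [[BK _] [oU sth mc co] [lam [Om [lam0 sOm Om0 gE]]]]]]] := gU.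
pose Th i x := form_at iota B theta x (delta_mx 0 i).
have formE x v : form_at iota B theta x v = \sum_i iota (v 0 i) *: Th i x.
  rewrite /Th /form_at.
  under [RHS]eq_bigr => i _ do rewrite scaler_sumr.
  rewrite exchange_big; apply: eq_bigr => k _ /=.
  under eq_bigr => i _ do rewrite scalerA -rowE mxE -rmorphM.
  by rewrite -scaler_suml -rmorph_sum mxE.
have ThE i x : Th i x = \sum_k iota (theta x i k) *: B k.
  by apply: eq_bigr => k _; rewrite -rowE mxE.
have ThK i x : fK (Th i x) by rewrite ThE; exact: (rf_lin rfM).
have sTh i a b : csmooth gr U (fun y => Th i y a b).
  apply: (@csmooth_ext _ _ _ gr U (fun y => \sum_k iota (theta y i k) * B k a b)) => //.
    by move=> y _; rewrite ThE summxE; apply: eq_bigr => k _; rewrite mxE.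
  apply: csmooth_sum => // k _; apply: csmoothM => //; last exact: csmooth_cst.
  exact: csmooth_iota.
have FFE i j x : U x -> curvf gr Th i j x = curv M (Th i x) (Th j x).
  move=> Ux; apply/eqP; rewrite -subr_eq0 -(mc x Ux i j) /mbracket -!/(Th _ x) addrA; apply/eqP.
  congr (_ - _); congr (_ + _); apply/matrixP => a b; rewrite mxE summxE.
  have D k l : cD gr k (fun z => Th l z a b) x = \sum_p B p a b * iota (partial k (fun y => theta y l p) x).
    rewrite (_ : (fun z => _) = (fun z => \sum_p B p a b * iota (theta z l p))); last first.
      by apply: funext => z; rewrite ThE summxE; apply: eq_bigr => p _; rewrite mxE mulrC.
    have dth p : cdiff gr (fun z => iota (theta z l p)) x by apply: csmooth_diff (csmooth_iota oU (sth l p)) Ux.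
    rewrite cD_sum; last by move=> p _; apply: cdiffZ; exact: dth.
    apply: eq_bigr => p _; rewrite cDZ; last exact: dth.
    by rewrite cD_iota //; exact: smooth_diff (sth l p) Ux.
  rewrite !D -sumrB; apply: eq_bigr => p _.
  by rewrite [RHS]mxE rmorphB mulrBl ![_ * B p a b]mulrC.
have cof x (v : 'I_5 -> C) : U x ->
    (forall a, \sum_i v i * Th i x (mi a) ord0 = 0) -> forall i, v i = 0.
  move=> Ux H; apply: (rf_indep rfM (h := Th^~ x)) => [i|w|]; first exact: ThK.
    move=> wp i; have := co x Ux (\row_i w i).
    rewrite formE; under eq_bigr => k _ do rewrite mxE.
    by move=> /(_ wp) => /(congr1 (fun A : pt => A 0 i)); rewrite !mxE.
  apply: parab_col0.
    by apply/g2_span; apply: isG2_sum => i _; apply: isG2_Z; apply: (adm_space admM); exact: (rf_sub rfM).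
  by move=> a; rewrite summxE -[RHS](H a); apply: eq_bigr => i _; rewrite mxE.
have cc : cartan_chart M Th U.
  by split=> // i x _; exact: (rf_sub rfM).
have ThG i x : U x -> isG2 (Th i x) by move=> Ux; apply: (adm_space admM); exact: (cc_space cc).
have gsym x i j : U x -> g x i j = g x j i.
  by move=> Ux; have [gT _] := gE x Ux; rewrite -[in LHS]gT mxE.
have gE' x (v : pt) : U x -> iota ((v *m g x *m v^T) 0 0) =
  lam * iota (Om x) ^+ 2 * (2^-1 * hf (\sum_i iota (v 0 i) *: (Th i x *m e1)) (\sum_i iota (v 0 i) *: (Th i x *m e1))).
  move=> Ux; have [_ ->] := gE x Ux; rewrite nurowskiE; last first.
    by rewrite formE; apply: isG2_sum => i _; apply: isG2_Z; exact: ThG.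
  by rewrite formE mulmx_suml; under eq_bigr => i _ do rewrite -scalemxAl.
exists Th, (X_tractor iota Om lam); split => //.
- move=> W sigma oW WU ae.
  have [s [sS Ds sE]] := parallel_of_AE oU sTh ThG FFE (adm_curv admM) (adm_e1 admM) (adm_linl admM)
    (adm_normal admM) cof lam0 sOm Om0 gsym gE' oW WU ae.
  by exists s.
- move=> W s k oW WU [sS Ds].
  exact: (AE_of_parallel oU sTh ThG FFE (adm_curv admM) (adm_e1 admM) (adm_linl admM)
    (adm_normal admM) cof lam0 sOm Om0 gsym gE' oW WU).
- move=> W s oW WU [sS Ds].
  exact: (parallel_inj oU sTh ThG FFE (adm_e1 admM) cof lam0 sOm Om0 gsym gE' oW WU sS Ds).
Qed.
End Category.
End Link.

(** * Parallel tractors in coordinates *)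

Section Chain.
Variables (R : realType) (K : numFieldType) (iota : {rmorphism K -> R[i]}) (gr : ground iota).
Notation C := R[i].
Notation vec := 'cV[C]_7.
Notation pt := 'rV[K]_5.
Variables (M : model R) (Th : 'I_5 -> pt -> 'M[C]_7) (U W : set pt) (s : pt -> vec).
Hypothesis admM : admissible M.
Hypothesis cc : cartan_chart gr M Th U.
Hypothesis oW : open W.
Hypothesis WU : W `<=` U.
Hypothesis ps : parallel gr Th W s.

Let P x : 'M[C]_5 := \matrix_(i, a) Th i x (mi a) ord0.
Let Pu x : U x -> P x \in unitmx.
Proof.
move=> Ux; rewrite -row_free_unit -kermx_eq0; apply/eqP/row_matrixP => k; rewrite row0.
set v := row k _; have v0 : v *m P x = 0 by apply/sub_kermxP; exact: row_sub.
apply/rowP => i; rewrite [RHS]mxE; apply: (cc_coframe cc (v := fun i => v 0 i) Ux) => a.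
have := congr1 (fun A : 'rV[C]_5 => A 0 a) v0; rewrite [X in _ = X -> _]mxE => E.
by rewrite -[RHS]E [RHS]mxE; apply: eq_bigr => l _; rewrite [X in _ = _ * X]mxE.
Qed.

Lemma frame_combination x (u : 'I_5 -> C) : U x ->
  exists v : 'I_5 -> C, forall a, (\sum_i v i *: Th i x) (mi a) ord0 = u a.
Proof.
move=> Ux; exists (fun i => (\row_a u a *m invmx (P x)) 0 i) => a.
have := congr1 (fun A : 'rV[C]_5 => A 0 a) (mulmxKV (Pu Ux) (\row_a u a)).
rewrite [X in _ = X -> _]mxE => <-; rewrite summxE mxE; apply: eq_bigr => i _.
by rewrite [LHS]mxE [X in _ = _ * X]mxE.
Qed.

Lemma curv_suml (v : 'I_5 -> C) (A : 'I_5 -> 'M[C]_7) B :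
  curv M (\sum_i v i *: A i) B = \sum_i v i *: curv M (A i) B.
Proof.
rewrite (adm_linl admM); under [RHS]eq_bigr => i _ do rewrite (adm_linl admM) scaler_sumr.
rewrite exchange_big; apply: eq_bigr => a _ /=; rewrite summxE scaler_suml.
by apply: eq_bigr => i _; rewrite mxE scalerA.
Qed.
Lemma curv_sumr (v : 'I_5 -> C) (A : 'I_5 -> 'M[C]_7) B :
  curv M B (\sum_i v i *: A i) = \sum_i v i *: curv M B (A i).
Proof.
rewrite (adm_linr admM); under [RHS]eq_bigr => i _ do rewrite (adm_linr admM) scaler_sumr.
rewrite exchange_big; apply: eq_bigr => a _ /=; rewrite summxE scaler_suml.
by apply: eq_bigr => i _; rewrite mxE scalerA.
Qed.

(** The curvature of nabla annihilates parallel sections, and over C the Theta_i reach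
every class modulo the parabolic. *)
Lemma curv_kills A B x : W x -> curv M A B *m s x = 0.
Proof.
move=> Wx; have Ux := WU Wx; have [sS Ds] := ps.
have sTh i a b : csmooth gr W (fun y => Th i y a b) := csmooth_sub WU (cc_smooth cc i a b).
have [v vE] := frame_combination (fun a => A (mi a) ord0) Ux.
have [w wE] := frame_combination (fun a => B (mi a) ord0) Ux.
have -> : curv M A B = curv M (\sum_i v i *: Th i x) (\sum_i w i *: Th i x).
  rewrite (adm_linl admM) [RHS](adm_linl admM); apply: eq_bigr => a _; rewrite vE; congr (_ *: _).
  by rewrite (adm_linr admM) [RHS](adm_linr admM); apply: eq_bigr => b _; rewrite wE.
rewrite curv_suml mulmx_suml big1 // => i _; rewrite curv_sumr -scalemxAl mulmx_suml big1 ?scaler0 // => j _.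
rewrite -scalemxAl -(cc_curv cc) // -(ricci_identity oW sTh i j Wx sS).
have DD0 k l : nabla gr Th k (nabla gr Th l s) x = 0.
  rewrite (@nabla_ext _ _ _ gr Th W oW k (nabla gr Th l s) (fun=> 0) x Wx); last by move=> y Wy; exact: Ds.
  by have [_] := parallel0 gr Th oW; apply.
by rewrite !DD0 subrr scaler0.
Qed.

(** The derivative of the k-th coordinate is minus that of Theta_i s; complex
combinations of the Theta_i have any prescribed class modulo the parabolic. *)
Lemma derive_coord k : (forall x, W x -> s x k 0 = 0) -> forall x (u : 'I_5 -> C), W x ->
  exists A, [/\ A \in mspace M, forall a, A (mi a) ord0 = u a & (A *m s x) k 0 = 0].
Proof.
move=> s0 x u Wx; have Ux := WU Wx; have [sS Ds] := ps.
have [v vE] := frame_combination u Ux.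
exists (\sum_i v i *: Th i x); split => //.
  by apply: memv_suml => i _; apply: memvZ; exact: (cc_space cc).
rewrite mulmx_suml summxE big1 // => i _; rewrite -scalemxAl mxE.
have := congr1 (fun A : vec => A k 0) (Ds i x Wx).
rewrite [X in _ = X -> _]mxE [X in X = _ -> _]mxE [X in X + _]mxE.
by rewrite (cD_ext gr i oW Wx (G := fun=> 0)) // cD_cst add0r => ->; rewrite mulr0.
Qed.
End Chain.

Section Coordinates.
Variable R : realType.
Notation C := R[i].
Notation g2mx := (@g2mx R).
Notation o k := (@Ordinal 5 k isT).
Notation i7 k := (@Ordinal 7 k isT).

Lemma sum5 (V : nmodType) (F : 'I_5 -> V) : \sum_a F a = F (o 0) + F (o 1) + F (o 2) + F (o 3) + F (o 4).
Proof.
by rewrite !big_ord_recl big_ord0 addr0 !addrA; congr (F _ + F _ + F _ + F _ + F _); apply: val_inj.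
Qed.
Lemma miE : (mi (o 0) = i7 1) * (mi (o 1) = i7 2) * (mi (o 2) = i7 3) * (mi (o 3) = i7 4) * (mi (o 4) = i7 5).
Proof. by split; [split; [split; [split|]|]|]; apply: val_inj; rewrite /= inordK. Qed.

Lemma df_coord (x : 'M[C]_7) : (df10 x = x (i7 1) ord0) * (df11 x = x (i7 2) ord0) *
  (df21 x = x (i7 3) ord0 / sqrtC 2) * (df31 x = x (i7 4) ord0) * (df32 x = x (i7 5) ord0).
Proof.
have := miE; rewrite /mi => E.
by split; [split; [split; [split|]|]|]; rewrite /df10 /df11 /df21 /df31 /df32 !E.
Qed.

Lemma g2_row z1 z2 a01 a10 a11 a21 a31 a32 b01 b10 b11 b21 b31 b32 (v : 'cV[C]_7) :
  let A := g2mx z1 z2 a01 a10 a11 a21 a31 a32 b01 b10 b11 b21 b31 b32 in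
  let r2 := sqrtC 2 in
  let s k := v k 0 in
  ((A *m v) (i7 0) 0 = (2 * z1 + z2) * s (i7 0) + b10 * s (i7 1) + b11 * s (i7 2) + r2 * b21 * s (i7 3)
        + b31 * s (i7 4) + b32 * s (i7 5)) *
      ((A *m v) (i7 1) 0 = a10 * s (i7 0) + (z1 + z2) * s (i7 1) + b01 * s (i7 2) + r2 * b11 * s (i7 3)
        - b21 * s (i7 4) - b32 * s (i7 6)) *
      ((A *m v) (i7 2) 0 = a11 * s (i7 0) + a01 * s (i7 1) + z1 * s (i7 2) - r2 * b10 * s (i7 3)
        + b21 * s (i7 5) - b31 * s (i7 6)) *
      ((A *m v) (i7 3) 0 = r2 * (a21 * s (i7 0) + a11 * s (i7 1) - a10 * s (i7 2)
        + b10 * s (i7 4) - b11 * s (i7 5) - b21 * s (i7 6))) *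
      ((A *m v) (i7 4) 0 = a31 * s (i7 0) - a21 * s (i7 1) + r2 * a10 * s (i7 3) - z1 * s (i7 4)
        - b01 * s (i7 5) - b11 * s (i7 6)) *
      ((A *m v) (i7 5) 0 = a32 * s (i7 0) + a21 * s (i7 2) - r2 * a11 * s (i7 3) - a01 * s (i7 4)
        - (z1 + z2) * s (i7 5) - b10 * s (i7 6)) *
      ((A *m v) (i7 6) 0 = - a32 * s (i7 1) - a31 * s (i7 2) - r2 * a21 * s (i7 3) - a11 * s (i7 4)
        - a10 * s (i7 5) - (2 * z1 + z2) * s (i7 6)).
Proof.
have sum7' (F : 'I_7 -> C) : \sum_a F a = F (i7 0) + F (i7 1) + F (i7 2) + F (i7 3) + F (i7 4) + F (i7 5) + F (i7 6).
  by rewrite !big_ord_recl big_ord0 addr0 !addrA; congr (F _ + F _ + F _ + F _ + F _ + F _ + F _); apply: val_inj.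
by move=> A r2 s; do 6 (try split); rewrite mxE sum7' !mxE /= -!/(s _) -/r2; move: (s) r2 => s' r; ring.
Qed.
End Coordinates.

(** * The curvature and the Lie algebra of each model *)

Section WedgeCurvature.
Variable R : realType.
Notation C := R[i].
Notation g2mx := (@g2mx R).
Notation o k := (@Ordinal 5 k isT).
Notation i7 k := (@Ordinal 7 k isT).
Notation e1 := (delta_mx ord0 0 : 'cV[C]_7).

Lemma df_delta a : let x := delta_mx (mi a) ord0 : 'M[C]_7 in
  (df10 x = (a == o 0)%:R) * (df11 x = (a == o 1)%:R) *
  (df21 x = (a == o 2)%:R / sqrtC 2) * (df31 x = (a == o 3)%:R) * (df32 x = (a == o 4)%:R).
Proof.
have E b c : (mi b == mi c) = (b == c).
  by rewrite -!val_eqE /= !inordK // ltnS ltnW // ltnS ltn_ord.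
by move=> x; rewrite !df_coord /x -!miE !mxE !eqxx !andbT !E ![_ == a]eq_sym.
Qed.

Variables (G1031 G1032 G1131 G1132 G2131 G2132 G3132 : 'M[C]_7).
(** Curvature functions that vanish on pairs from f_10, f_11, f_21; the G are the values
on the other pairs of the f_st. *)
Definition wcurv (x y : 'M[C]_7) : 'M[C]_7 :=
  wedge (@df10 R) (@df31 R) x y *: G1031 + wedge (@df10 R) (@df32 R) x y *: G1032 + wedge (@df11 R) (@df31 R) x y *: G1131 +
  wedge (@df11 R) (@df32 R) x y *: G1132 + wedge (@df21 R) (@df31 R) x y *: G2131 + wedge (@df21 R) (@df32 R) x y *: G2132 +
  wedge (@df31 R) (@df32 R) x y *: G3132.

Lemma wcurv_pairs (v : 'cV[C]_7) : (forall x y, wcurv x y *m v = 0) ->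
  [/\ G1031 *m v = 0, G1032 *m v = 0, G1131 *m v = 0, G1132 *m v = 0 &
   [/\ G2131 *m v = 0, G2132 *m v = 0 & G3132 *m v = 0]].
Proof.
move=> H.
have dE := dfE; rewrite /= in dE.
have H0 := H (f10 R) (f31 R). have H1 := H (f10 R) (f32 R). have H2 := H (f11 R) (f31 R).
have H3 := H (f11 R) (f32 R). have H4 := H (f21 R) (f31 R). have H5 := H (f21 R) (f32 R).
have H6 := H (f31 R) (f32 R).
have [a0 a1 a2 a3 a4] : [/\ df10 (f10 R) = 1, df11 (f10 R) = 0, df21 (f10 R) = 0, df31 (f10 R) = 0 & df32 (f10 R) = 0] by exact: dE.
have [b0 b1 b2 b3 b4] : [/\ df10 (f11 R) = 0, df11 (f11 R) = 1, df21 (f11 R) = 0, df31 (f11 R) = 0 & df32 (f11 R) = 0] by exact: dE.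
have [c0 c1 c2 c3 c4] : [/\ df10 (f21 R) = 0, df11 (f21 R) = 0, df21 (f21 R) = 1, df31 (f21 R) = 0 & df32 (f21 R) = 0] by exact: dE.
have [d0 d1 d2 d3 d4] : [/\ df10 (f31 R) = 0, df11 (f31 R) = 0, df21 (f31 R) = 0, df31 (f31 R) = 1 & df32 (f31 R) = 0] by exact: dE.
have [h0 h1 h2 h3 h4] : [/\ df10 (f32 R) = 0, df11 (f32 R) = 0, df21 (f32 R) = 0, df31 (f32 R) = 0 & df32 (f32 R) = 1] by exact: dE.
move: H0 H1 H2 H3 H4 H5 H6.
rewrite /wcurv /wedge a0 a1 a2 a3 a4 b0 b1 b2 b3 b4 c0 c1 c2 c3 c4 d0 d1 d2 d3 d4 h0 h1 h2 h3 h4.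
by rewrite !(mul0r, mulr0, mul1r, subr0, subrr, scale0r, scale1r, addr0, add0r).
Qed.

Hypothesis G_g2 : [/\ isG2 G1031, isG2 G1032, isG2 G1131, isG2 G1132 & [/\ isG2 G2131, isG2 G2132 & isG2 G3132]].
Hypothesis G_e1 : [/\ G1031 *m e1 = 0, G1032 *m e1 = 0, G1131 *m e1 = 0, G1132 *m e1 = 0 &
   [/\ G2131 *m e1 = 0, G2132 *m e1 = 0 & G3132 *m e1 = 0]].
Hypothesis G_normal : forall c, let r2 := sqrtC 2 in
  [/\ G1031 (i7 4) c + G1032 (i7 5) c = 0, G1131 (i7 4) c + G1132 (i7 5) c = 0,
      G2131 (i7 4) c + G2132 (i7 5) c = 0,
      G1031 (i7 1) c + G1131 (i7 2) c + G2131 (i7 3) c / r2 - G3132 (i7 5) c = 0 &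
      G1032 (i7 1) c + G1132 (i7 2) c + G2132 (i7 3) c / r2 + G3132 (i7 4) c = 0].

Let df_lin x : [/\ df10 x = \sum_a x (mi a) ord0 * df10 (delta_mx (mi a) ord0 : 'M[C]_7),
   df11 x = \sum_a x (mi a) ord0 * df11 (delta_mx (mi a) ord0 : 'M[C]_7),
   df21 x = \sum_a x (mi a) ord0 * df21 (delta_mx (mi a) ord0 : 'M[C]_7),
   df31 x = \sum_a x (mi a) ord0 * df31 (delta_mx (mi a) ord0 : 'M[C]_7) &
   df32 x = \sum_a x (mi a) ord0 * df32 (delta_mx (mi a) ord0 : 'M[C]_7)].
Proof.
split; rewrite sum5 !df_delta !df_coord !miE /=;
  by rewrite !(mul0r, mulr0, mul1r, mulr1, addr0, add0r).
Qed.
Let wedge_lin (f g : 'M[C]_7 -> C) (x y : 'M[C]_7) :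
  f x = \sum_a x (mi a) ord0 * f (delta_mx (mi a) ord0) ->
  g x = \sum_a x (mi a) ord0 * g (delta_mx (mi a) ord0) ->
  wedge f g x y = \sum_a x (mi a) ord0 * wedge f g (delta_mx (mi a) ord0) y.
Proof.
move=> Hf Hg; rewrite /wedge Hf Hg mulr_suml mulr_sumr -sumrB; apply: eq_bigr => a _.
by rewrite mulrBr !mulrA [f y * _]mulrC.
Qed.
Let wcurv_linl x y : wcurv x y = \sum_a x (mi a) ord0 *: wcurv (delta_mx (mi a) ord0) y.
Proof.
have [h10 h11 h21 h31 h32] := df_lin x.
rewrite /wcurv (wedge_lin _ h10 h31) (wedge_lin _ h10 h32) (wedge_lin _ h11 h31) (wedge_lin _ h11 h32)
  (wedge_lin _ h21 h31) (wedge_lin _ h21 h32) (wedge_lin _ h31 h32) !scaler_suml -!big_split.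
by apply: eq_bigr => a _ /=; rewrite !scalerDr !scalerA.
Qed.
Let wcurvC x y : wcurv x y = - wcurv y x.
Proof.
have W f g : @wedge R f g x y = - wedge f g y x by rewrite /wedge opprB.
by rewrite /wcurv 7!W !scaleNr -!opprD.
Qed.
Let normal_aux (r y0 y1 y2 y3 y4 a4 a1 b5 b1 c4 c2 d5 d2 e4 e3 f5 f3 h5 h4 : C) :
  [/\ a4 + b5 = 0, c4 + d5 = 0, e4 + f5 = 0, a1 + c2 + e3 / r - h5 = 0 & b1 + d2 + f3 / r + h4 = 0] ->
  (y3 * a1 + y4 * b1) + (y3 * c2 + y4 * d2) + (r^-1 * y3 * e3 + r^-1 * y4 * f3) +
  (- y0 * a4 - y1 * c4 - y2 * e4 + y4 * h4) + (- y0 * b5 - y1 * d5 - y2 * f5 - y3 * h5) = 0.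
Proof.
move=> [H1 H2 H3 H4 H5].
transitivity (- y0 * (a4 + b5) - y1 * (c4 + d5) - y2 * (e4 + f5) + y3 * (a1 + c2 + e3 / r - h5) +
  y4 * (b1 + d2 + f3 / r + h4)); first by ring.
by rewrite H1 H2 H3 H4 H5 !mulr0 !subr0 !addr0.
Qed.
Let wcurv_normal y c : \sum_a (wcurv (delta_mx (mi a) ord0) y) (mi a) c = 0.
Proof.
rewrite -[RHS](normal_aux (df10 y) (df11 y) (df21 y) (df31 y) (df32 y) (G_normal c)).
have E a i : wcurv (delta_mx (mi a) ord0) y i c = 
  ((a == o 0)%:R * df31 y - df10 y * (a == o 3)%:R) * G1031 i c + ((a == o 0)%:R * df32 y - df10 y * (a == o 4)%:R) * G1032 i c +
  ((a == o 1)%:R * df31 y - df11 y * (a == o 3)%:R) * G1131 i c + ((a == o 1)%:R * df32 y - df11 y * (a == o 4)%:R) * G1132 i c +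
  ((a == o 2)%:R / sqrtC 2 * df31 y - df21 y * (a == o 3)%:R) * G2131 i c +
  ((a == o 2)%:R / sqrtC 2 * df32 y - df21 y * (a == o 4)%:R) * G2132 i c +
  ((a == o 3)%:R * df32 y - df31 y * (a == o 4)%:R) * G3132 i c.
  by rewrite /wcurv /wedge !df_delta !mxE.
rewrite sum5 !E /= !miE; congr (_ + _ + _ + _ + _).
all: by rewrite !(oppr0, mulNr, mul0r, mulr0, mul1r, mulr1, subr0, sub0r, addr0, add0r).
Qed.

(** Bilinearity holds because the wedges are built from coordinates of the first column;
normality reduces to one identity for each basis vector f_st of g/p. *)
Lemma wcurv_admissible (V : {vspace 'M[C]_7}) : (forall x, x \in V -> isG2 x) -> admissible (Model V wcurv).
Proof.
have [g1 g2 g3 g4 [g5 g6 g7]] := G_g2.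
have [k1 k2 k3 k4 [k5 k6 k7]] := G_e1.
move=> VG; split=> //=.
- by move=> x y; rewrite /wcurv; do 6 (apply: isG2_D; last exact: isG2_Z); exact: isG2_Z.
- by move=> x y; rewrite /wcurv !mulmxDl -!scalemxAl k1 k2 k3 k4 k5 k6 k7 !scaler0 !addr0.
- move=> x y; rewrite wcurvC wcurv_linl -sumrN; apply: eq_bigr => a _.
  by rewrite -scalerN -wcurvC.
Qed.
End WedgeCurvature.

Section Models.
Variable R : realType.
Notation C := R[i].
Notation g2mx := (@g2mx R).
Notation i7 k := (@Ordinal 7 k isT).
Notation e1 := (delta_mx ord0 0 : 'cV[C]_7).

Lemma isG2_mx z1 z2 a01 a10 a11 a21 a31 a32 b01 b10 b11 b21 b31 b32 :
  isG2 (g2mx z1 z2 a01 a10 a11 a21 a31 a32 b01 b10 b11 b21 b31 b32).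
Proof. by do 14 eexists. Qed.
Lemma g2_filtered z1 z2 a01 b01 b10 b11 b21 b31 b32 : 2 * z1 + z2 = 0 ->
  g2mx z1 z2 a01 0 0 0 0 0 b01 b10 b11 b21 b31 b32 *m e1 = 0.
Proof.
move=> z0; apply/colP => i; rewrite -colE !mxE.
by case: i => [[|[|[|[|[|[|[|//]]]]]]] ?]; rewrite /= ?z0 ?mulr0 ?oppr0 //.
Qed.
Lemma h01E : h01 R = g2mx (-1) 2 0 0 0 0 0 0 0 0 0 0 0 0.
Proof.
have eE : e01 R = delta_mx (i7 1) (i7 2) - delta_mx (i7 4) (i7 5).
  apply/matrixP => i j; rewrite !mxE.
  by case: i => [[|[|[|[|[|[|[|//]]]]]]] ?]; case: j => [[|[|[|[|[|[|[|//]]]]]]] ?];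
    rewrite /= ?(mulr0, addr0, subr0, sub0r, oppr0).
have fE : f01 R = delta_mx (i7 2) (i7 1) - delta_mx (i7 5) (i7 4).
  apply/matrixP => i j; rewrite !mxE.
  by case: i => [[|[|[|[|[|[|[|//]]]]]]] ?]; case: j => [[|[|[|[|[|[|[|//]]]]]]] ?];
    rewrite /= ?(mulr0, addr0, subr0, sub0r, oppr0).
rewrite /h01 /bracket eE fE !mulmxBl !mulmxBr !mul_delta_mx_cond /= !mulr1n !mulr0n !subr0 !sub0r !opprK.
apply/matrixP => i j; rewrite !mxE; move: (sqrtC (2 : C)) => r.
case: i => [[|[|[|[|[|[|[|//]]]]]]] ?]; case: j => [[|[|[|[|[|[|[|//]]]]]]] ?];
  rewrite /= ?(mulr0, addr0, subr0, sub0r, oppr0) //; ring.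
Qed.

Lemma admissible_flat : admissible (flat_model R).
Proof.
split=> /=.
- by move=> x /g2_span.
- by move=> _ _; exact: isG2_0.
- by move=> _ _; rewrite mul0mx.
- by move=> x y; rewrite big1 // => a _; rewrite scaler0.
- by move=> x y; rewrite big1 // => a _; rewrite scaler0.
by move=> y c _; rewrite big1 // => a _; rewrite mxE.
Qed.

Lemma span_tuple (K : fieldType) (V : vectType K) n (X : n.-tuple V) v :
  v \in << X >>%VS -> exists c : 'I_n -> K, v = \sum_i c i *: X`_i.
Proof. by move=> /coord_span vE; exists (fun i => coord X i v). Qed.

Lemma space_N7 c x : x \in mspace (modelN7 c) -> exists z a01 u10 u11 u21 u31 u32,
  x = g2mx 0 z a01 u10 u11 u21 u31 u32 0 (c * u10) 0 0 0 0.
Proof.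
move=> /(@span_tuple _ _ _ (in_tuple _))[d ->] /=; rewrite !big_ord_recl big_ord0 /= addr0.
do 7 move: (d _) => ?; do 7 eexists.
rewrite /Z2 /f01 /f10 /e10 /f11 /f21 /f31 /f32 !(g2mxZ, g2mxD).
congr g2mx; ring.
Qed.
Lemma space_N6 x : x \in mspace (modelN6 R) -> exists t u10 u11 u21 u31 u32,
  x = g2mx (u11 - 2 * u31) (- 2 * u11 + u31) t u10 u11 u21 u31 u32 u10 (6 * u10 + 9 * u21 - u32)
    (- u31) (2 * u21) (2 * u11 - 4 * u31) (2 * u10).
Proof.
move=> /(@span_tuple _ _ _ (in_tuple _))[d ->] /=; rewrite !big_ord_recl big_ord0 /= addr0.
move: (d _) => d0; move: (d _) => d1; move: (d _) => d2; move: (d _) => d3; move: (d _) => d4; move: (d _) => d5.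
exists d0, d1, d2, d3, d4, d5.
rewrite /Z1 /Z2 /f01 /e01 /f10 /e10 /f11 /e11 /f21 /e21 /f31 /e31 /f32 /e32 !(g2mxZ, g2mxD, g2mxN).
congr g2mx; ring.
Qed.
Definition qD6 (a : C) := a * (a ^+ 2 + 1 / 3).
Lemma space_D6 a x : x \in mspace (modelD6 a) -> exists t u10 u11 u21 u31 u32,
  x = g2mx (- t) (2 * t) 0 u10 u11 u21 u31 u32 0 (a * u11 + u32) (a * u10 + u31) ((a ^+ 2 + 1) * u21)
    (u11 + qD6 a * u32) (u10 + qD6 a * u31).
Proof.
move=> /(@span_tuple _ _ _ (in_tuple _))[d ->] /=; rewrite !big_ord_recl big_ord0 /= addr0 h01E.
move: (d _) => d0; move: (d _) => d1; move: (d _) => d2; move: (d _) => d3; move: (d _) => d4; move: (d _) => d5.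
exists d0, d1, d2, d3, d4, d5; rewrite -/(qD6 a); move: (qD6 a) => q.
rewrite /f10 /e10 /f11 /e11 /f21 /e21 /f31 /e31 /f32 /e32 !(g2mxZ, g2mxD).
congr g2mx; ring.
Qed.

Lemma curv_N7 c : curv (modelN7 c) = wcurv (f01 R) 0 0 0 0 0 0.
Proof. by apply: funext => x; apply: funext => y; rewrite /wcurv !scaler0 !addr0. Qed.
Lemma curv_N6 : curv (modelN6 R) =
  wcurv (g2mx 0 0 42 0 0 0 0 0 0 (-30) 0 (-20) 0 8) (g2mx 0 0 0 0 0 0 0 0 0 0 0 0 (-4) 0)
   (g2mx 0 0 0 0 0 0 0 0 0 0 0 0 4 0) 0 (g2mx 0 0 60 0 0 0 0 0 0 (-40) 0 (-24) 0 6)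
   (g2mx 0 0 0 0 0 0 0 0 0 0 0 0 (-6) 0) (g2mx 0 0 20 0 0 0 0 0 0 (-12) 0 (-6) 0 0).
Proof.
apply: funext => x; apply: funext => y; rewrite /wcurv /= scaler0 addr0.
move: (wedge _ _ x y) => w1; move: (wedge _ _ x y) => w2; move: (wedge _ _ x y) => w3.
move: (wedge _ _ x y) => w4; move: (wedge _ _ x y) => w5; move: (wedge _ _ x y) => w6.
rewrite /f01 /e10 /e21 /e31 /e32 !(g2mxZ, g2mxD, g2mxN).
congr g2mx; ring.
Qed.
Lemma curv_D6 a : curv (modelD6 a) =
  wcurv (g2mx 0 0 0 0 0 0 0 0 4 0 0 0 0 0) (g2mx 4 (-8) 0 0 0 0 0 0 0 0 0 (- (4 * a / 3)) 0 0)
   (g2mx (-4) 8 0 0 0 0 0 0 0 0 0 (4 * a / 3) 0 0) (g2mx 0 0 4 0 0 0 0 0 0 0 0 0 0 0)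
   (g2mx 0 0 0 0 0 0 0 0 0 0 (8 * a / 3) 0 0 (- (2 * a ^+ 2)))
   (g2mx 0 0 0 0 0 0 0 0 0 (- (8 * a / 3)) 0 0 (2 * a ^+ 2) 0)
   (g2mx (- (4 * a / 3)) (8 * a / 3) 0 0 0 0 0 0 0 0 0 (2 * a ^+ 2) 0 0).
Proof.
apply: funext => x; apply: funext => y; rewrite /wcurv /= h01E.
move: (wedge _ _ x y) => w1; move: (wedge _ _ x y) => w2; move: (wedge _ _ x y) => w3.
move: (wedge _ _ x y) => w4; move: (wedge _ _ x y) => w5; move: (wedge _ _ x y) => w6; move: (wedge _ _ x y) => w7.
rewrite /f01 /e01 /e10 /e11 /e21 /e31 /e32 !(g2mxZ, g2mxD, g2mxN).
congr g2mx; by field.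
Qed.

Lemma admissible_N7 (c : C) : admissible (modelN7 c).
Proof.
have -> : modelN7 c = Model (mspace (modelN7 c)) (wcurv (f01 R) 0 0 0 0 0 0) by rewrite -(curv_N7 c).
apply: wcurv_admissible.
- by split; [| | | |split]; try exact: isG2_0; exact: isG2_mx.
- by split; [| | | |split]; rewrite ?mul0mx //; apply: g2_filtered; rewrite mulr0 addr0.
- move=> d r; have r0 : r != 0 by exact: r2_neq0.
  rewrite !mxE -/r; move: r r0 => r r0.
  by split; case: d => [[|[|[|[|[|[|[|//]]]]]]] ?]; rewrite /= ?(mulr0, mul0r, addr0, oppr0, subr0).
by move=> x /space_N7[? [? [? [? [? [? [? ->]]]]]]]; exact: isG2_mx.
Qed.
Lemma admissible_N6 : admissible (modelN6 R).
Proof.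
have := curv_N6; set k := wcurv _ _ _ _ _ _ _ => kE.
have -> : modelN6 R = Model (mspace (modelN6 R)) k by rewrite -kE.
apply: wcurv_admissible.
- by split; [| | | |split]; try exact: isG2_0; exact: isG2_mx.
- by split; [| | | |split]; rewrite ?mul0mx //; apply: g2_filtered; rewrite mulr0 addr0.
- move=> d r; have r0 : r != 0 by exact: r2_neq0.
  rewrite !mxE -/r; move: r r0 => r r0.
  by split; case: d => [[|[|[|[|[|[|[|//]]]]]]] ?]; rewrite /=; field.
by move=> x /space_N6[? [? [? [? [? [? ->]]]]]]; exact: isG2_mx.
Qed.
Lemma admissible_D6 (a : C) : admissible (modelD6 a).
Proof.
have := curv_D6 a; set k := wcurv _ _ _ _ _ _ _ => kE.
have -> : modelD6 a = Model (mspace (modelD6 a)) k by rewrite -kE.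
apply: wcurv_admissible.
- by split; [| | | |split]; exact: isG2_mx.
- by split; [| | | |split]; apply: g2_filtered; ring.
- move=> d r; have r0 : r != 0 by exact: r2_neq0.
  rewrite !mxE -/r; move: r r0 => r r0.
  by split; case: d => [[|[|[|[|[|[|[|//]]]]]]] ?]; rewrite /=; field.
by move=> x /space_D6[? [? [? [? [? [? ->]]]]]]; exact: isG2_mx.
Qed.
End Models.

(** * Real forms and the dimension of the space of scales *)

Section RationalForms.
Variable R : realType.
Notation C := R[i].

Lemma rational_complex (M : model R) : rational_form (idfun : {rmorphism C -> C}) M [set x | x \in mspace M].
Proof.
split=> //=.
by move=> n B c BM; apply: memv_suml => k _; apply: memvZ; exact: BM.
Qed.

(** Write a complex combination of fixed vectors as A1 + i A2 with A1, A2 fixed by psi.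
If it lies in the parabolic, so does its image A1 - i A2, hence A1 and A2 do. *)
Lemma rational_real (M : model R) psi : (forall x, x \in mspace M -> isG2 x) -> real_form_involution M psi ->
  rational_form (real_complex R : {rmorphism R -> C}) M [set x | x \in mspace M /\ psi x = x].
Proof.
move=> MG inv.
have Mg2 x : x \in mspace M -> x \in g2 R by move=> /MG /g2_span.
have lin n (B : 'I_n -> 'M[C]_7) (c : 'I_n -> R) : (forall k, B k \in mspace M /\ psi (B k) = B k) ->
   (\sum_k (c k)%:C%C *: B k \in mspace M) /\ psi (\sum_k (c k)%:C%C *: B k) = \sum_k (c k)%:C%C *: B k.
  move=> HB; have mB k : (c k)%:C%C *: B k \in mspace M by apply: memvZ; exact: (HB k).1.
  split; first by apply: memv_suml => k _.
  have psi0 : psi 0 = 0.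
    by have := invol_scale inv 0 (mem0v (g2 R)); rewrite !scale0r conjc0 scale0r.
  suff [] : (\sum_k (c k)%:C%C *: B k \in g2 R) /\
    psi (\sum_k (c k)%:C%C *: B k) = \sum_k (c k)%:C%C *: B k by [].
  elim/big_rec: _ => [|k y _ [yM yE]]; first by rewrite mem0v psi0.
  have kg := Mg2 _ (mB k); split; first exact: memvD.
  rewrite (invol_add inv) // yE (invol_scale inv) ?(HB k).2; last by apply: Mg2; exact: (HB k).1.
  by congr (_ *: _ + _); rewrite conjc_real.
split=> /=.
- by move=> x [].
- by move=> n B c; exact: lin.
move=> h hM hind v vp.
pose A1 := \sum_i (complex.Re (v i))%:C%C *: h i.
pose A2 := \sum_i (complex.Im (v i))%:C%C *: h i.
have [m1 p1] : A1 \in mspace M /\ psi A1 = A1 by exact: lin.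
have [m2 p2] : A2 \in mspace M /\ psi A2 = A2 by exact: lin.
have vE : \sum_i v i *: h i = A1 + 'i%C *: A2.
  rewrite scaler_sumr -big_split; apply: eq_bigr => i _ /=.
  by rewrite scalerA -scalerDl -complexE.
have g1 := Mg2 _ m1; have g2' := Mg2 _ m2.
have cp : A1 - 'i%C *: A2 \in parab R.
  have := invol_parab inv vp; rewrite vE (invol_add inv) ?memvZ // (invol_scale inv) // p1 p2.
  have -> : ('i%C : C)^*%C = - 'i%C by apply/eqP; rewrite eq_complex /= oppr0 !eqxx.
  by rewrite scaleNr.
have vp' : A1 + 'i%C *: A2 \in parab R by rewrite -vE.
have q1 : A1 \in parab R.
  have : (2^-1 : C) *: (A1 + 'i%C *: A2 + (A1 - 'i%C *: A2)) \in parab R by apply: memvZ; exact: memvD.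
  have h2 : 2^-1 + 2^-1 = 1 :> C by field.
  by rewrite addrACA subrr addr0 scalerDr -scalerDl h2 scale1r.
have q2 : A2 \in parab R.
  have : (- 'i%C : C) *: (A1 + 'i%C *: A2 - A1) \in parab R by apply: memvZ; exact: memvB.
  by rewrite addrAC subrr add0r scalerA mulNr -expr2 sqr_i opprK scale1r.
move=> i; have r1 := hind _ q1 i; have r2 := hind _ q2 i.
by apply/eqP; rewrite eq_complex r1 r2 !eqxx.
Qed.
End RationalForms.

Section Results.
Variable R : realType.
Notation C := R[i].
Notation vec := 'cV[C]_7.
Notation i7 k := (@Ordinal 7 k isT).

(** Quantification over the ground field treats a model together with its real forms. *)
Definition parallel_in (K : numFieldType) (iota : {rmorphism K -> C}) (gr : ground iota) (M : model R)
   (Q : vec -> Prop) := forall Th (U W : set 'rV[K]_5) s, cartan_chart gr M Th U -> open W -> W `<=` U ->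
   parallel gr Th W s -> forall x, W x -> Q (s x).

Lemma no_scales_of (M : model R) : admissible M ->
  (forall K iota gr, @parallel_in K iota gr M (fun v => v = 0)) ->
  complex_no_scales M /\ real_forms_no_scales M.
Proof.
move=> aM H; split.
  move=> U g gU; have [Th [X [cc T1 T2 T3]]] := local_model_scales (complex_ground R) aM (rational_complex M) gU.
  apply: (no_scales (gr := complex_ground R) T1) => W s oW WU ps; exact: H cc oW WU ps.
move=> psi inv U g gU.
have [Th [X [cc T1 T2 T3]]] := local_model_scales (real_ground R) aM (rational_real (adm_space aM) inv) gU.
apply: (no_scales (gr := real_ground R) T1) => W s oW WU ps; exact: H cc oW WU ps.
Qed.

Lemma scales_dim_of (M : model R) r (N : 'M[C]_(7, r)) (N' : 'M[C]_(r, 7)) : admissible M ->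
  N' *m N = 1%:M -> (forall A, A \in mspace M -> A *m N = N *m (N' *m A *m N)) ->
  (forall x y, curv M x y *m N = 0) ->
  (forall K iota gr, @parallel_in K iota gr M (fun v => v = N *m (N' *m v))) ->
  complex_scales_dim M r /\ real_forms_scales_dim M r.
Proof.
move=> aM NN AN cN H; split.
  move=> U g gU; have [Th [X [cc T1 T2 T3]]] := local_model_scales (complex_ground R) aM (rational_complex M) gU.
  apply: (scales_dim (cc_open cc) (cc_smooth cc) T1 T2 T3 NN) => [i x Ux|i j x Ux|W s oW WU ps].
  - by apply: AN; exact: (cc_space cc).
  - by rewrite (cc_curv cc).
  - exact: H cc oW WU ps.
move=> psi inv U g gU.
have [Th [X [cc T1 T2 T3]]] := local_model_scales (real_ground R) aM (rational_real (adm_space aM) inv) gU.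
apply: (scales_dim (cc_open cc) (cc_smooth cc) T1 T2 T3 NN) => [i x Ux|i j x Ux|W s oW WU ps].
- by apply: AN; exact: (cc_space cc).
- by rewrite (cc_curv cc).
- exact: H cc oW WU ps.
Qed.

Lemma scales_flat : complex_scales_dim (flat_model R) 7 /\ real_forms_scales_dim (flat_model R) 7.
Proof.
apply: (@scales_dim_of _ 7 1%:M 1%:M (admissible_flat R)).
- by rewrite mulmx1.
- by move=> A _; rewrite !mul1mx !mulmx1.
- by move=> x y; rewrite mul0mx.
- by move=> K iota gr Th U W s _ _ _ _ x _; rewrite !mul1mx.
Qed.

Notation o k := (@Ordinal 5 k isT).
Notation g2mx := (@g2mx R).

Lemma g2_col0 z1 z2 a01 a10 a11 a21 a31 a32 b01 b10 b11 b21 b31 b32 (u : 'I_5 -> C) :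
  (forall a, g2mx z1 z2 a01 a10 a11 a21 a31 a32 b01 b10 b11 b21 b31 b32 (mi a) ord0 = u a) ->
  [/\ a10 = u (o 0), a11 = u (o 1), sqrtC 2 * a21 = u (o 2), a31 = u (o 3) & a32 = u (o 4)].
Proof.
by move=> H; split; rewrite -H !miE mxE.
Qed.
Lemma unit_coframe z1 z2 a01 a10 a11 a21 a31 a32 b01 b10 b11 b21 b31 b32 b : b != o 2 ->
  (forall a, g2mx z1 z2 a01 a10 a11 a21 a31 a32 b01 b10 b11 b21 b31 b32 (mi a) ord0 = (a == b)%:R) ->
  [/\ a10 = (o 0 == b)%:R, a11 = (o 1 == b)%:R, a21 = 0, a31 = (o 3 == b)%:R & a32 = (o 4 == b)%:R].
Proof.
move=> b2 /g2_col0[h0 h1 h2 h3 h4]; split => //.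
by apply: (mulfI (r2_neq0 R)); rewrite h2 mulr0 eq_sym (negbTE b2).
Qed.

Lemma row_eq0 (A : 'M[C]_7) (v : vec) k : A *m v = 0 -> (A *m v) k 0 = 0.
Proof. by move=> ->; rewrite mxE. Qed.

Let simp := (mul0r, mulr0, mul1r, mulr1, addr0, add0r, subr0, sub0r, oppr0).

(** As kappa takes the value f_01, coordinates 1 and 4 (counted from 0) vanish. Deriving
them in the direction of f_10 gives coordinates 0 and 3, and deriving coordinate 3
gives coordinate 2. *)
Lemma parallel_N7 c K iota gr : @parallel_in K iota gr (modelN7 c) (fun v => forall k : 'I_7, (k < 5)%N -> v k 0 = 0).
Proof.
move=> Th U W s cc oW WU ps.
have aM := admissible_N7 c.
have [s1 s4] : (forall x, W x -> s x (i7 1) 0 = 0) /\ (forall x, W x -> s x (i7 4) 0 = 0).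
  suff H x : W x -> s x (i7 1) 0 = 0 /\ s x (i7 4) 0 = 0 by split=> x /H[].
  move=> Wx; have := fun A B => curv_kills aM cc oW WU ps A B Wx.
  rewrite curv_N7 => /wcurv_pairs[k1 _ _ _ _].
  have := row_eq0 (i7 2) k1; have := row_eq0 (i7 5) k1; rewrite !g2_row !simp => /eqP; rewrite oppr_eq0 => /eqP.
  by [].
have e1 k x : (forall x, W x -> s x k 0 = 0) -> W x -> exists z a01 u32,
    (g2mx 0 z a01 1 0 0 0 u32 0 c 0 0 0 0 *m s x) k 0 = 0.
  move=> sk Wx; have [A [AM]] := derive_coord cc oW WU ps sk (fun a => (a == o 0)%:R) Wx.
  move: AM => /space_N7[z [a01 [u10 [u11 [u21 [u31 [u32 ->]]]]]]] /unit_coframe[] // -> -> -> -> _.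
  by rewrite mulr1; exists z, a01, u32.
have s0 x : W x -> s x (i7 0) 0 = 0.
  by move=> Wx; have [z [a01 [u32]]] := e1 _ _ s1 Wx; rewrite g2_row s1 // s4 // !simp.
have s3 x : W x -> s x (i7 3) 0 = 0.
  move=> Wx; have [z [a01 [u32]]] := e1 _ _ s4 Wx; rewrite g2_row s0 // s4 // s1 // !simp => /eqP.
  by rewrite mulf_eq0 (negbTE (r2_neq0 R)) => /eqP.
have s2 x : W x -> s x (i7 2) 0 = 0.
  move=> Wx; have [z [a01 [u32]]] := e1 _ _ s3 Wx; rewrite g2_row s0 // s4 // s1 // !simp => /eqP.
  by rewrite mulf_eq0 (negbTE (r2_neq0 R)) oppr_eq0 => /eqP.
move=> x Wx [[|[|[|[|[|k]]]]] lk] // _; rewrite -[RHS](s0 x Wx).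
- by congr (s x _ _); apply: val_inj.
- by rewrite s0 // -(s1 x Wx); congr (s x _ _); apply: val_inj.
- by rewrite s0 // -(s2 x Wx); congr (s x _ _); apply: val_inj.
- by rewrite s0 // -(s3 x Wx); congr (s x _ _); apply: val_inj.
- by rewrite s0 // -(s4 x Wx); congr (s x _ _); apply: val_inj.
Qed.

Lemma vec7_eq0 (v : vec) : v (i7 0) 0 = 0 -> v (i7 1) 0 = 0 -> v (i7 2) 0 = 0 -> v (i7 3) 0 = 0 ->
  v (i7 4) 0 = 0 -> v (i7 5) 0 = 0 -> v (i7 6) 0 = 0 -> v = 0.
Proof.
move=> h0 h1 h2 h3 h4 h5 h6; apply/colP => -[[|[|[|[|[|[|[|//]]]]]]] lk]; rewrite mxE.
- by rewrite -[RHS]h0; congr (v _ _); apply: val_inj.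
- by rewrite -[RHS]h1; congr (v _ _); apply: val_inj.
- by rewrite -[RHS]h2; congr (v _ _); apply: val_inj.
- by rewrite -[RHS]h3; congr (v _ _); apply: val_inj.
- by rewrite -[RHS]h4; congr (v _ _); apply: val_inj.
- by rewrite -[RHS]h5; congr (v _ _); apply: val_inj.
- by rewrite -[RHS]h6; congr (v _ _); apply: val_inj.
Qed.

Let solve_N6 (r a b c d e : C) : r != 0 -> - 12 * a + r * - 6 * b = 0 ->
  - 40 * a + r * - 24 * b + 6 * c = 0 -> - 30 * a + r * - 20 * b + 8 * c = 0 ->
  - (- 4 * e) = 0 -> - 4 * d = 0 -> [/\ a = 0, b = 0, d = 0, c = 0 & e = 0].
Proof.
move=> r0 h3 h2 h1 he hd.
have num n (z : C) : n.+1%:R * z = 0 -> z = 0 by move/eqP; rewrite mulf_eq0 pnatr_eq0 => /eqP.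
have a0 : a = 0.
  apply: (num 1).
  transitivity (4 * (- 40 * a + r * - 24 * b + 6 * c) - 3 * (- 30 * a + r * - 20 * b + 8 * c) -
       6 * (- 12 * a + r * - 6 * b)); first by ring.
  by rewrite h1 h2 h3 !mulr0 !subr0.
have b0 : b = 0.
  by apply: (mulfI r0); rewrite mulr0; apply: (num 5%N); rewrite -[RHS]oppr0 -h3 a0; ring.
split=> //; last by apply: (num 3%N); rewrite -[RHS]he; ring.
- by apply: (num 3%N); rewrite -[RHS]oppr0 -hd; ring.
- by apply: (num 7%N); rewrite -[RHS]h1 a0 b0; ring.
Qed.

(** The values of kappa kill coordinates 1, 3, 4, 5, 6 (counted from 0); deriving
coordinate 4 and then coordinate 0 in the direction of f_31 gives the other two. *)
Lemma parallel_N6 K iota gr : @parallel_in K iota gr (modelN6 R) (fun v => v = 0).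
Proof.
move=> Th U W s cc oW WU ps.
have aM := admissible_N6 R.
have H x : W x -> [/\ s x (i7 1) 0 = 0, s x (i7 3) 0 = 0, s x (i7 4) 0 = 0, s x (i7 5) 0 = 0 & s x (i7 6) 0 = 0].
  move=> Wx; have := fun A B => curv_kills aM cc oW WU ps A B Wx.
  rewrite curv_N6 => /wcurv_pairs[k1 k2 _ _ [k5 _ k7]].
  have := row_eq0 (i7 0) k2; have := row_eq0 (i7 2) k2.
  have := row_eq0 (i7 0) k1; have := row_eq0 (i7 0) k5; have := row_eq0 (i7 0) k7.
  rewrite !g2_row !simp; exact: solve_N6 (r2_neq0 R).
have e4 k x : (forall x, W x -> s x k 0 = 0) -> W x -> exists t,
    (g2mx (- 2) 1 t 0 0 0 1 0 0 0 (- 1) 0 (- 4) 0 *m s x) k 0 = 0.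
  move=> sk Wx; have [A [AM]] := derive_coord cc oW WU ps sk (fun a => (a == o 3)%:R) Wx.
  move: AM => /space_N6[t [u10 [u11 [u21 [u31 [u32 ->]]]]]] /unit_coframe[] // -> -> -> -> ->.
  by rewrite /= !simp; exists t.
have s0 x : W x -> s x (i7 0) 0 = 0.
  have s4 y : W y -> s y (i7 4) 0 = 0 by move=> /H[].
  move=> Wx; have [t] := e4 _ _ s4 Wx; have [h1 h3 h4 h5 h6] := H x Wx.
  by rewrite g2_row h1 h3 h4 h5 h6 !simp.
move=> x Wx; have [h1 h3 h4 h5 h6] := H x Wx.
apply: vec7_eq0 => //; first exact: s0.
have [t] := e4 _ _ s0 Wx; rewrite g2_row h1 h3 h4 h5 s0 // !simp mulN1r => /eqP.
by rewrite oppr_eq0 => /eqP.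
Qed.

Let solve_D6 (r a q s0 s3 s6 : C) : r != 0 -> s0 + r * a * s3 - s6 = 0 -> r * s3 - q * s6 = 0 ->
  (8 * a / 3) * s6 = 0 -> a != 0 -> [/\ s0 = 0, s3 = 0 & s6 = 0].
Proof.
move=> r0 h1 h2 h3 a0.
have z6 : s6 = 0.
  by move: h3 => /eqP; rewrite !mulf_eq0 invr_eq0 !pnatr_eq0 (negbTE a0) => /eqP.
have z3 : s3 = 0 by move: h2; rewrite z6 mulr0 subr0 => /eqP; rewrite mulf_eq0 (negbTE r0) => /eqP.
by split=> //; move: h1; rewrite z3 z6 mulr0 addr0 subr0.
Qed.

(** As kappa takes the values e_01 and f_01, coordinates 1, 2, 4, 5 (counted from 0)
vanish; deriving coordinate 1 relates the remaining three. The last relation is void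
for a = 0. *)
Lemma parallel_D6 a K iota gr : @parallel_in K iota gr (modelD6 a) (fun v =>
  [/\ v (i7 1) 0 = 0, v (i7 2) 0 = 0, v (i7 4) 0 = 0, v (i7 5) 0 = 0 &
  [/\ v (i7 0) 0 + sqrtC 2 * a * v (i7 3) 0 - v (i7 6) 0 = 0,
      sqrtC 2 * v (i7 3) 0 - qD6 a * v (i7 6) 0 = 0 & (8 * a / 3) * v (i7 6) 0 = 0]]).
Proof.
move=> Th U W s cc oW WU ps.
have aM := admissible_D6 a.
have H x : W x -> [/\ s x (i7 1) 0 = 0, s x (i7 2) 0 = 0, s x (i7 4) 0 = 0, s x (i7 5) 0 = 0 &
    (8 * a / 3) * s x (i7 6) 0 = 0].
  move=> Wx; have := fun A B => curv_kills aM cc oW WU ps A B Wx.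
  rewrite curv_D6 => /wcurv_pairs[k1 _ _ k4 [k5 _ _]].
  have := row_eq0 (i7 1) k1; have := row_eq0 (i7 4) k1; have := row_eq0 (i7 2) k4; have := row_eq0 (i7 5) k4.
  have := row_eq0 (i7 4) k5.
  have num n (z : C) : n.+1%:R * z = 0 -> z = 0 by move/eqP; rewrite mulf_eq0 pnatr_eq0 => /eqP.
  have numN n (z : C) : - (n.+1%:R * z) = 0 -> z = 0 by move=> /eqP; rewrite oppr_eq0 => /eqP /num.
  rewrite !g2_row !simp => h6 /(numN 3%N) h4 /(num 3%N) h1 /(numN 3%N) h5 /(num 3%N) h2; split => //.
  by move: h6 => /eqP; rewrite oppr_eq0 => /eqP.
have s1 x : W x -> s x (i7 1) 0 = 0 by move=> /H[].
move=> x Wx; have [h1 h2 h4 h5 h6] := H x Wx; split=> //; split=> //.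
  have [A [AM]] := derive_coord cc oW WU ps s1 (fun b => (b == o 0)%:R) Wx.
  move: AM => /space_D6[t [u10 [u11 [u21 [u31 [u32 ->]]]]]] /unit_coframe[] // -> -> -> -> ->.
  by rewrite g2_row h1 h2 h4 /= !simp.
have [A [AM]] := derive_coord cc oW WU ps s1 (fun b => (b == o 3)%:R) Wx.
move: AM => /space_D6[t [u10 [u11 [u21 [u31 [u32 ->]]]]]] /unit_coframe[] // -> -> -> -> ->.
by rewrite g2_row h1 h2 h4 /= !simp.
Qed.

Lemma no_scales_N6 : complex_no_scales (modelN6 R) /\ real_forms_no_scales (modelN6 R).
Proof. by apply: no_scales_of (admissible_N6 R) _ => K iota gr; exact: parallel_N6. Qed.

Lemma no_scales_D6 (a : C) : a != 0 -> complex_no_scales (modelD6 a) /\ real_forms_no_scales (modelD6 a).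
Proof.
move=> a0; apply: no_scales_of (admissible_D6 a) _ => K iota gr Th U W s cc oW WU ps x Wx.
have [h1 h2 h4 h5 [k1 k2 k3]] := parallel_D6 cc oW WU ps Wx.
have [h0 h3 h6] := solve_D6 (r2_neq0 R) k1 k2 k3 a0.
exact: vec7_eq0.
Qed.

(** The model algebra preserves span (e_6, e_7), acting through Z_2 and f_10 + c e_10
alone, and f_01 kills it. *)
Lemma scales_N7 (c : C) : complex_scales_dim (modelN7 c) 2 /\ real_forms_scales_dim (modelN7 c) 2.
Proof.
pose N : 'M[C]_(7, 2) := \matrix_(i, j) (i == rshift 5 j)%:R.
have AN m (A : 'M[C]_(m, 7)) i j : (A *m N) i j = A i (rshift 5 j).
  rewrite mxE (bigD1 (rshift 5 j)) //= big1 ?addr0; first by rewrite mxE eqxx mulr1.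
  by move=> l lj; rewrite mxE (negbTE lj) mulr0.
have proj n (v : 'M[C]_(7, n)) : (forall (k : 'I_7) j, (k < 5)%N -> v k j = 0) -> N *m (N^T *m v) = v.
  move=> v0; have NTv i j : (N^T *m v) i j = v (rshift 5 i) j.
    have := AN _ v^T j i; rewrite [RHS]mxE => <-.
    by have /(congr1 (fun B : 'M[C]_(n, 2) => B j i)) := trmx_mul N^T v; rewrite trmxK mxE.
  apply/matrixP => k j; rewrite mxE; under eq_bigr => i _ do rewrite NTv mxE.
  case: (@split_ordP 5 2 k) => l ->.
    have -> : v (lshift 2 l) j = 0 by apply: v0; exact: (ltn_ord l).
    by apply: big1 => i _; rewrite eq_lrshift mul0r.
  rewrite (bigD1 l) //= eqxx mul1r big1 ?addr0 // => i il.
  by rewrite eq_rshift eq_sym (negbTE il) mul0r.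
have f01N : f01 R *m N = 0.
  apply/matrixP => k j; rewrite AN !mxE.
  by case: k => [[|[|[|[|[|[|[|//]]]]]]] ?]; case: j => [[|[|//]] ?]; rewrite /= ?(mulr0, oppr0, subr0).
apply: (@scales_dim_of _ 2 N N^T (admissible_N7 c)).
- by apply/matrixP => i j; rewrite AN !mxE eq_rshift eq_sym.
- move=> A /space_N7[z [a01 [u10 [u11 [u21 [u31 [u32 ->]]]]]]]; rewrite -mulmxA proj // => k j lk.
  rewrite AN !mxE; move: lk.
  by case: k => [[|[|[|[|[|[|[|//]]]]]]] ?]; case: j => [[|[|//]] ?]; rewrite //= ?(mulr0, oppr0).
- by move=> x y; rewrite curv_N7 /wcurv !scaler0 !addr0 -scalemxAl f01N scaler0.
- move=> K iota gr Th U W s cc oW WU ps x Wx; rewrite proj // => k j lk.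
  by have H := parallel_N7 cc oW WU ps Wx; rewrite (ord1 j); exact: H.
Qed.

(** Every element of the model algebra and every value of kappa kills e_1 + e_7. *)
Lemma scales_D6 : complex_scales_dim (modelD6 (0 : C)) 1 /\ real_forms_scales_dim (modelD6 (0 : C)) 1.
Proof.
pose N : vec := delta_mx (i7 0) 0 + delta_mx (i7 6) 0.
have N'E n (A : 'M[C]_(7, n)) : (delta_mx 0 (i7 0) : 'rV[C]_7) *m A = row (i7 0) A by rewrite rowE.
have AN z1 z2 a01 b01 a10 a11 a21 a31 a32 : 2 * z1 + z2 = 0 ->
  g2mx z1 z2 a01 a10 a11 a21 a31 a32 b01 a32 a31 a21 a11 a10 *m N = 0.
  move=> z0; rewrite mulmxDr -!colE; apply/colP => k; rewrite !mxE.
  case: k => [[|[|[|[|[|[|[|//]]]]]]] ?]; rewrite /= ?addr0 ?subrr ?z0 //.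
  by rewrite -opprD z0 oppr0 add0r.
have q0 : qD6 (0 : C) = 0 by rewrite /qD6 mul0r.
have zz (a : C) : 2 * - a + 2 * a = 0 by ring.
have z4 : 2 * 4 + - 8 = 0 :> C by ring.
have z4' : 2 * - 4 + 8 = 0 :> C by ring.
have AN0 A : A \in mspace (modelD6 (0 : C)) -> A *m N = 0.
  move=> /space_D6[t [u10 [u11 [u21 [u31 [u32 ->]]]]]].
  by rewrite q0 expr0n /= !simp; apply: AN.
apply: (@scales_dim_of _ 1 N (delta_mx 0 (i7 0)) (admissible_D6 0)).
- by rewrite N'E; apply/matrixP => i j; rewrite !mxE !ord1 /= addr0.
- by move=> A AM; rewrite -mulmxA AN0 // !mulmx0.
- move=> x y; rewrite curv_D6 /wcurv expr0n /= !simp.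
  have N1 : g2mx 0 0 0 0 0 0 0 0 4 0 0 0 0 0 *m N = 0 by apply: AN; rewrite mulr0 addr0.
  have N2 : g2mx 4 (-8) 0 0 0 0 0 0 0 0 0 0 0 0 *m N = 0 by apply: AN.
  have N3 : g2mx (-4) 8 0 0 0 0 0 0 0 0 0 0 0 0 *m N = 0 by apply: AN.
  have N4 : g2mx 0 0 4 0 0 0 0 0 0 0 0 0 0 0 *m N = 0 by apply: AN; rewrite mulr0 addr0.
  have N5 : g2mx 0 0 0 0 0 0 0 0 0 0 0 0 0 0 *m N = 0 by apply: AN; rewrite mulr0 addr0.
  by rewrite !mulmxDl -!scalemxAl N1 N2 N3 N4 N5 !scaler0 !addr0.
move=> K iota gr Th U W s cc oW WU ps x Wx.
have [h1 h2 h4 h5 [k1 k2 _]] := parallel_D6 cc oW WU ps Wx.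
move: k1 k2; rewrite q0 mulr0 !simp => k1 /eqP; rewrite mulf_eq0 (negbTE (r2_neq0 R)) => /eqP h3.
move: k1 => /eqP; rewrite subr_eq0 => /eqP h0.
apply/eqP; rewrite -subr_eq0; apply/eqP; rewrite N'E.
have NE k : (s x - N *m row (i7 0) (s x)) k 0 = s x k 0 - N k 0 * s x (i7 0) 0.
  by rewrite [LHS]mxE [X in _ + X]mxE [X in _ - X]mxE big_ord1 [X in _ * X]mxE.
by apply: vec7_eq0; rewrite NE !mxE /= ?h1 ?h2 ?h3 ?h4 ?h5 -?h0 ?mulr0n ?simp ?mul1r ?subrr ?mul0r ?subr0.
Qed.
End Results.

Theorem theorem7p4 (R : realType) :
  (complex_no_scales (modelN6 R) /\ real_forms_no_scales (modelN6 R)) /\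
  (forall a : R[i], a != 0 ->
     complex_no_scales (modelD6 a) /\ real_forms_no_scales (modelD6 a)) /\
  (complex_scales_dim (flat_model R) 7 /\
   real_forms_scales_dim (flat_model R) 7) /\
  (forall c : R[i],
     complex_scales_dim (modelN7 c) 2 /\ real_forms_scales_dim (modelN7 c) 2) /\
  (complex_scales_dim (modelD6 (0 : R[i])) 1 /\
   real_forms_scales_dim (modelD6 (0 : R[i])) 1).
Proof.
split; first exact: no_scales_N6.
split; first exact: no_scales_D6.
split; first exact: scales_flat.
split; first exact: scales_N7.
exact: scales_D6.
Qed.
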